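(* Let $n\ge 1$, $N\ge 0$ and $0\le m\le n$ be integers and let $z=(z_1,\dots,z_n)$, $w_1,w_2$ and $a_1,\dots,a_{n+2}$ be nonzero complex parameters satisfying $$w_1w_2=z_1\cdots z_n\,a_1\cdots a_{n+2}.$$ Define $x=(x_1,\dots,x_n)$ and $b=(b_1,\dots,b_{n+2})$ by $$x=(q^{1-N}a_1/w_1w_2,\dots,q^{1-N}a_{n-m}/w_1w_2,\,z_{n-m+1},\dots,z_n),$$ $$b=(q^{N-1}w_1w_2z_1,\dots,q^{N-1}w_1w_2z_{n-m},\,a_{n-m+1},\dots,a_{n+2}).$$ Assume that no denominator in the identity below vanishes. Then $$\sum_{\substack{y_1,\dots,y_n\geq 0\\ y_1+\dots+y_n=N}} \frac{\Delta(zq^y)}{\Delta(z)}\prod_{k=1}^n\frac{\prod_{j=1}^{n+2}(a_jz_k)_{y_k}} {\prod_{j=1}^2(w_jz_k)_{y_k}\prod_{j=1}^n(qz_k/z_j)_{y_k}}$$ $$=\prod_{j=1}^{n-m}\frac{(a_jz_j)^N(w_1/a_j)_N(w_2/a_j)_N} {(w_1z_j)_N(w_2z_j)_N}\sum_{\substack{y_1,\dots,y_n\geq 0\\ y_1+\dots+y_n=N}} \frac{\Delta(xq^y)}{\Delta(x)}\prod_{k=1}^n\frac{\prod_{j=1}^{n+2}(b_jx_k)_{y_k}} {\prod_{j=1}^2(w_jx_k)_{y_k}\prod_{j=1}^n(qx_k/x_j)_{y_k}},$$ where the summation indices $y_k$ are integers. Here $(a_jz_j)^N$ is an ordinary power.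
   Context: Fix complex numbers $p$ with $|p|<1$ and $q\neq 0$. The theta function is $\theta(x)=\prod_{j=0}^\infty(1-p^jx)(1-p^{j+1}/x)$ for $x\neq 0$. The elliptic Pochhammer symbol is $(a)_k=\theta(a)\theta(aq)\cdots\theta(aq^{k-1})$ for integers $k\ge 0$, with $(a)_0=1$. For a vector $z=(z_1,\dots,z_n)$ put $\Delta(z)=\prod_{1\le j<k\le n}z_j\,\theta(z_k/z_j)$ (equal to $1$ if $n=1$), and for $y=(y_1,\dots,y_n)$ let $zq^y=(z_1q^{y_1},\dots,z_nq^{y_n})$, so that $$\frac{\Delta(zq^y)}{\Delta(z)}=\prod_{1\le j<k\le n}q^{y_j}\frac{\theta(z_kq^{y_k}/z_jq^{y_j})}{\theta(z_k/z_j)}.$$ Notation such as $q^{1-N}a_1/w_1w_2$ means $q^{1-N}a_1/(w_1w_2)$. Empty products equal $1$. *)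

(* Defs.v *)
From mathcomp Require Import all_boot all_order all_algebra.
From mathcomp Require Import all_classical all_reals all_analysis.
From mathcomp Require Import complex.

Set Implicit Arguments.
Unset Strict Implicit.
Unset Printing Implicit Defensive.

Import Order.TTheory GRing.Theory Num.Theory numFieldNormedType.Exports.
Local Open Scope ring_scope.

(* The definitions are over an arbitrary numFieldType C, whose norm topology is
   the library's; they are meant for C := R[i] with R : realType, where the
   infinite product below converges whenever `|p| < 1. At x = 0 the value is
   meaningless, as x^-1 = 0 there. *)
Definition theta {C : numFieldType} (p x : C) : C :=
  limn (fun M : nat =>
    \prod_(j < M) ((1 - p ^+ j * x) * (1 - p ^+ j.+1 / x)) : C).

Definition epoch {C : numFieldType} (p q a : C) (k : nat) : C :=
  \prod_(i < k) theta p (a * q ^+ i).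

Definition Delta {C : numFieldType} (p : C) {n : nat} (z : 'I_n -> C) : C :=
  \prod_(j < n) \prod_(k < n | (j < k)%N) (z j * theta p (z k / z j)).

Definition qshift {C : numFieldType} (q : C) {n : nat}
    (z : 'I_n -> C) (y : 'I_n -> nat) : 'I_n -> C :=
  fun k => z k * q ^+ y k.

Definition factor_den {C : numFieldType} (p q w1 w2 : C) {n : nat}
    (z : 'I_n -> C) (y : 'I_n -> nat) (k : 'I_n) : C :=
  epoch p q (w1 * z k) (y k) * epoch p q (w2 * z k) (y k)
  * \prod_(j < n) epoch p q (q * z k / z j) (y k).

Definition summand {C : numFieldType} (p q w1 w2 : C) {n : nat}
    (a : 'I_(n + 2) -> C) (z : 'I_n -> C) (y : 'I_n -> nat) : C :=
  Delta p (qshift q z y) / Delta p z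
  * \prod_(k < n) ((\prod_(j < n + 2) epoch p q (a j * z k) (y k))
                   / factor_den p q w1 w2 z y k).

(* The entries of a composition y of N are at most N, so the compositions are
   the finite functions into 'I_N.+1 with sum N. *)
Definition composition_sum {C : numFieldType} (p q w1 w2 : C) {n : nat}
    (N : nat) (a : 'I_(n + 2) -> C) (z : 'I_n -> C) : C :=
  \sum_(y : {ffun 'I_n -> 'I_N.+1} | (\sum_(k < n) y k == N)%N)
    summand p q w1 w2 a z (fun k => y k).

Definition nonzero_denominators {C : numFieldType} (p q w1 w2 : C) {n : nat}
    (N : nat) (z : 'I_n -> C) : Prop :=
  Delta p z != 0 /\
  forall y : 'I_n -> nat, (\sum_(k < n) y k)%N = N ->
    forall k : 'I_n, factor_den p q w1 w2 z y k != 0.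

(* Indices are 0-based: the first n - m entries are those with k < n - m. *)
Definition new_x {C : numFieldType} (q w1 w2 : C) {n : nat} (N m : nat)
    (a : 'I_(n + 2) -> C) (z : 'I_n -> C) : 'I_n -> C :=
  fun k => if (k < n - m)%N then q ^ (1 - N%:Z) * a (lshift 2 k) / (w1 * w2)
           else z k.

Definition new_b {C : numFieldType} (q w1 w2 : C) {n : nat} (N m : nat)
    (a : 'I_(n + 2) -> C) (z : 'I_n -> C) : 'I_(n + 2) -> C :=
  fun j => match fintype.split j with
           | inl k => if (k < n - m)%N then q ^ (N%:Z - 1) * w1 * w2 * z k
                      else a j
           | inr _ => a j
           end.

(* Main.v *)
Require Import Defs.
From mathcomp Require Import all_boot all_order all_algebra.
From mathcomp Require Import all_classical all_reals all_analysis.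
From mathcomp Require Import complex ring zify.

(* By the Kajihara-Noumi duality, the n-dimensional sum on either side equals a
   2-dimensional sum over y_1 + y_2 = N that involves the parameters only through
   w_k / a_j and w_k z_j. Reversing the order of the factors of the elliptic
   Pochhammer symbols shows that exchanging (a_j, z_j) for (b_j, x_j) multiplies
   each term of this 2-dimensional sum by the same factor.

   The duality is proved by induction on N. Both of its sides satisfy the same
   recursion in N, with shifts a_l -> q a_l and w_i -> q w_i, which follows from the
   elliptic partial fraction identity. That identity comes from the three-term
   addition formula: by the Jacobi triple product, a constant multiple of
   theta(xy) theta(x/y) has the form x (A(x) B(y) - B(x) A(y)), and the addition
   formula is the Pluecker relation for such 2 x 2 minors.

   These arguments divide by theta(w_1 / w_2) and the like, which may vanish, so the
   identity is first proved for the parameters w_1 t, w_2 / t, a_{n+1} t^2,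
   a_{n+2} / t^2 and then extended to t = 1 by continuity. *)

Set Implicit Arguments.
Unset Strict Implicit.
Unset Printing Implicit Defensive.

Import Order.TTheory GRing.Theory Num.Theory numFieldNormedType.Exports.
Local Open Scope ring_scope.
Local Open Scope classical_set_scope.

(** * Laws of the theta function *)

(** In the n-dimensional sum every z_j interacts with all the others. In the dual sum each pair
    (a_j, z_j) with j <= n contributes a separate factor, so the pairs can be exchanged one at a
    time. Dimension 2 matters because y_1 + y_2 = N makes the two lengths complementary, which is
    what reversing a symbol requires.

    The recursion comes from expanding theta(q^N) in partial fractions so that the k-th term
    vanishes at y_k = 0; the surviving terms are indexed by compositions of N - 1. On the z side the
    result runs over the poles z_k q^{y_k}, and a second expansion carries it to the poles 1/w_i. On
    the w side the first expansion already has these poles.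

    Addition formulas and partial fractions are usually proved by comparing zeros and quasi-periods
    of holomorphic functions. Here all the algebra rests on the four laws below, of which only
    continuity and the isolation of zeros are analytic. The laws are derived from estimates for the
    product and from the series of theta, summed unconditionally so that a product of two series can
    be rearranged over pairs of integers. *)

Record theta_laws (C : numFieldType) (th : C -> C) : Prop := ThetaLaws {
  thetaV : forall x : C, x != 0 -> th x^-1 = - th x / x;
  (* With c = x^2, A = xy, U = xu, V = xv, this is the addition formula for
     theta(xy) theta(x/y), written without square roots. *)
  theta_three_term : forall A U V c : C, A != 0 -> U != 0 -> V != 0 -> c != 0 ->
    th A * th (c / A) * th (U * V / c) * th (U / V) / U
    - th U * th (c / U) * th (A * V / c) * th (A / V) / A
    + th V * th (c / V) * th (A * U / c) * th (A / U) / A = 0;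
  theta_continuous : forall x : C, x != 0 -> {for x, continuous th};
  theta_near1_neq0 : forall c : C, c != 0 -> \forall t \near (1 : C)^', th (c * t) != 0
}.

Ltac nz := intros; solve [repeat first
  [assumption | done | apply: mulf_neq0 | apply: invr_neq0 | apply: expf_neq0]].

(** * Continuity and punctured neighbourhoods of 1 *)

Section Continuity.
Variable C : numFieldType.
Implicit Types F : C -> C.

(** Every genericity assumption is removed through this: an identity is checked for parameters
    perturbed by t close to 1 but different from 1, where the denominators do not vanish. *)
Lemma near1_eq0 F : {for (1 : C), continuous F} ->
  (\forall t \near (1 : C)^', F t = 0) -> F 1 = 0.
Proof.
move=> cF F0.
have h1 : F t @[t --> (1:C)^'] --> F 1 by exact: cvg_trans (cvg_app _ (@nbhs_dnbhs _ _)) cF.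
have h2 : F t @[t --> (1:C)^'] --> (0 : C).
  apply: (@cvg_trans _ ((fun=> (0 : C)) t @[t --> (1:C)^'])); last exact: cvg_cst.
  by apply: near_eq_cvg; apply: filterS F0 => t ->.
by apply: (cvg_unique _ h1 h2); exact: norm_hausdorff.
Qed.

Lemma continuous_sum (I : Type) (r : seq I) (P : pred I) (F : I -> C -> C) (x : C) :
  (forall i, P i -> {for x, continuous (F i)}) ->
  {for x, continuous (fun t => \sum_(i <- r | P i) F i t)}.
Proof. by move=> cF; apply: (@cvg_big _ _ _ _ P (@add_continuous C) _ (nbhs x) r F (F^~ x)). Qed.

Lemma continuous_prod (I : Type) (r : seq I) (P : pred I) (F : I -> C -> C) (x : C) :
  (forall i, P i -> {for x, continuous (F i)}) ->
  {for x, continuous (fun t => \prod_(i <- r | P i) F i t)}.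
Proof. by move=> cF; apply: (@cvg_big _ _ _ _ P (@mul_continuous C) _ (nbhs x) r F (F^~ x)). Qed.

Lemma cont_mul (f g : C -> C) (x : C) : {for x, continuous f} ->
  {for x, continuous g} -> {for x, continuous (fun t => f t * g t)}.
Proof. exact: continuousM. Qed.

Lemma cont_sub (f g : C -> C) (x : C) : {for x, continuous f} ->
  {for x, continuous g} -> {for x, continuous (fun t => f t - g t)}.
Proof. exact: continuousB. Qed.

Lemma cont_inv (f : C -> C) (x : C) : f x != 0 ->
  {for x, continuous f} -> {for x, continuous (fun t => (f t)^-1)}.
Proof. exact: continuousV. Qed.

Lemma cont_cst (c x : C) : {for x, continuous (fun=> c)}.
Proof. exact: cst_continuous. Qed.

Lemma cont_id (x : C) : {for x, continuous (fun t => t)}.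
Proof. by []. Qed.

End Continuity.

Section Near.
Variable C : numFieldType.

Lemma near1_comp (f : C -> C) (P : C -> Prop) : {for (1 : C), continuous f} -> f 1 = 1 ->
  (\forall t \near (1 : C)^', f t != 1) -> (\forall s \near (1 : C)^', P s) ->
  \forall t \near (1 : C)^', P (f t).
Proof.
move=> cf f1 nf nP.
have : \forall t \near (1 : C)^', f t != 1 -> P (f t).
  apply: (@nbhs_dnbhs _ (1:C)).
  have h : nbhs (f 1) (fun s => s != 1 -> P s) by rewrite f1.
  exact: (cf _ h).
by move: nf; apply: filterS2 => t h1 h2; exact: (h2 h1).
Qed.

Lemma continuous_exprn k (x : C) : {for x, continuous (fun t : C => t ^+ k)}.
Proof.
elim: k => [|k IH]; first exact: cont_cst.
have -> : (fun t : C => t ^+ k.+1) = (fun t => t * t ^+ k) by apply/funext => t; rewrite exprS.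
by apply: cont_mul; first exact: cont_id.
Qed.

Lemma near1_neq0 (f : C -> C) : {for (1 : C), continuous f} -> f 1 != 0 ->
  \forall t \near (1 : C)^', f t != 0.
Proof.
move=> cf f1; apply: (@nbhs_dnbhs _ (1:C)).
exact: (@cvgr_neq0 _ _ _ (nbhs (1:C)) _ _ _ cf f1).
Qed.

(** In t^(k+1) - 1 = (t - 1)(1 + t + ... + t^k) the second factor is continuous and equals k + 1 at
    t = 1, which is nonzero in characteristic 0. *)
Lemma near1_expr_neq1 k : \forall t \near (1 : C)^', t ^+ k.+1 != 1.
Proof.
have c : {for (1 : C), continuous (fun t : C => \sum_(i < k.+1) t ^+ i)}.
  by apply: continuous_sum => i _; apply: continuous_exprn.
have s1 : \sum_(i < k.+1) (1 : C) ^+ i != 0.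
  under eq_bigr do rewrite expr1n.
  by rewrite sumr_const card_ord pnatr_eq0.
have : \forall t \near (1 : C)^', \sum_(i < k.+1) t ^+ i != 0 by exact: near1_neq0.
have h : \forall t \near (1 : C)^', t != 1.
  exact: (@nbhs_dnbhs_neq _ (1:C)).
by move: h; apply: filterS2 => t t1 ts; rewrite -subr_eq0 subrX1 mulf_neq0 // subr_eq0.
Qed.

Lemma near1_expr (P : C -> Prop) k : (\forall s \near (1 : C)^', P s) ->
  \forall t \near (1 : C)^', P (t ^+ k.+1).
Proof.
apply: near1_comp; [exact: continuous_exprn|exact: expr1n|exact: near1_expr_neq1].
Qed.

Lemma near1_exprV (P : C -> Prop) k : (\forall s \near (1 : C)^', P s) ->
  \forall t \near (1 : C)^', P (t ^- k.+1).
Proof.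
apply: near1_comp; [|by rewrite expr1n invr1|].
  by apply: cont_inv; [rewrite expr1n oner_neq0|exact: continuous_exprn].
by apply: filterS (near1_expr_neq1 k) => t; apply: contra => /eqP h; rewrite -[t ^+ _]invrK h invr1.
Qed.

End Near.

(** * Elliptic partial fractions *)

Section PartialFractions.
Variables (C : numFieldType) (th : C -> C).
Hypothesis thP : theta_laws th.

Lemma theta1 : th 1 = 0.
Proof.
have := thetaV thP (oner_neq0 C); rewrite invr1 mulr1 => /eqP.
by rewrite -addr_eq0 -mulr2n mulrn_eq0 /= => /eqP.
Qed.

Lemma thetaVE x : x != 0 -> th x = - th x^-1 * x.
Proof. by move=> x0; rewrite (thetaV thP x0); field. Qed.

Lemma theta_continuous_comp (f : C -> C) (x : C) : f x != 0 ->
  {for x, continuous f} -> {for x, continuous (fun t => th (f t))}.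
Proof. by move=> fx cf; apply: continuous_comp => //; exact: theta_continuous. Qed.

(** Up to a factor independent of k, the residue at x = a_k of prod_j theta(x/b_j)/theta(x/a_j) with
    respect to dx/x. *)
Definition pf_coef n (a b : 'I_n -> C) (k : 'I_n) : C :=
  \prod_j th (a k / b j) / \prod_(j | j != k) th (a k / a j).

(** The partial fraction identity with the two poles [a], [c] and the two zeros [b], [c / t]. It is
    the addition formula at A = x/b, U = x/a, V = x/c. *)
Lemma pf_step (a b x t c : C) : a != 0 -> b != 0 -> c != 0 -> x != 0 -> t != 0 ->
  th (x / a) != 0 -> th (x / c) != 0 -> th (c / a) != 0 ->
  th (t * a / b) * (th (x * t / c) / th (x / c)) * (th (x / b) / th (x / a)) =
  th t * (th (c / b) / th (c / a)) * (th (x * (t * a / b) / c) / th (x / c)) +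
  (th (a / b) * (th (x * (t * a / b) / a) / th (x / a))) * (th (a * t / c) / th (a / c)).
Proof.
move=> a0 b0 c0 x0 t0 xa xc ca.
have ac : th (a / c) != 0.
  have h : a / c != 0 by nz.
  by rewrite (thetaVE h) invf_div mulf_neq0 // oppr_eq0.
have k0 : x * x * t / (c * b) != 0 by nz.
have := theta_three_term thP (A := x / b) (U := x / a) (V := x / c) (c := x * x * t / (c * b)).
move/(_ ltac:(nz) ltac:(nz) ltac:(nz) ltac:(nz)).
have -> : x * x * t / (c * b) / (x / b) = x * t / c by field; rewrite ?(a0, b0, c0, x0, t0).
have -> : x / a * (x / c) / (x * x * t / (c * b)) = (t * a / b)^-1 by field; rewrite ?(a0, b0, c0, x0, t0).
have -> : x / a / (x / c) = c / a by field; rewrite ?(a0, b0, c0, x0, t0).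
have -> : x * x * t / (c * b) / (x / a) = x * (t * a / b) / c by field; rewrite ?(a0, b0, c0, x0, t0).
have -> : x / b * (x / c) / (x * x * t / (c * b)) = t^-1 by field; rewrite ?(a0, b0, c0, x0, t0).
have -> : x / b / (x / c) = c / b by field; rewrite ?(a0, b0, c0, x0, t0).
have -> : x * x * t / (c * b) / (x / c) = x * (t * a / b) / a by field; rewrite ?(a0, b0, c0, x0, t0).
have -> : x / b * (x / a) / (x * x * t / (c * b)) = (a * t / c)^-1 by field; rewrite ?(a0, b0, c0, x0, t0).
have -> : x / b / (x / a) = a / b by field; rewrite ?(a0, b0, c0, x0, t0).
have t'0 : t * a / b != 0 by nz.
have atc : a * t / c != 0 by nz.
rewrite (thetaV thP t'0) (thetaV thP t0) (thetaV thP atc).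
have hca : th (c / a) = - th (a / c) * (c / a).
  have h : c / a != 0 by nz.
  by rewrite (thetaVE h) invf_div.
rewrite hca in ca *.
set P := th (x / b); set Q := th (x * t / c); set T' := th _.
set D := th (a / c) in ac ca *.
set E := th (x / a) in xa *; set G := th (x * (t * a / b) / c); set H := th t; set J := th (c / b).
set K := th (x / c) in xc *; set L := th (x * (t * a / b) / a); set M := th (a * t / c); set N := th (a / b).
move=> e.
apply/eqP; rewrite -subr_eq0; apply/eqP.
(* Cleared of its theta denominators, the difference of the two sides is a monomial times the
   addition formula [e]. *)
have : K * E * D * x *
  (T' * (Q / K) * (P / E) - (H * (J / (- D * (c / a))) * (G / K) + N * (L / E) * (M / D))) = 0.
  rewrite -[RHS](mulr0 (x * x * t * a / (c * b))) -e.
  field.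
  by rewrite a0 b0 c0 x0 t0 xa xc ac.
by move=> /eqP; rewrite !mulf_eq0 (negbTE xc) (negbTE xa) (negbTE ac) (negbTE x0) /= => /eqP.
Qed.

Lemma pf_coef_ord0 n (a b : 'I_n.+1 -> C) :
  pf_coef a b ord0 = th (a ord0 / b ord0) *
    \prod_(j < n) (th (a ord0 / b (lift ord0 j)) / th (a ord0 / a (lift ord0 j))).
Proof.
rewrite /pf_coef big_ord_recl [in X in _ / X]big_mkcond big_ord_recl /= mul1r.
by rewrite prodf_div mulrA.
Qed.

Lemma pf_coef_lift n (a b : 'I_n.+1 -> C) (k : 'I_n) :
  pf_coef a b (lift ord0 k) = th (a (lift ord0 k) / b ord0) / th (a (lift ord0 k) / a ord0) *
    pf_coef (a \o lift ord0) (b \o lift ord0) k.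
Proof.
rewrite /pf_coef big_ord_recl [in X in _ / X]big_mkcond big_ord_recl /=.
under [X in _ / (_ * X)]eq_bigr do rewrite (inj_eq lift_inj).
by rewrite -big_mkcond invfM /= mulrACA.
Qed.

Let shape n (a b : 'I_n -> C) (x t : C) :=
  th t * \prod_j (th (x / b j) / th (x / a j)) =
  \sum_k pf_coef a b k * (th (x * t / a k) / th (x / a k)).

(** Here [t] is the quotient of poles by zeros for the tail and [t'] that for the whole family.
    After multiplication by [th t], the tail is expanded at [x] on the left and at [a ord0] inside
    the coefficient of the pole [a ord0]; the two expansions then match term by term by
    [pf_step]. *)
Lemma pf_induction n (a b : 'I_n.+1 -> C) (x t t' : C) :
  (forall j, a j != 0) -> (forall j, b j != 0) -> x != 0 -> t != 0 ->
  (forall j, th (x / a j) != 0) -> (forall i j, i != j -> th (a i / a j) != 0) ->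
  t' = t * a ord0 / b ord0 -> th t != 0 ->
  shape (a \o lift ord0) (b \o lift ord0) x t ->
  shape (a \o lift ord0) (b \o lift ord0) (a ord0) t ->
  shape a b x t'.
Proof.
move=> a0 b0 x0 t0 xa aa -> tht; rewrite /shape => IHx IHa.
apply: (mulfI tht); rewrite !big_ord_recl mulrDr pf_coef_ord0.
rewrite [X in _ = X + _](_ : _ = \sum_(k < n) pf_coef (a \o lift ord0) (b \o lift ord0) k *
   (th (a ord0 / b ord0) * (th (x * (t * a ord0 / b ord0) / a ord0) / th (x / a ord0)) *
   (th (a ord0 * t / a (lift ord0 k)) / th (a ord0 / a (lift ord0 k))))); last first.
  move: IHa => /= IHa; move: (\prod_(j < n) _) IHa => P IHa.
  transitivity (th (a ord0 / b ord0) *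
    (th (x * (t * a ord0 / b ord0) / a ord0) / th (x / a ord0)) * (th t * P)).
    by ring.
  by rewrite IHa mulr_sumr; apply: eq_bigr => k _ /=; ring.
rewrite mulr_sumr -big_split /=.
rewrite [LHS](_ : _ = th (t * a ord0 / b ord0) * (th (x / b ord0) / th (x / a ord0)) *
  (th t * \prod_(j < n) (th (x / (b \o lift ord0) j) / th (x / (a \o lift ord0) j)))); last first.
  by rewrite /=; ring.
rewrite IHx mulr_sumr; apply: eq_bigr => k _ /=.
rewrite pf_coef_lift.
have := pf_step (a0 ord0) (b0 ord0) (a0 (lift ord0 k)) x0 t0 (xa _) (xa _) (aa _ _ _).
move/(_ isT) => e.
rewrite [LHS](_ : _ = pf_coef (a \o lift ord0) (b \o lift ord0) k *
 (th (t * a ord0 / b ord0) * (th (x * t / a (lift ord0 k)) / th (x / a (lift ord0 k))) *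
  (th (x / b ord0) / th (x / a ord0)))); last by ring.
by rewrite e; ring.
Qed.

(** The value of [t] is the one for which both sides and every term on the right are multiplied by
    the same factor 1/t under x -> p x. *)
Lemma partial_fractions n (a b : 'I_n.+1 -> C) (x t : C) :
  (forall j, a j != 0) -> (forall j, b j != 0) -> x != 0 ->
  (forall j, th (x / a j) != 0) -> (forall i j, i != j -> th (a i / a j) != 0) ->
  t = (\prod_j a j) / \prod_j b j ->
  th t * \prod_j (th (x / b j) / th (x / a j)) =
  \sum_k pf_coef a b k * (th (x * t / a k) / th (x / a k)).
Proof.
elim: n => [|n IH] in a b x t * => a0 b0 x0 xa aa tE.
  rewrite !big_ord1 /pf_coef big_ord1 big_pred0 => [|j]; last by rewrite (ord1 j).
  have -> : t = a ord0 / b ord0 by rewrite tE !big_ord1.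
  have -> : x * (a ord0 / b ord0) / a ord0 = x / b ord0.
    by field; rewrite a0 b0.
  by rewrite divr1; ring.
(* The induction step divides by theta of the ratio of the products of the tails,
   so b_0 and b_1 are perturbed to b_0 s and b_1 / s, with s -> 1. *)
pose e (j : 'I_n.+2) (s : C) := match val j with 0 => s | 1 => s^-1 | _ => 1 end.
have e1 j : e j 1 = 1 by rewrite /e; case: (val j) => [|[|]] //=; rewrite invr1.
have e0 j s : s != 0 -> e j s != 0.
  by move=> s0; rewrite /e; case: (val j) => [|[|]] //=; rewrite ?invr_eq0 ?oner_eq0.
have ce j : {for (1 : C), continuous (e j)}.
  rewrite /e; case: (val j) => [|[|m]]; [exact: cont_id| |exact: cont_cst].
  by apply: cont_inv; [exact: oner_neq0 | exact: cont_id].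
pose bs s j := b j * e j s.
pose F s := th t * \prod_j (th (x / bs s j) / th (x / a j)) -
  \sum_k pf_coef a (bs s) k * (th (x * t / a k) / th (x / a k)).
have bs1 : bs 1 = b by apply/funext => j; rewrite /bs e1 mulr1.
suff : F 1 = 0 by rewrite /F bs1 => /eqP; rewrite subr_eq0 => /eqP.
have cb j c : c != 0 -> {for (1 : C), continuous (fun s => th (c / bs s j))}.
  move=> c0; apply: theta_continuous_comp; first by rewrite bs1; have := b0 j; nz.
  apply: cont_mul; first exact: cont_cst.
  apply: cont_inv; first by rewrite bs1.
  by apply: cont_mul; [exact: cont_cst | exact: ce].
apply: near1_eq0.
  apply: cont_sub.
    apply: cont_mul; first exact: cont_cst.
    apply: continuous_prod => j _; apply: cont_mul; last exact: cont_cst.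
    exact: cb.
  apply: continuous_sum => k _; apply: cont_mul; last exact: cont_cst.
  apply: cont_mul; last exact: cont_cst.
  by apply: continuous_prod => j _; exact: cb.
pose T := (\prod_(j < n.+1) a (lift ord0 j)) / \prod_(j < n.+1) b (lift ord0 j).
have pa : \prod_(j < n.+1) a (lift ord0 j) != 0 by apply/prodf_neq0.
have pb : \prod_(j < n.+1) b (lift ord0 j) != 0 by apply/prodf_neq0.
have T0 : T != 0 by nz.
have := theta_near1_neq0 thP T0.
have : \forall s \near (1:C)^', s != 0.
  apply: (@nbhs_dnbhs _ (1:C)).
  have := @cvgr_neq0 _ _ _ (nbhs (1:C)) _ id (1:C) cvg_id (oner_neq0 _).
  exact.
apply: filterS2 => s s0 Ts.
apply/eqP; rewrite subr_eq0; apply/eqP.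
have bs0 j : bs s j != 0 by have := b0 j; have := e0 j _ s0; rewrite /bs; nz.
have TsE : T * s = (\prod_(j < n.+1) a (lift ord0 j)) / \prod_(j < n.+1) bs s (lift ord0 j).
  have -> : \prod_(j < n.+1) bs s (lift ord0 j) = (\prod_(j < n.+1) b (lift ord0 j)) * s^-1.
    by rewrite big_split /= [X in _ * X]big_ord_recl [X in _ * (_ * X)]big1 ?mulr1.
  by rewrite /T invfM invrK mulrA.
apply: (@pf_induction _ a (bs s) x (T * s)) => //.
- by nz.
- rewrite tE big_ord_recl [X in _ / X]big_ord_recl /T /bs /e /=.
  by field; rewrite s0 pb b0.
- by apply: IH => //= i j ij; apply: aa; rewrite (inj_eq lift_inj).
- by apply: IH => //= *; apply: aa; rewrite ?(inj_eq lift_inj).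
Qed.

End PartialFractions.

(** * Sums over compositions *)

Section CompositionSums.
Variable V : nmodType.

(* Any bound B >= N gives the sum over all compositions of N; a bound that does not
   depend on N allows inductions on N. *)
Definition csum n (B N : nat) (f : ('I_n -> nat) -> V) : V :=
  \sum_(y : {ffun 'I_n -> 'I_B.+1} | (\sum_k y k == N)%N) f (fun k => y k : nat).

Definition incr n (i : 'I_n) (y : 'I_n -> nat) : 'I_n -> nat :=
  fun k => (y k + (k == i))%N.

Lemma sum_incr n (i : 'I_n) y : (\sum_k incr i y k = (\sum_k y k).+1)%N.
Proof.
rewrite big_split /= [X in (_ + X)%N](bigD1 i) //= eqxx [X in (_ + (_ + X))%N]big1 ?addn0 ?addn1 // => j.
by move=> /negbTE ->.
Qed.

Lemma leq_composition n (y : 'I_n -> nat) k : (y k <= \sum_j y j)%N.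
Proof. by rewrite (bigD1 k) //= leq_addr. Qed.

(** Once the two sums are exchanged, the terms with y_k = 0 drop out and the others are reindexed by
    lowering y_k by one. The hypothesis [N < B] keeps the raised entries within the bound. *)
Lemma csum_step n B N (F : ('I_n -> nat) -> 'I_n -> V) : (N < B)%N ->
  (forall y k, y k = 0%N -> F y k = 0) ->
  csum B N.+1 (fun y => \sum_k F y k) = csum B N (fun y => \sum_k F (incr k y) k).
Proof.
move=> NB F0; rewrite /csum exchange_big [RHS]exchange_big /=; apply: eq_bigr => k _.
rewrite (bigID (fun y : {ffun 'I_n -> 'I_B.+1} => y k == ord0)) /= big1 ?add0r; last first.
  by move=> y /andP[_ /eqP yk]; apply: F0; rewrite yk.
rewrite (reindex_onto
  (fun y : {ffun 'I_n -> 'I_B.+1} => [ffun j => inord (incr k (fun j => y j : nat) j) : 'I_B.+1])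
  (fun y => [ffun j => inord (y j - (j == k))])) /=; last first.
  move=> y /andP[_ yk]; apply/ffunP => j; rewrite !ffunE /incr; apply: val_inj => /=.
  have h : (y j - (j == k) < B.+1)%N by rewrite (leq_ltn_trans _ (ltn_ord (y j))) // leq_subr.
  have h2 : (y j - (j == k) + (j == k) = y j)%N.
    rewrite subnK //; case: eqP => // ->; move: yk; rewrite -(inj_eq val_inj) /= => ?; lia.
  by rewrite ffunE (inordK h) h2 inordK ?ltn_ord.
have val_h (y : {ffun 'I_n -> 'I_B.+1}) j : (y k < B)%N ->
    ([ffun j => inord (incr k (fun j => y j : nat) j) : 'I_B.+1] j : nat) =
    incr k (fun j => y j : nat) j.
  move=> yk; rewrite ffunE inordK // ltnS /incr.
  case: eqP => [->|_]; first by rewrite addn1.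
  by rewrite addn0 -ltnS ltn_ord.
have ltB (y : {ffun 'I_n -> 'I_B.+1}) : (\sum_i y i)%N = N -> (y k < B)%N.
  by move=> yN; apply: leq_ltn_trans NB; rewrite -yN; exact: (@leq_composition _ (fun j => y j : nat)).
(* If y_k = B, raising it makes [inord] fall back to its default [ord0]. The condition that the new
   k-th entry is nonzero therefore excludes exactly the overflow. *)
apply: eq_big => [y|y]; last first.
  move=> /andP[/andP[h1 h2] /eqP h3]; congr (F _ k); apply/funext => j; rewrite val_h //.
  move: h2; rewrite ffunE /incr eqxx addn1.
  have := ltn_ord (y k); rewrite ltnS leq_eqVlt => /predU1P[-> |//].
  by rewrite /inord /insubd insubF ?ltnn // eqxx.
have [yk|yk] := ltnP (y k) B; last first.
  rewrite [RHS]negbTE; last by apply/eqP => /ltB; rewrite ltnNge yk.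
  rewrite [X in _ && ~~ X && _](_ : _ = true) ?andbF //.
  have -> : [ffun j => inord (incr k (fun j => y j : nat) j) : 'I_B.+1] k = inord B.+1.
    rewrite ffunE /incr eqxx addn1; congr (inord _.+1); apply/eqP.
    by rewrite eqn_leq yk -ltnS ltn_ord.
  by rewrite /inord /insubd insubF ?ltnn // eqxx.
rewrite (eq_bigr _ (fun j _ => val_h y j yk)) sum_incr eqSS.
have -> : [ffun j => inord ([ffun j => inord (incr k (fun j => y j : nat) j) : 'I_B.+1] j - (j == k))] = y.
  by apply/ffunP => j; rewrite ffunE val_h // /incr addnK inord_val.
rewrite eqxx andbT; case: eqP => //= _.
apply/eqP => /(congr1 val) /=; rewrite val_h // /incr eqxx addn1 //.
Qed.

End CompositionSums.

(** * The Kajihara-Noumi duality *)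

Section KajiharaNoumi.
Variables (C : numFieldType) (p q : C).
Local Notation th := (theta p).
Local Notation ep := (epoch p q).
Hypothesis thP : theta_laws th.
Hypothesis q0 : q != 0.

(** * Shifts of Delta and of the elliptic Pochhammer symbols *)

Lemma epoch0 x : ep x 0 = 1.
Proof. by rewrite /epoch big_ord0. Qed.

Lemma epochS x k : ep x k.+1 = ep x k * th (x * q ^+ k).
Proof. by rewrite /epoch big_ord_recr. Qed.

Lemma epoch_recl x k : ep x k.+1 = th x * ep (x * q) k.
Proof.
rewrite /epoch big_ord_recl expr0 mulr1; congr (_ * _); apply: eq_bigr => i _.
by rewrite /= exprS mulrA.
Qed.

Lemma epoch_shift x k : ep x k * th (x * q ^+ k) = th x * ep (x * q) k.
Proof. by rewrite -epochS epoch_recl. Qed.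

Lemma prod_predC1 n (i : 'I_n) (F : 'I_n -> C) :
  \prod_(j | j != i) F j = (\prod_(j < n | (j < i)%N) F j) * \prod_(j < n | (i < j)%N) F j.
Proof.
rewrite (bigID (fun j : 'I_n => (j < i)%N)) /=; congr (_ * _); apply: eq_bigl => j.
  by case: ltngtP => //; rewrite ?andbF // => h; rewrite andbT -(inj_eq val_inj) /= neq_ltn h.
by rewrite -leqNgt ltn_neqAle eq_sym -(inj_eq val_inj) /= eq_sym.
Qed.

(* The pairs (i, k) with i < k contribute z_i theta(z_k / z_i) = - z_k theta(z_i / z_k),
   so that z_i enters Delta only through the factors theta(z_i / z_j). *)
Definition Delta_rest n (i : 'I_n) (z : 'I_n -> C) : C :=
  (\prod_(j < n | (j < i)%N) z j) * (\prod_(k < n | (i < k)%N) - z k) *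
  \prod_(j | j != i) \prod_(k < n | (j < k)%N && (k != i)) (z j * th (z k / z j)).

Lemma Delta_split n (i : 'I_n) (z : 'I_n -> C) : (forall j, z j != 0) ->
  Delta p z = Delta_rest i z * \prod_(j | j != i) th (z i / z j).
Proof.
move=> z0; rewrite /Delta (bigD1 i) //=.
have -> : \prod_(k < n | (i < k)%N) (z i * th (z k / z i)) =
    \prod_(k < n | (i < k)%N) (- z k) * \prod_(k < n | (i < k)%N) th (z i / z k).
  rewrite -big_split; apply: eq_bigr => k _ /=.
  have zik : z i / z k != 0 by have := z0 i; have := z0 k; nz.
  rewrite -(invf_div (z i) (z k)) (thetaV thP zik) invf_div.
  by field; rewrite !z0.
rewrite [X in _ * X = _](eq_bigr (fun j : 'I_n => (if (j < i)%N then z j * th (z i / z j) else 1) *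
    \prod_(k < n | (j < k)%N && (k != i)) (z j * th (z k / z j)))); last first.
  move=> j ji; case: ifP => ltji; first by rewrite (bigD1 i).
  rewrite mul1r; apply: eq_bigl => k; case: eqP => [->|]; last by rewrite andbT.
  by rewrite ltji.
rewrite big_split /= -big_mkcondr /= /Delta_rest [X in _ = _ * X]prod_predC1.
rewrite [X in _ * (X * _) = _](eq_bigl (fun j : 'I_n => (j < i)%N)); last first.
  by move=> j; rewrite -(inj_eq val_inj) /=; case: ltngtP; rewrite ?andbF.
by rewrite big_split /=; ring.
Qed.

Lemma eq_Delta_rest n (i : 'I_n) (z z' : 'I_n -> C) :
  (forall j, j != i -> z j = z' j) -> Delta_rest i z = Delta_rest i z'.
Proof.
move=> zz; rewrite /Delta_rest; congr (_ * _ * _); last first.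
- apply: eq_bigr => j ji; apply: eq_bigr => k /andP[_ ki].
  by rewrite !zz.
- by apply: eq_bigr => k ik; rewrite zz // -(inj_eq val_inj) /= neq_ltn ik orbT.
- by apply: eq_bigr => k ik; rewrite zz // -(inj_eq val_inj) /= neq_ltn ik.
Qed.

Definition bump_at n (i : 'I_n) (z : 'I_n -> C) : 'I_n -> C :=
  fun k => z k * q ^+ (k == i).

Lemma bump_at_id n (i : 'I_n) z : bump_at i z i = z i * q.
Proof. by rewrite /bump_at eqxx expr1. Qed.

Lemma bump_at_neq n (i j : 'I_n) z : j != i -> bump_at i z j = z j.
Proof. by rewrite /bump_at => /negbTE ->; rewrite expr0 mulr1. Qed.

Lemma bump_at_neq0 n (i j : 'I_n) z : z j != 0 -> bump_at i z j != 0.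
Proof. by move=> zj; rewrite /bump_at; nz. Qed.

Lemma qshift_incr n (i : 'I_n) (z : 'I_n -> C) y :
  qshift q z (incr i y) = bump_at i (qshift q z y).
Proof. by apply/funext => k; rewrite /qshift /bump_at /incr exprD mulrA. Qed.

Lemma qshift_bump n (i : 'I_n) (z : 'I_n -> C) y :
  qshift q (bump_at i z) y = qshift q z (incr i y).
Proof. by rewrite qshift_incr; apply/funext => k; rewrite /qshift /bump_at mulrAC. Qed.

Lemma qshift_neq0 n (z : 'I_n -> C) y k : z k != 0 -> qshift q z y k != 0.
Proof. by rewrite /qshift; nz. Qed.

Lemma Delta_bump n (i : 'I_n) (z : 'I_n -> C) : (forall j, z j != 0) ->
  (forall j, j != i -> th (z i / z j) != 0) ->
  Delta p (bump_at i z) =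
  Delta p z * \prod_(j | j != i) (th (z i * q / z j) / th (z i / z j)).
Proof.
move=> z0 zi; rewrite (Delta_split i z0) (@Delta_split _ i); last by move=> j; apply: bump_at_neq0.
rewrite (@eq_Delta_rest _ i _ z); last by move=> j; exact: bump_at_neq.
rewrite bump_at_id prodf_div.
rewrite (eq_bigr (fun j => th (z i * q / z j))); last by move=> j ji; rewrite bump_at_neq.
have h : \prod_(j | j != i) th (z i / z j) != 0 by apply/prodf_neq0 => j; apply: zi.
by field.
Qed.

Lemma Delta_neq0 n (z : 'I_n -> C) : (forall j, z j != 0) ->
  (forall i j, i != j -> th (z i / z j) != 0) -> Delta p z != 0.
Proof.
move=> z0 zz; apply/prodf_neq0 => j _; apply/prodf_neq0 => k jk.
by have := z0 j; have := zz k j; rewrite -(inj_eq val_inj) /= neq_ltn jk orbT => /(_ isT); nz.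
Qed.

(** One shape serves both sides of the duality: with nodes z, denominator parameters w and numerator
    parameters a on one side, and with w, z and the inverses of a on the other. *)
Definition kn_summand n m r (z : 'I_n -> C) (w : 'I_m -> C) (a : 'I_r -> C)
    (y : 'I_n -> nat) : C :=
  Delta p (qshift q z y) / Delta p z *
  \prod_k ((\prod_j ep (a j * z k) (y k)) /
    ((\prod_j ep (w j * z k) (y k)) * \prod_j ep (q * z k / z j) (y k))).

Definition epoch_prod n r (c : 'I_r -> C) (z : 'I_n -> C) (y : 'I_n -> nat) : C :=
  \prod_j \prod_k ep (c j * z k) (y k).

Lemma kn_summandE n m r (z : 'I_n -> C) (w : 'I_m -> C) (a : 'I_r -> C) y :
  kn_summand z w a y = Delta p (qshift q z y) / Delta p z *
   (epoch_prod a z y / (epoch_prod w z y * epoch_prod (fun j => q / z j) z y)).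
Proof.
rewrite /kn_summand; congr (_ * _); rewrite prodf_div big_split /= /epoch_prod.
congr (_ / (_ * _)); rewrite exchange_big //=.
by apply: eq_bigr => k _; apply: eq_bigr => j _; rewrite mulrAC.
Qed.

Lemma prod_epoch_incr n (i : 'I_n) c (z : 'I_n -> C) y :
  \prod_k ep (c * z k) (incr i y k) = (\prod_k ep (c * z k) (y k)) * th (c * z i * q ^+ y i).
Proof.
rewrite (bigD1 i) //= [in RHS](bigD1 i) //= {1}/incr eqxx addn1 epochS mulrAC.
congr (_ * _ * _); apply: eq_bigr => k /negbTE ki; by rewrite /incr ki addn0.
Qed.

Lemma prod_epoch_bump n (i : 'I_n) c (z : 'I_n -> C) y :
  th (c * z i) * \prod_k ep (c * bump_at i z k) (y k) = \prod_k ep (c * z k) (incr i y k).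
Proof.
rewrite (bigD1 i) //= [in RHS](bigD1 i) //= {1}/incr eqxx addn1 epoch_recl bump_at_id !mulrA.
by congr (_ * _); apply: eq_bigr => k ki; rewrite bump_at_neq // /incr (negbTE ki) addn0.
Qed.

Lemma prod_epoch_shift n c (z : 'I_n -> C) y :
  (\prod_k ep (c * z k) (y k)) * \prod_k th (c * qshift q z y k) =
  (\prod_k th (c * z k)) * \prod_k ep (c * q * z k) (y k).
Proof.
rewrite -!big_split; apply: eq_bigr => k _ /=.
by rewrite /qshift [c * (_ * _)]mulrA epoch_shift [c * q * _]mulrAC.
Qed.

Lemma epoch_prod_incr n r (i : 'I_n) (c : 'I_r -> C) z y :
  epoch_prod c z (incr i y) = epoch_prod c z y * \prod_j th (c j * qshift q z y i).
Proof.
rewrite /epoch_prod -big_split; apply: eq_bigr => j _ /=; rewrite prod_epoch_incr.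
by rewrite /qshift mulrA.
Qed.

Lemma epoch_prod_bump_base n r (i : 'I_n) (c : 'I_r -> C) z y :
  (\prod_j th (c j * z i)) * epoch_prod c (bump_at i z) y = epoch_prod c z (incr i y).
Proof. by rewrite /epoch_prod -big_split; apply: eq_bigr => j _ /=; rewrite prod_epoch_bump. Qed.

Lemma epoch_prod_bump_coef n r (l : 'I_r) (c : 'I_r -> C) (z : 'I_n -> C) y :
  epoch_prod c z y * \prod_k th (c l * qshift q z y k) =
  (\prod_k th (c l * z k)) * epoch_prod (bump_at l c) z y.
Proof.
rewrite /epoch_prod (bigD1 l) //= [in RHS](bigD1 l) //= mulrAC prod_epoch_shift bump_at_id -mulrA.
congr (_ * (_ * _)); apply: eq_bigr => j jl; by rewrite bump_at_neq.
Qed.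

Lemma kn_summand_incr n m r (i : 'I_n) (z : 'I_n -> C) (w : 'I_m -> C) (a : 'I_r -> C) y :
  (forall j, z j != 0) ->
  (forall j, j != i -> th (qshift q z y i / qshift q z y j) != 0) ->
  kn_summand z w a (incr i y) = kn_summand z w a y *
   (\prod_(j | j != i) (th (qshift q z y i * q / qshift q z y j) / th (qshift q z y i / qshift q z y j)) *
   ((\prod_j th (a j * qshift q z y i)) / ((\prod_j th (w j * qshift q z y i)) *
      \prod_j th (q / z j * qshift q z y i)))).
Proof.
move=> z0 zi; rewrite !kn_summandE qshift_incr Delta_bump //; last first.
  by move=> j; apply: qshift_neq0.
by rewrite !epoch_prod_incr !invfM; ring.
Qed.

Lemma kn_summand_bump n m r (i : 'I_m) (l : 'I_r) (z : 'I_n -> C) (w : 'I_m -> C)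
    (a : 'I_r -> C) y :
  \prod_k th (a l * z k) != 0 -> \prod_k th (w i * z k) != 0 ->
  kn_summand z (bump_at i w) (bump_at l a) y = kn_summand z w a y *
   ((\prod_k th (a l * qshift q z y k)) / (\prod_k th (a l * z k)) *
    ((\prod_k th (w i * z k)) / \prod_k th (w i * qshift q z y k))).
Proof.
move=> al wi; rewrite !kn_summandE.
have /(canRL (mulKf al)) -> := esym (epoch_prod_bump_coef l a z y).
have /(canRL (mulKf wi)) -> := esym (epoch_prod_bump_coef i w z y).
by rewrite !invfM invrK; ring.
Qed.

Lemma prod_theta_invM n (c : C) (v : 'I_n -> C) : c != 0 -> (forall j, v j != 0) ->
  \prod_j th (c^-1 / v j) = (- c^-1) ^+ n / (\prod_j v j) * \prod_j th (c * v j).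
Proof.
move=> c0 v0; rewrite -[n in _ ^+ n]card_ord -prodr_const -prodf_div -big_split.
apply: eq_bigr => j _ /=; have vj := v0 j.
by rewrite -invfM (thetaV thP) ?mulf_neq0 //; field; rewrite c0 vj.
Qed.

Lemma prod_theta_inv_div n (P : pred 'I_n) (c : C) (v : 'I_n -> C) : c != 0 ->
  (forall j, v j != 0) ->
  \prod_(j | P j) th (c^-1 / (v j)^-1) =
  (- c^-1) ^+ #|P| * (\prod_(j | P j) v j) * \prod_(j | P j) th (c / v j).
Proof.
move=> c0 v0; rewrite -prodr_const -!big_split.
apply: eq_bigr => j _ /=; have vj := v0 j.
by rewrite -invfM (thetaV thP) ?mulf_neq0 ?invr_neq0 //; field; rewrite c0 vj.
Qed.

Lemma prod_qshift n (z : 'I_n -> C) y :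
  \prod_k qshift q z y k = (\prod_k z k) * q ^+ (\sum_k y k).
Proof. by rewrite big_split /= prodrXr. Qed.

(** A residue at the pole 1/w_i, with the factor of [a l] shifted by [q ^+ N]. It does not involve
    y, and it is the same for the primal and the dual recursion, which is what lets the induction
    compare them term by term. *)
Definition rec_coef n m r (N : nat) (z : 'I_n -> C) (w : 'I_m -> C) (a : 'I_r -> C)
    (l : 'I_r) (i : 'I_m) : C :=
  (\prod_(j | j != l) th (w i / a j)) * th (q ^+ N * w i / a l) /
  ((\prod_(j | j != i) th (w i / w j)) * \prod_j th (w i * z j)).

Lemma eq_csum n B N (f g : ('I_n -> nat) -> C) :
  (forall y, (\sum_k y k)%N = N -> f y = g y) -> csum B N f = csum B N g.
Proof. by move=> fg; apply: eq_bigr => y /eqP yN; apply: fg. Qed.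

Lemma csum_comb n m B N (c : 'I_m -> C) (f : 'I_m -> ('I_n -> nat) -> C) :
  csum B N (fun y => \sum_i c i * f i y) = \sum_i c i * csum B N (f i).
Proof. by rewrite /csum exchange_big; apply: eq_bigr => i _; rewrite mulr_sumr. Qed.

Lemma csum_scale n B N (c : C) (f : ('I_n -> nat) -> C) :
  c * csum B N f = csum B N (fun y => c * f y).
Proof. by rewrite /csum mulr_sumr. Qed.

Lemma pf_coef_eq0 n (a b : 'I_n -> C) k : a k = b k -> b k != 0 -> pf_coef th a b k = 0.
Proof.
move=> ab bk; rewrite /pf_coef (bigD1 k) //= ab divff // (theta1 thP).
by rewrite !mul0r.
Qed.

(** This says that theta does not vanish at x q^e for any integer e with |e| <= K. With two natural
    exponents, a shift of x by q in either direction only costs one unit of K. *)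
Definition nonroot K x := forall c d, (c <= K)%N -> (d <= K)%N -> th (x * q ^+ c / q ^+ d) != 0.

Lemma nonroot_le K K' x : (K' <= K)%N -> nonroot K x -> nonroot K' x.
Proof. by move=> h nx c d cK dK; apply: nx; rewrite (leq_trans _ h). Qed.

Lemma nonroot1 K x : nonroot K x -> th x != 0.
Proof. by move=> /(_ 0%N 0%N isT isT); rewrite expr0 mulr1 divr1. Qed.

Lemma nonroot_shift K x e e' : (e <= 1)%N -> (e' <= 1)%N -> nonroot K.+1 x ->
  nonroot K (x * q ^+ e / q ^+ e').
Proof.
move=> e1 e1' nx c d cK dK.
have -> : x * q ^+ e / q ^+ e' * q ^+ c / q ^+ d = x * q ^+ (e + c) / q ^+ (e' + d).
  by rewrite !exprD invfM; ring.
by apply: nx; rewrite -add1n leq_add.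
Qed.

(** Genericity is graded by N because each step of the induction multiplies one [w i] and [a l] by
    q, and one unit of N pays for that. The products [w i * z j] only move upwards, so they need
    only nonnegative exponents. *)
Record kn_generic n m r (N : nat) (z : 'I_n -> C) (w : 'I_m -> C) (a : 'I_r -> C)
    (l : 'I_r) : Prop := KnGeneric {
  kn_z : forall i j, i != j -> nonroot N (z i / z j);
  kn_q : forall c, (0 < c <= N)%N -> th (q ^+ c) != 0;
  kn_wz : forall i j c, (c < N)%N -> th (w i * z j * q ^+ c) != 0;
  kn_w : forall i j, i != j -> nonroot N (w i / w j);
  kn_a : forall j, nonroot N (a l * z j);
  kn_wa : forall i, nonroot N (w i / a l)
}.

Lemma kn_generic_bump n m r N z w a l i : @kn_generic n m r N.+1 z w a l ->
  kn_generic N z (bump_at i w) (bump_at l a) l.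
Proof.
case=> hz hq hwz hw ha hwa; split.
- by move=> j k jk; apply: (nonroot_le (leqnSn _)); apply: hz.
- by move=> c /andP[c0 cN]; apply: hq; rewrite c0 leqW.
- move=> k j c cN; rewrite /bump_at.
  have -> : w k * q ^+ (k == i) * z j * q ^+ c = w k * z j * q ^+ ((k == i) + c).
    by rewrite exprD; ring.
  by apply: hwz; case: (k == i); rewrite /= ?add0n ?add1n ltnS // ltnW.
- move=> j k jk; rewrite /bump_at.
  have -> : w j * q ^+ (j == i) / (w k * q ^+ (k == i)) =
    w j / w k * q ^+ (j == i) / q ^+ (k == i) by rewrite invfM; ring.
  by apply: nonroot_shift; rewrite ?leq_b1 //; apply: hw.
- move=> j; rewrite bump_at_id.
  have -> : a l * q * z j = a l * z j * q ^+ 1 / q ^+ 0 by rewrite expr0 divr1; ring.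
  exact: nonroot_shift.
- move=> k; rewrite bump_at_id /bump_at.
  have -> : w k * q ^+ (k == i) / (a l * q) = w k / a l * q ^+ (k == i) / q ^+ 1.
    by rewrite invfM; ring.
  by apply: nonroot_shift; rewrite ?leq_b1.
Qed.

(** * The recursion for the sum over z *)

Section PrimalRecursion.
Variables (n m N : nat) (z : 'I_n.+1 -> C) (w : 'I_m.+1 -> C)
  (a : 'I_(n.+1 + m.+1) -> C) (l : 'I_(n.+1 + m.+1)).
Hypotheses (z0 : forall k, z k != 0) (w0 : forall k, w k != 0) (a0 : forall k, a k != 0).
Hypothesis balanced : \prod_k w k = (\prod_k z k) * \prod_k a k.

(** A single expansion with the poles u_k and 1/w_i together and the zeros 1/a_j, taken at the zero
    x = 1/a_l. Its product side vanishes, so the contributions of the two kinds of poles are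
    opposite. By the balancing condition the quotient of poles by zeros is [q ^+ N]. *)
Lemma partial_fractions_dual (y : 'I_n.+1 -> nat) (u := qshift q z y) :
  (\sum_k y k)%N = N ->
  (forall i j, i != j -> th (u i / u j) != 0) ->
  (forall i j, i != j -> th (w i / w j) != 0) ->
  (forall i j, th (w i * u j) != 0) ->
  (forall j, th (a l * u j) != 0) ->
  (forall i, th (w i / a l) != 0) ->
  \sum_k (\prod_j th (a j * u k)) / ((\prod_(j | j != k) th (u k / u j)) * \prod_j th (w j * u k))
      * (th ((a l)^-1 * q ^+ N / u k) / th ((a l)^-1 / u k)) =
  - \sum_i (\prod_j th ((w i)^-1 / (a j)^-1)) /
     ((\prod_j th ((w i)^-1 / u j)) * \prod_(j | j != i) th ((w i)^-1 / (w j)^-1))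
      * (th ((a l)^-1 * q ^+ N / (w i)^-1) / th ((a l)^-1 / (w i)^-1)).
Proof.
move=> yN uu ww wu au wa.
have u0 k : u k != 0 by apply: qshift_neq0.
pose pts (i : 'I_(n.+1 + m.+1)) := match fintype.split i with inl k => u k | inr j => (w j)^-1 end.
have ptl k : pts (lshift _ k) = u k by rewrite /pts (unsplitK (inl k)).
have ptr k : pts (rshift _ k) = (w k)^-1 by rewrite /pts (unsplitK (inr k)).
have thV (x : C) : x != 0 -> th x != 0 -> th x^-1 != 0.
  by move=> x0 tx; rewrite (thetaV thP x0) mulf_neq0 ?oppr_eq0 ?invr_neq0.
have pts0 i : pts i != 0.
  by rewrite /pts; case: (fintype.split i) => k; [exact: u0 | rewrite invr_neq0].
have pts_pole i : th ((a l)^-1 / pts i) != 0.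
  rewrite /pts; case: (fintype.split i) => k.
    by rewrite -invfM; apply: thV => //; apply: mulf_neq0.
  by rewrite invrK mulrC.
have pts_neq i j : i != j -> th (pts i / pts j) != 0.
  case: (split_ordP i) => i' ->; case: (split_ordP j) => j' ->;
    rewrite ?ptl ?ptr ?eq_shift ?invrK.
  + exact: uu.
  + by rewrite mulrC.
  + by rewrite -invfM => _; apply: thV => //; apply: mulf_neq0.
  + by move=> ij; rewrite mulrC ww // eq_sym.
have tE : q ^+ N = (\prod_k pts k) / \prod_k (a k)^-1.
  rewrite prodfV invrK big_split_ord /=.
  rewrite (eq_bigr _ (fun k _ => ptl k)) [X in _ * X * _](eq_bigr _ (fun k _ => ptr k)).
  rewrite prodfV prod_qshift yN balanced.
  have pz : \prod_k z k != 0 by apply/prodf_neq0.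
  have pa : \prod_k a k != 0 by apply/prodf_neq0.
  by field; rewrite pz pa.
have key : \sum_k pf_coef th pts (fun j => (a j)^-1) k *
    (th ((a l)^-1 * q ^+ N / pts k) / th ((a l)^-1 / pts k)) = 0.
  rewrite -(@partial_fractions _ _ thP _ pts (fun j => (a j)^-1) (a l)^-1 (q ^+ N)) //.
  - rewrite (bigD1 l) //= divff ?invr_neq0 // (theta1 thP) mul0r mul0r mulr0 //.
  - by move=> j; rewrite invr_neq0.
  - by rewrite invr_neq0.
rewrite (@big_split_ord _ _ _ n.+1 m.+1) in key.
apply/eqP; rewrite -addr_eq0 -[X in _ == X]key; apply/eqP.
  congr (_ + _); apply: eq_bigr => k _.
    rewrite ptl; congr (_ * _); rewrite /pf_coef ptl; congr (_ / _).
      by apply: eq_bigr => j _; rewrite invrK mulrC.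
    rewrite (@big_split_ord _ _ _ n.+1 m.+1) /=.
    congr (_ * _); apply: eq_big => [j|j _]; rewrite ?eq_shift ?ptl ?ptr //.
    by rewrite invrK mulrC.
  rewrite ptr; congr (_ * _); rewrite /pf_coef ptr; congr (_ / _).
  rewrite (@big_split_ord _ _ _ n.+1 m.+1) /=.
  by congr (_ * _); apply: eq_big => [j|j _]; rewrite ?eq_shift ?ptl ?ptr.
Qed.

Hypothesis gen : kn_generic N.+1 z w a l.

(** The inverse of the product in the expansion with poles z_k q^{y_k} and zeros z_k at the point
    1/a_l. The point is chosen so that [rho] is, up to a monomial, also the factor that replacing
    a_l by q a_l produces in the summand. *)
Let rho y := (\prod_j th ((a l)^-1 / qshift q z y j)) / \prod_j th ((a l)^-1 / z j).
Let F y k := kn_summand z w a y * rho y * (pf_coef th (qshift q z y) z k *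
  (th ((a l)^-1 * q ^+ N.+1 / qshift q z y k) / th ((a l)^-1 / qshift q z y k))).

Lemma composition_le (y : 'I_n.+1 -> nat) M k : (\sum_j y j)%N = M -> (y k <= M)%N.
Proof. by move=> <-; exact: leq_composition. Qed.

Lemma shifted_poles y : (\sum_j y j <= N.+1)%N ->
  [/\ forall i j, i != j -> th (qshift q z y i / qshift q z y j) != 0,
      forall j, th (a l * qshift q z y j) != 0,
      forall j, th ((a l)^-1 / qshift q z y j) != 0 &
      forall j, th ((a l)^-1 / z j) != 0].
Proof.
move=> yN; have le k : (y k <= N.+1)%N by apply: leq_trans yN; exact: leq_composition.
have h2 j : th (a l * qshift q z y j) != 0.
  by have := kn_a gen j (le j) (leq0n _); rewrite expr0 divr1 -mulrA.
have thV (x : C) : x != 0 -> th x != 0 -> th x^-1 != 0.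
  by move=> x0 tx; rewrite (thetaV thP x0) mulf_neq0 ?oppr_eq0 ?invr_neq0.
split=> //.
- move=> i j ij; have := kn_z gen ij (le i) (le j).
  rewrite /qshift; congr (th _ != 0).
  by rewrite invfM; ring.
- by move=> j; rewrite -invfM; apply: thV => //; apply: mulf_neq0 => //; apply: qshift_neq0.
- move=> j; rewrite -invfM; apply: thV; first exact: mulf_neq0.
  exact: nonroot1 (kn_a gen j).
Qed.

(* Passes from compositions of N + 1 to those of N: the k-th term F y k vanishes
   when y_k = 0. *)
Lemma primal_insertion y : (\sum_j y j)%N = N.+1 ->
  th (q ^+ N.+1) * kn_summand z w a y = \sum_k F y k.
Proof.
move=> yN; have [uu au su sz] : _ := shifted_poles (eq_leq yN).
rewrite /F -mulr_sumr -(@partial_fractions _ _ thP _ _ z (a l)^-1 (q ^+ N.+1)) //.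
- rewrite prodf_div /rho.
  have P1 : \prod_j th ((a l)^-1 / z j) != 0 by apply/prodf_neq0.
  have P2 : \prod_j th ((a l)^-1 / qshift q z y j) != 0 by apply/prodf_neq0.
  by field; rewrite P1 P2.
- by move=> j; apply: qshift_neq0.
- by rewrite invr_neq0.
- rewrite prod_qshift yN.
  have pz : \prod_k z k != 0 by apply/prodf_neq0.
  by field.
Qed.

(** Raising y_k brings factors theta(q u_k/u_j) into the numerator, from Delta, and theta(q u_k/z_j)
    into the denominator. The coefficient [pf_coef] contains exactly their inverses, so the result
    is expressed by the unraised nodes u alone. *)
Lemma primal_term y k : (\sum_j y j)%N = N ->
  F (incr k y) k = kn_summand z w a y * rho y *
   ((\prod_j th (a j * qshift q z y k)) /
     ((\prod_(j | j != k) th (qshift q z y k / qshift q z y j)) * \prod_j th (w j * qshift q z y k))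
      * (th ((a l)^-1 * q ^+ N / qshift q z y k) / th ((a l)^-1 / qshift q z y k))).
Proof.
move=> yN; have yN' : (\sum_j y j <= N.+1)%N by rewrite yN.
have [uu au su sz] := shifted_poles yN'.
have [uu' au' su' _] := shifted_poles (eq_leq (etrans (sum_incr k y) (congr1 S yN))).
rewrite /F kn_summand_incr //; last by move=> j jk; apply: uu; rewrite eq_sym.
have su'k := su' k.
have uu'k j : j != k -> th (qshift q z y k * q / qshift q z y j) != 0.
  move=> jk; have := uu' k j; rewrite eq_sym jk => /(_ isT).
  by rewrite qshift_incr bump_at_id bump_at_neq.
rewrite qshift_incr bump_at_id in su'k.
have rhoE : \prod_j th ((a l)^-1 / qshift q z (incr k y) j) = th ((a l)^-1 / (qshift q z y k * q)) *
    \prod_(j | j != k) th ((a l)^-1 / qshift q z y j).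
  rewrite (bigD1 k) //= qshift_incr bump_at_id; congr (_ * _); apply: eq_bigr => j jk.
  by rewrite bump_at_neq.
have pfE : pf_coef th (qshift q z (incr k y)) z k = (\prod_j th (q / z j * qshift q z y k)) /
    \prod_(j | j != k) th (qshift q z y k * q / qshift q z y j).
  rewrite /pf_coef qshift_incr bump_at_id; congr (_ / _); apply: eq_bigr => j jk.
    by rewrite -mulrA mulrC.
  by rewrite bump_at_neq.
rewrite /rho rhoE pfE qshift_incr bump_at_id.
rewrite [X in _ = _ * (X / _) * _](bigD1 k) //=.
have -> : (a l)^-1 * q ^+ N.+1 / (qshift q z y k * q) = (a l)^-1 * q ^+ N / qshift q z y k.
  have uk : qshift q z y k != 0 by apply: qshift_neq0.
  by rewrite exprS; field; rewrite q0 uk a0.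
rewrite prodf_div.
have P1 : \prod_(j | j != k) th (qshift q z y k * q / qshift q z y j) != 0 by apply/prodf_neq0.
have P2 : \prod_j th (q / z j * qshift q z y k) != 0.
  apply/prodf_neq0 => j _.
  have -> : q / z j * qshift q z y k = z k / z j * q ^+ (y k).+1 by rewrite /qshift exprS; ring.
  have yk : (y k <= N)%N by apply: composition_le.
  have [kj|kj] := eqVneq k j; first by rewrite -kj divff // mul1r; apply: (kn_q gen); rewrite /= ltnS.
  by have := kn_z gen kj (_ : (y k).+1 <= N.+1)%N (leq0n _); rewrite expr0 divr1; apply.
have P3 : \prod_j th (w j * qshift q z y k) != 0.
  apply/prodf_neq0 => j _; rewrite /qshift mulrA; apply: (kn_wz gen).
  by rewrite ltnS composition_le.
have P4 : \prod_(j | j != k) th (qshift q z y k / qshift q z y j) != 0.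
  by apply/prodf_neq0 => j jk; apply: uu; rewrite eq_sym.
have P5 : \prod_j th ((a l)^-1 / z j) != 0 by apply/prodf_neq0.
have su_k := su k.
move: P1 P2 su_k su'k.
move: (\prod_(j | j != k) th (qshift q z y k * q / _)) (\prod_j th (q / z j * _)) (th ((a l)^-1 / qshift q z y k)) (th ((a l)^-1 / (qshift q z y k * q))) => A1 A2 A3 A4 h1 h2 h3 h4.
by field; rewrite h1 h2 h3 h4 P3 P4 P5.
Qed.

Lemma primal_sum y : (\sum_j y j)%N = N ->
  \sum_k F (incr k y) k =
  \sum_i rec_coef N z w a l i * kn_summand z (bump_at i w) (bump_at l a) y.
Proof.
move=> yN; have yN' : (\sum_j y j <= N.+1)%N by rewrite yN.
have [uu au su sz] := shifted_poles yN'.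
rewrite (eq_bigr _ (fun k _ => primal_term k yN)) -mulr_sumr.
have wu i j : th (w i * qshift q z y j) != 0.
  by rewrite /qshift mulrA; apply: (kn_wz gen); rewrite ltnS composition_le.
(* The sum over the n + 1 nodes becomes the sum over the m + 1 parameters w_i that the recursion
   requires. *)
rewrite partial_fractions_dual //; last 2 first.
- by move=> i j ij; apply: nonroot1 (kn_w gen ij).
- by move=> i; apply: nonroot1 (kn_wa gen i).
rewrite mulrN -mulNr mulr_sumr; apply: eq_bigr => i _.
have wl : th (w i / a l) != 0 by apply: nonroot1 (kn_wa gen i).
have wz j : th (w i * z j) != 0.
  by have := kn_wz gen i j (ltn0Sn _); rewrite expr0 mulr1.
have ww j : j != i -> th (w i / w j) != 0.
  by move=> ji; apply: nonroot1 (kn_w gen _); rewrite eq_sym.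
have az j : th (a l * z j) != 0 by apply: nonroot1 (kn_a gen j).
have u0 j : qshift q z y j != 0 by apply: qshift_neq0.
rewrite kn_summand_bump; [|by apply/prodf_neq0..].
(* All thetas of inverted arguments are turned over. The monomials that this produces cancel because
   of the balancing condition, used below to eliminate the product of the a_j. *)
rewrite /rho /rec_coef (prod_theta_invM (a0 l) u0) (prod_theta_invM (a0 l) z0).
rewrite (prod_theta_invM (w0 i) u0) (prod_theta_inv_div predT (w0 i) a0).
rewrite (prod_theta_inv_div (fun j => j != i) (w0 i) w0).
have -> : (a l)^-1 / (w i)^-1 = w i / a l by rewrite invrK mulrC.
have -> : (a l)^-1 * q ^+ N / (w i)^-1 = q ^+ N * w i / a l by rewrite invrK; ring.
rewrite prod_qshift yN.
have -> : #|(fun j : 'I_m.+1 => j != i)| = m by rewrite (cardC1 i) card_ord.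
have -> : #|@predT 'I_(n.+1 + m.+1)| = (n.+1 + m.+1)%N by rewrite cardT size_enum_ord.
have Z0 : \prod_k z k != 0 by apply/prodf_neq0.
have W0 : \prod_(j | j != i) w j != 0 by apply/prodf_neq0.
have -> : \prod_(j | predT j) a j = w i * (\prod_(j | j != i) w j) / \prod_k z k.
  have <- : \prod_k w k = w i * \prod_(j | j != i) w j by rewrite (bigD1 i).
  by rewrite balanced mulrAC divff // mul1r.
have -> : \prod_(j | predT j) th (w i / a j) = th (w i / a l) * \prod_(j | j != l) th (w i / a j).
  by rewrite (bigD1 l).
rewrite exprD.
have H1 : \prod_j th (a l * z j) != 0 by apply/prodf_neq0.
have H2 : \prod_j th (w i * qshift q z y j) != 0 by apply/prodf_neq0.
have H3 : \prod_j th (w i * z j) != 0 by apply/prodf_neq0.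
have H4 : \prod_(j | j != i) th (w i / w j) != 0 by apply/prodf_neq0.
have sl : (- (a l)^-1) ^+ n.+1 != 0 by rewrite expf_neq0 // oppr_eq0 invr_eq0.
have sw k : (- (w i)^-1) ^+ k != 0 by rewrite expf_neq0 // oppr_eq0 invr_eq0.
have qN : q ^+ N != 0 by rewrite expf_neq0.
rewrite [(- (w i)^-1) ^+ m.+1]exprS.
have sn := sw n.+1; have sm := sw m.
move: H1 H2 H3 H4 sl sn sm qN W0 Z0 wl (w0 i).
move: (\prod_j th (a l * z j)) (\prod_j th (w i * qshift q z y j)) (\prod_j th (w i * z j))
  (\prod_(j | j != i) th (w i / w j)) (\prod_(j | j != i) w j) (\prod_k z k) => X1 X2 X3 X4 X5 X6.
move: ((- (w i)^-1) ^+ n.+1) ((- (w i)^-1) ^+ m) ((- (a l)^-1) ^+ n.+1) => Y1 Y2 Y3.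
move: (th (w i / a l)) (q ^+ N) (w i) => T1 QN wi *.
by field; do ?[apply/andP; split].
Qed.

Theorem primal_recursion B : (N < B)%N ->
  th (q ^+ N.+1) * csum B N.+1 (kn_summand z w a) =
  \sum_i rec_coef N z w a l i * csum B N (kn_summand z (bump_at i w) (bump_at l a)).
Proof.
move=> NB; rewrite csum_scale (eq_csum B primal_insertion) csum_step //.
  by rewrite (eq_csum B primal_sum) csum_comb.
move=> y k yk; rewrite /F pf_coef_eq0 ?mul0r ?mulr0 //.
by rewrite /qshift yk expr0 mulr1.
Qed.

End PrimalRecursion.

(** * The recursion for the sum over w *)

Section DualRecursion.
Variables (n m r N : nat) (z : 'I_n -> C) (w : 'I_m.+1 -> C) (a : 'I_r -> C) (l : 'I_r).
Hypotheses (w0 : forall k, w k != 0) (a0 : forall k, a k != 0).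
Hypothesis gen : kn_generic N.+1 z w a l.

(** Here the poles are the inverses of the base points w_i and the zeros those of the shifted
    points. By [qshift_bump], multiplying the base point w_i by q while lowering y_i leaves the
    shifted points fixed, so each term of this expansion is already a summand with w_i replaced by q
    w_i. The point [x] is the inverse of the shifted parameter q a_l. *)
Let x := (a l * q)^-1.
Let winv k := (w k)^-1.
Let uinv y k := (qshift q w y k)^-1.
Let G y i := pf_coef th winv (uinv y) i *
  (th (x * q ^+ N.+1 / winv i) / th (x / winv i)) *
  ((\prod_k th (x / winv k)) / \prod_k th (x / uinv y k)).

Lemma dual_nonroots y : (\sum_k y k)%N = N.+1 ->
  [/\ forall k, th (x * w k) != 0, forall k, th (x * qshift q w y k) != 0 &
      forall i j, i != j -> th (w i / w j) != 0].
Proof.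
move=> yN; have le k : (y k <= N.+1)%N by rewrite -yN; exact: leq_composition.
split.
- move=> k; have := kn_wa gen k (leq0n _) (isT : (1 <= N.+1)%N).
  congr (th _ != 0); rewrite /x invfM expr0 expr1; ring.
- move=> k; have := kn_wa gen k (le k) (isT : (1 <= N.+1)%N).
  congr (th _ != 0); rewrite /x /qshift invfM expr1; ring.
- by move=> i j ij; apply: nonroot1 (kn_w gen ij).
Qed.

Lemma dual_insertion y : (\sum_k y k)%N = N.+1 ->
  th (q ^+ N.+1) * kn_summand w z (fun j => (a j)^-1) y =
  \sum_i kn_summand w z (fun j => (a j)^-1) y * G y i.
Proof.
move=> yN; have [xw xu ww] := dual_nonroots yN.
have xw' k : th (x / winv k) != 0 by rewrite /winv invrK.
have xu' k : th (x / uinv y k) != 0 by rewrite /uinv invrK.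
have u0 k : qshift q w y k != 0 by apply: qshift_neq0.
rewrite -mulr_sumr mulrC; congr (_ * _).
rewrite -mulr_suml -(@partial_fractions _ _ thP _ winv (uinv y) x (q ^+ N.+1)) //.
- rewrite prodf_div.
  have P1 : \prod_k th (x / winv k) != 0 by apply/prodf_neq0.
  have P2 : \prod_k th (x / uinv y k) != 0 by apply/prodf_neq0.
  by field; rewrite P1 P2.
- by move=> j; rewrite invr_neq0.
- by move=> j; rewrite invr_neq0.
- by rewrite invr_neq0 // mulf_neq0.
- by move=> i j ij; rewrite /winv invrK mulrC ww // eq_sym.
- rewrite !prodfV invrK prod_qshift yN.
  have pw : \prod_k w k != 0 by apply/prodf_neq0.
  by field.
Qed.

(** In q w_k/w_j the factor q on w_i acts twice. As a node (k = i) it removes the first factor of a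
    raised symbol; as a coefficient (j = i) it divides the argument by q. For j = k = i both effects
    cancel, and only the last factor of the symbol is left over. *)
Lemma epoch_prod_denominator (i : 'I_m.+1) y :
  epoch_prod (fun j => q / bump_at i w j) (bump_at i w) y *
    (\prod_(j | j != i) th (w i * q / w j)) *
    (\prod_k th (qshift q w (incr i y) k / w i)) =
  epoch_prod (fun j => q / w j) w (incr i y) * \prod_(k | k != i) th (w k / w i).
Proof.
rewrite /epoch_prod (bigD1 i) //= [in RHS](bigD1 i) //=.
have -> : \prod_(j | j != i) \prod_k ep (q / w j * w k) (incr i y k) =
    (\prod_(j | j != i) \prod_k ep (q / bump_at i w j * bump_at i w k) (y k)) *
    \prod_(j | j != i) th (w i * q / w j).
  rewrite -big_split /=; apply: eq_bigr => j ji.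
  rewrite bump_at_neq // -(prod_epoch_bump i) mulrC.
  by congr (_ * th _); rewrite mulrC mulrA.
rewrite (bigD1 i) //= [X in _ = X * _ * _](bigD1 i) //= [X in _ * X = _](bigD1 i) //=.
have wi := w0 i.
have -> : q / bump_at i w i * bump_at i w i = q.
  by rewrite bump_at_id; field; rewrite wi q0.
have -> : q / w i * w i = q by field.
have -> : qshift q w (incr i y) i / w i = q * q ^+ y i.
  by rewrite /qshift /incr eqxx addn1 exprS; field.
have -> : ep q (incr i y i) = ep q (y i) * th (q * q ^+ y i).
  by rewrite /incr eqxx addn1 epochS.
have e : (\prod_(k | k != i) ep (q / bump_at i w i * bump_at i w k) (y k)) *
    (\prod_(k | k != i) th (qshift q w (incr i y) k / w i)) =
    (\prod_(k | k != i) ep (q / w i * w k) (incr i y k)) * \prod_(k | k != i) th (w k / w i).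
  rewrite -!big_split; apply: eq_bigr => k ki /=.
  rewrite bump_at_id bump_at_neq // /qshift /incr (negbTE ki) addn0.
  have -> : q / (w i * q) * w k = w k / w i by field; rewrite wi q0.
  have -> : w k * q ^+ y k / w i = w k / w i * q ^+ y k by ring.
  rewrite epoch_shift mulrC; congr (ep _ _ * _); by ring.
move: e; move: (\prod_(k | k != i) ep (q / bump_at i w i * bump_at i w k) (y k))
  (\prod_(k | k != i) th (qshift q w (incr i y) k / w i))
  (\prod_(k | k != i) ep (q / w i * w k) (incr i y k)) (\prod_(k | k != i) th (w k / w i)) => P1 P2 P3 P4 e.
move: (\prod_(j | j != i) \prod_k ep (q / bump_at i w j * bump_at i w k) (y k))
  (\prod_(j | j != i) th (w i * q / w j)) (ep q (y i)) (th (q * q ^+ y i)) => R Q E T.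
by transitivity (E * T * (R * Q) * (P1 * P2)); [ring | rewrite e; ring].
Qed.

Lemma epoch_prod_numerator (i : 'I_m.+1) y (A := \prod_(j | j != l) th (w i / a j)) :
  (\prod_k th (x * qshift q w (incr i y) k)) *
    (th (x * w i) * A * epoch_prod (fun j => (bump_at l a j)^-1) (bump_at i w) y) =
  (\prod_k th (x * w k)) * epoch_prod (fun j => (a j)^-1) w (incr i y).
Proof.
have xE : (bump_at l a l)^-1 = x by rewrite bump_at_id.
have := epoch_prod_bump_coef l (fun j => (bump_at l a j)^-1) w (incr i y).
rewrite xE.
have -> : bump_at l (fun j => (bump_at l a j)^-1) = fun j => (a j)^-1.
  apply/funext => j; have [->|jl] := eqVneq j l; last by rewrite !bump_at_neq.
  by rewrite !bump_at_id invfM; field; rewrite q0 a0.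
move=> <-; rewrite mulrC; congr (_ * _).
rewrite -epoch_prod_bump_base (bigD1 l) //= xE; congr (_ * _ * _).
by apply: eq_bigr => j jl; rewrite bump_at_neq // mulrC.
Qed.

Lemma dual_term (i : 'I_m.+1) y : (\sum_k y k)%N = N ->
  rec_coef N z w a l i * kn_summand (bump_at i w) z (fun j => (bump_at l a j)^-1) y =
  kn_summand w z (fun j => (a j)^-1) (incr i y) * G (incr i y) i.
Proof.
move=> yN; have YN : (\sum_k incr i y k)%N = N.+1 by rewrite sum_incr yN.
have le k : (incr i y k <= N.+1)%N by rewrite -YN; exact: leq_composition.
have [xw xu ww] := dual_nonroots YN.
rewrite !kn_summandE qshift_bump (Delta_bump w0); last by move=> j ji; apply: ww; rewrite eq_sym.
rewrite /rec_coef prodf_div.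
have hz : (\prod_j th (w i * z j)) * epoch_prod z (bump_at i w) y = epoch_prod z w (incr i y).
  by rewrite -epoch_prod_bump_base; congr (_ * _); apply: eq_bigr => j _; rewrite mulrC.
have hn := epoch_prod_numerator i y.
have hd := epoch_prod_denominator i y.
have S0 : \prod_k th (qshift q w (incr i y) k / w i) != 0.
  apply/prodf_neq0 => k _; have [->|ki] := eqVneq k i.
    have -> : qshift q w (incr i y) i / w i = q ^+ (y i).+1.
      by rewrite /qshift /incr eqxx addn1; field.
    by apply: (kn_q gen); rewrite /= ltnS -yN; exact: leq_composition.
  have := kn_w gen ki (le k) (leq0n _); rewrite expr0 divr1.
  by congr (th _ != 0); rewrite /qshift; ring.
have B0 : \prod_(j | j != i) th (w i / w j) != 0.
  by apply/prodf_neq0 => j ji; apply: ww; rewrite eq_sym.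
have V0 : \prod_(k | k != i) th (w k / w i) != 0 by apply/prodf_neq0 => k ki; apply: ww.
have Q0 : \prod_(j | j != i) th (w i * q / w j) != 0.
  apply/prodf_neq0 => j ji; rewrite eq_sym in ji.
  have := kn_w gen ji (isT : (1 <= N.+1)%N) (leq0n _); rewrite expr0 divr1.
  by congr (th _ != 0); rewrite expr1; ring.
have X0 : \prod_k th (x * qshift q w (incr i y) k) != 0 by apply/prodf_neq0.
have xi := xw i.
rewrite /G /pf_coef.
have -> : \prod_j th (winv i / uinv (incr i y) j) = \prod_k th (qshift q w (incr i y) k / w i).
  by apply: eq_bigr => j _; rewrite /winv /uinv invrK mulrC.
have -> : \prod_(j | j != i) th (winv i / winv j) = \prod_(k | k != i) th (w k / w i).
  by apply: eq_bigr => j _; rewrite /winv invrK mulrC.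
have -> : \prod_k th (x / winv k) = \prod_k th (x * w k).
  by apply: eq_bigr => j _; rewrite /winv invrK.
have -> : \prod_k th (x / uinv (incr i y) k) = \prod_k th (x * qshift q w (incr i y) k).
  by apply: eq_bigr => j _; rewrite /uinv invrK.
have -> : x / winv i = x * w i by rewrite /winv invrK.
have -> : x * q ^+ N.+1 / winv i = q ^+ N * w i / a l.
  by rewrite /winv invrK /x exprS; field; rewrite q0 a0.
move: hz hn hd S0 B0 V0 Q0 X0 xi.
move: (epoch_prod z w _) (epoch_prod z _ _) (epoch_prod (fun j => (a j)^-1) w _)
  (epoch_prod (fun j => (bump_at l a j)^-1) _ _) (epoch_prod (fun j => q / w j) _ _)
  (epoch_prod (fun j => q / bump_at i w j) _ _) => g2 g2' g1 g1' g3 g3'.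
move: (\prod_j th (w i * z j)) (\prod_(j | j != l) _) (th (x * w i)) (th (q ^+ N * _ / _))
  => Zp A xi T.
move: (\prod_(j | j != i) th (w i / w j)) (\prod_(j | j != i) th (w i * q / w j))
  (\prod_(j | j != i) th (w j / w i)) => Bp Qp Vp.
move: (\prod_k th (x * w k)) (\prod_k th (x * qshift q w (incr i y) k))
   (\prod_k th (qshift q w (incr i y) k / w i)) => X XU S.
move: (Delta _ w) (Delta _ _) => D2 D1 hz hn hd S0 B0 V0 Q0 X0 xi0.
have h1 : A * g1' = X * g1 / (XU * xi) by rewrite -hn; field; rewrite X0 xi0.
have h3 : g3' = g3 * Vp / (Qp * S) by rewrite -hd; field; rewrite S0 Q0.
rewrite h3 -hz.
transitivity (T * D1 / D2 / Zp / g2' / g3 * S / Vp * (A * g1')).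
  rewrite !invfM !invrK.
  transitivity ((Bp^-1 * Bp) * (Qp^-1 * Qp) * (T * D1 / D2 / Zp / g2' / g3 * S / Vp * (A * g1'))).
    by ring.
  by rewrite !mulVf // !mul1r.
by rewrite h1 !invfM; ring.
Qed.

Theorem dual_recursion B : (N < B)%N ->
  th (q ^+ N.+1) * csum B N.+1 (kn_summand w z (fun j => (a j)^-1)) =
  \sum_i rec_coef N z w a l i *
    csum B N (kn_summand (bump_at i w) z (fun j => (bump_at l a j)^-1)).
Proof.
move=> NB; rewrite csum_scale (eq_csum B dual_insertion) csum_step //.
  rewrite -csum_comb; apply: eq_csum => y yN; apply: eq_bigr => i _.
  by rewrite dual_term.
move=> y k yk; rewrite /G pf_coef_eq0 ?mul0r ?mulr0 //.
  by rewrite /winv /uinv /qshift yk expr0 mulr1.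
by rewrite invr_neq0 // qshift_neq0.
Qed.

End DualRecursion.

(** * The duality *)

Lemma csum0 n B (f : ('I_n -> nat) -> C) : csum B 0 f = f (fun=> 0%N).
Proof.
rewrite /csum (big_pred1 [ffun=> ord0]) => [|y].
  by congr f; apply/funext => k; rewrite ffunE.
rewrite sum_nat_eq0; apply/forallP/eqP => [h|-> k]; last by rewrite ffunE.
by apply/ffunP => k; rewrite ffunE; apply: val_inj; apply/eqP; have := h k.
Qed.

Lemma kn_summand0 n m r (z : 'I_n -> C) (w : 'I_m -> C) (a : 'I_r -> C) :
  Delta p z != 0 -> kn_summand z w a (fun=> 0%N) = 1.
Proof.
move=> D0; rewrite kn_summandE.
have -> : qshift q z (fun=> 0%N) = z by apply/funext => k; rewrite /qshift expr0 mulr1.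
have g0 s (c : 'I_s -> C) : epoch_prod c z (fun=> 0%N) = 1.
  by rewrite /epoch_prod big1 // => j _; rewrite big1 // => k _; rewrite epoch0.
by rewrite !g0 divff // !mul1r invr1.
Qed.

Lemma prod_bump n (i : 'I_n) (z : 'I_n -> C) : \prod_k bump_at i z k = q * \prod_k z k.
Proof.
rewrite (bigD1 i) //= [in RHS](bigD1 i) //= bump_at_id mulrCA mulrA.
by congr (_ * _); apply: eq_bigr => k ki; rewrite bump_at_neq.
Qed.

(** The index [l] is auxiliary: it selects the numerator parameter that the recursions shift, and
    does not enter the conclusion. The bound [B] stays fixed while N decreases. *)
Theorem kajihara_noumi n m B N (z : 'I_n.+1 -> C) (w : 'I_m.+1 -> C)
    (a : 'I_(n.+1 + m.+1) -> C) (l : 'I_(n.+1 + m.+1)) : (N <= B)%N ->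
  (forall k, z k != 0) -> (forall k, w k != 0) -> (forall k, a k != 0) ->
  \prod_k w k = (\prod_k z k) * \prod_k a k ->
  kn_generic N z w a l ->
  csum B N (kn_summand z w a) = csum B N (kn_summand w z (fun j => (a j)^-1)).
Proof.
elim: N => [|N IH] in w a * => NB z0 w0 a0 bal gen.
  rewrite !csum0 !kn_summand0 //; apply: Delta_neq0 => // i j ij.
    by apply: nonroot1 (kn_w gen ij).
  by apply: nonroot1 (kn_z gen ij).
have qN : th (q ^+ N.+1) != 0 by apply: (kn_q gen); rewrite /= leqnn.
apply: (mulfI qN).
rewrite (primal_recursion z0 w0 a0 bal gen NB) (dual_recursion w0 a0 gen NB).
apply: eq_bigr => i _; congr (_ * _); apply: IH => //.
- exact: ltnW.
- by move=> k; apply: bump_at_neq0.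
- by move=> k; apply: bump_at_neq0.
- by rewrite !prod_bump bal mulrCA.
- exact: kn_generic_bump.
Qed.

(** * Reversal of symbols and the generic case *)

Lemma expr_1subz N i : (i < N)%N -> q ^ (1 - N%:Z) * q ^+ i = (q ^+ (N - i.+1))^-1.
Proof.
move=> iN; have qn : q ^+ (N - i.+1) != 0 by rewrite expf_neq0.
apply: (mulIf qn); rewrite mulVf // !exprnP -!expfzDr //.
by rewrite (_ : _ + _ = 0) ?expr0z //; lia.
Qed.

(** The last l factors of [ep c N], read backwards and turned over by theta(1/x) = - theta(x)/x,
    form a symbol of length l starting at q^(1-N)/c. *)
Lemma epoch_reflection c N k l : c != 0 -> (k + l)%N = N ->
  ep c N = ep c k * ((- c) ^+ l * \prod_(i < l) q ^+ (N - i.+1)) *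
    ep (q ^ (1 - N%:Z) / c) l.
Proof.
move=> c0 kl; rewrite -kl {1}/epoch big_split_ord /= kl -mulrA; congr (_ * _).
rewrite (reindex_inj rev_ord_inj) /= /epoch -[l in _ ^+ l]card_ord -prodr_const -!big_split.
apply: eq_bigr => i _ /=.
have -> : (k + (l - i.+1))%N = (N - i.+1)%N by have := ltn_ord i; lia.
have X0 : c * q ^+ (N - i.+1) != 0 by rewrite mulf_neq0 // expf_neq0.
rewrite (thetaVE thP X0) invfM.
have -> : q ^ (1 - N%:Z) / c * q ^+ i = (q ^+ (N - i.+1))^-1 / c.
  by rewrite mulrAC expr_1subz //; have := ltn_ord i; lia.
by rewrite [c^-1 * _]mulrC; ring.
Qed.

Lemma epoch_neq0P x N : reflect (forall c, (c < N)%N -> th (x * q ^+ c) != 0) (ep x N != 0).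
Proof.
apply: (iffP (prodf_neq0 _ _)) => h; last by move=> i _; apply: h.
by move=> c cN; apply: (h (Ordinal cN)).
Qed.

(** Reflection links (w_1/a)_k to 1/(w_2 x)_l and (w_1 z)_k to 1/(w_2/b)_l, and likewise with the
    roles of w_1 and w_2 exchanged; this is the origin of x and b. The reflections of w_i/a and of
    w_i z differ by powers of a z with exponents k and l, which combine to [(a * z) ^+ N]. *)
Lemma epoch_swap N k l (a z w1 w2 x b : C) : (k + l)%N = N ->
  a != 0 -> z != 0 -> w1 != 0 -> w2 != 0 ->
  x = q ^ (1 - N%:Z) * a / (w1 * w2) -> b = q ^ (N%:Z - 1) * w1 * w2 * z ->
  ep (w1 * z) N != 0 -> ep (w2 * z) N != 0 -> ep (w1 * x) N != 0 -> ep (w2 * x) N != 0 ->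
  ep (a^-1 * w1) k * ep (a^-1 * w2) l / (ep (z * w1) k * ep (z * w2) l) =
  ((a * z) ^+ N * ep (w1 / a) N * ep (w2 / a) N / (ep (w1 * z) N * ep (w2 * z) N)) *
  (ep (b^-1 * w1) k * ep (b^-1 * w2) l / (ep (x * w1) k * ep (x * w2) l)).
Proof.
move=> kl a0 z0 w10 w20 xE bE; have lk : (l + k)%N = N by rewrite addnC.
have le0 y i j : (i + j)%N = N -> ep y N != 0 -> ep y i != 0.
  move=> ij /epoch_neq0P h; apply/epoch_neq0P => c ci; apply: h; lia.
have nz1 (c d : C) : c != 0 -> d != 0 -> c / d != 0 by move=> *; rewrite mulf_neq0 ?invr_neq0.
have qN : q ^ (1 - N%:Z) != 0 by rewrite expfz_neq0.
have qNE : q ^ (N%:Z - 1) = (q ^ (1 - N%:Z))^-1.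
  by rewrite invr_expz; congr (_ ^ _); lia.
have r1 := epoch_reflection (nz1 _ _ w10 a0) kl.
have r2 := epoch_reflection (nz1 _ _ w20 a0) lk.
have r3 := epoch_reflection (mulf_neq0 w10 z0) kl.
have r4 := epoch_reflection (mulf_neq0 w20 z0) lk.
have e1 : q ^ (1 - N%:Z) / (w1 / a) = w2 * x by rewrite xE; field; rewrite w10 w20 a0.
have e2 : q ^ (1 - N%:Z) / (w2 / a) = w1 * x by rewrite xE; field; rewrite w10 w20 a0.
have e3 : q ^ (1 - N%:Z) / (w1 * z) = w2 / b.
  by rewrite bE qNE; field; rewrite w10 w20 z0 qN.
have e4 : q ^ (1 - N%:Z) / (w2 * z) = w1 / b.
  by rewrite bE qNE; field; rewrite w10 w20 z0 qN.
rewrite {}e1 in r1; rewrite {}e2 in r2; rewrite {}e3 in r3; rewrite {}e4 in r4.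
rewrite r3 r4 !mulf_eq0 !negb_or => /andP[/andP[h1 /andP[h2 h3]] h4] /andP[/andP[h5 /andP[h6 h7]] h8].
move=> /(le0 _ _ _ kl) h9 /(le0 _ _ _ lk) h10.
rewrite r1 r2 ![_^-1 * _]mulrC ![_ * w1]mulrC ![_ * w2]mulrC -kl exprMn !exprD.
rewrite (_ : (- (w1 / a)) ^+ l = (- (w1 * z)) ^+ l / (a * z) ^+ l); last first.
  by rewrite -expr_div_n; congr (_ ^+ _); field; rewrite a0 z0.
rewrite (_ : (- (w2 / a)) ^+ k = (- (w2 * z)) ^+ k / (a * z) ^+ k); last first.
  by rewrite -expr_div_n; congr (_ ^+ _); field; rewrite a0 z0.
have ak : a ^+ k != 0 by rewrite expf_neq0.
have al : a ^+ l != 0 by rewrite expf_neq0.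
have zk : z ^+ k != 0 by rewrite expf_neq0.
have zl : z ^+ l != 0 by rewrite expf_neq0.
rewrite kl !exprMn.
move: h1 h2 h3 h4 h5 h6 h7 h8 h9 h10 ak al zk zl.
move: (a ^+ k) (a ^+ l) (z ^+ k) (z ^+ l) => Ak Al Zk Zl.
move: (ep (w1 * z) k) (ep (w2 * z) l) (ep (w1 * x) k) (ep (w2 * x) l) (ep (w1 / b) k) (ep (w2 / b) l) => E1 E2 E3 E4 E5 E6.
move: (\prod_(i < l) _) (\prod_(i < k) _) ((- (w1 * z)) ^+ l) ((- (w2 * z)) ^+ k) => P1 P2 P3 P4.
move=> h1 h2 h3 h4 h5 h6 h7 h8 h9 h10 ak al zk zl.
by field; do ?[apply/andP; split].
Qed.

Definition wpair (w1 w2 : C) : 'I_2 -> C := fun i => if i == ord0 then w1 else w2.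

Lemma wpair0 w1 w2 : wpair w1 w2 ord0 = w1. Proof. by []. Qed.
Lemma wpair1 w1 w2 : wpair w1 w2 (lift ord0 ord0) = w2. Proof. by []. Qed.

Lemma composition_sumE n N w1 w2 (a : 'I_(n + 2) -> C) (z : 'I_n -> C) :
  composition_sum p q w1 w2 N a z = csum N N (kn_summand z (wpair w1 w2) a).
Proof.
apply: eq_bigr => y _; rewrite /summand /kn_summand; congr (_ * _).
apply: eq_bigr => k _; rewrite /factor_den; congr (_ / (_ * _)).
by rewrite !big_ord_recl big_ord0 mulr1.
Qed.

Definition prefactor n N m w1 w2 (a : 'I_(n + 2) -> C) (z : 'I_n -> C) : C :=
  \prod_(j < n | (j < n - m)%N)
     ((a (lshift 2 j) * z j) ^+ N
      * ep (w1 / a (lshift 2 j)) N * ep (w2 / a (lshift 2 j)) N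
      / (ep (w1 * z j) N * ep (w2 * z j) N)).

Lemma new_bl n N m w1 w2 (a : 'I_(n + 2) -> C) (z : 'I_n -> C) j :
  new_b q w1 w2 N m a z (lshift 2 j) =
  if (j < n - m)%N then q ^ (N%:Z - 1) * w1 * w2 * z j else a (lshift 2 j).
Proof. by rewrite /new_b (unsplitK (inl j)). Qed.

Lemma new_br n N m w1 w2 (a : 'I_(n + 2) -> C) (z : 'I_n -> C) j :
  new_b q w1 w2 N m a z (rshift n j) = a (rshift n j).
Proof. by rewrite /new_b (unsplitK (inr j)). Qed.

Section Generic.
Variables (n N m : nat) (w1 w2 : C) (a : 'I_(n.+1 + 2) -> C) (z : 'I_n.+1 -> C)
  (l : 'I_(n.+1 + 2)).
Hypotheses (z0 : forall k, z k != 0) (w10 : w1 != 0) (w20 : w2 != 0)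
  (a0 : forall k, a k != 0).
Hypothesis balanced : w1 * w2 = (\prod_k z k) * \prod_k a k.
Let x := new_x q w1 w2 N m a z.
Let b := new_b q w1 w2 N m a z.

Lemma new_x_neq0 k : x k != 0.
Proof.
rewrite /x /new_x; case: ifP => _ //.
by rewrite !mulf_neq0 ?invr_neq0 ?expfz_neq0 ?mulf_neq0.
Qed.

Lemma new_b_neq0 k : b k != 0.
Proof.
case: (split_ordP k) => j ->; rewrite /b ?new_bl ?new_br //.
by case: ifP => // _; rewrite !mulf_neq0 ?expfz_neq0.
Qed.

Lemma new_xb k : x k * b (lshift 2 k) = z k * a (lshift 2 k).
Proof.
rewrite /x /b /new_x new_bl; case: ifP => // _.
have e : q ^ (N%:Z - 1) * q ^ (1 - N%:Z) = 1.
  by rewrite -expfzDr // (_ : _ + _ = 0) ?expr0z //; lia.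
transitivity (q ^ (N%:Z - 1) * q ^ (1 - N%:Z) * (z k * a (lshift 2 k))); last by rewrite e mul1r.
by field; rewrite w10 w20.
Qed.

Lemma new_balanced : w1 * w2 = (\prod_k x k) * \prod_k b k.
Proof.
rewrite balanced !(@big_split_ord _ _ _ n.+1 2) /= !mulrA -!big_split /=.
congr (_ * _); first by apply: eq_bigr => k _; rewrite new_xb.
by apply: eq_bigr => k _; rewrite /b new_br.
Qed.

Lemma transformation_generic :
  kn_generic N z (wpair w1 w2) a l -> kn_generic N x (wpair w1 w2) b l ->
  composition_sum p q w1 w2 N a z = prefactor N m w1 w2 a z * composition_sum p q w1 w2 N b x.
Proof.
move=> gz gx.
have w0 k : wpair w1 w2 k != 0 by rewrite /wpair; case: ifP.
have prodw : \prod_k wpair w1 w2 k = w1 * w2 by rewrite !big_ord_recl big_ord0 mulr1.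
rewrite !composition_sumE.
rewrite (@kajihara_noumi n 1 N N z _ _ l) ?prodw //.
rewrite (@kajihara_noumi n 1 N N x _ _ l) ?prodw //; last first.
- exact: new_balanced.
- exact: new_b_neq0.
- exact: new_x_neq0.
rewrite /csum mulr_sumr; apply: eq_bigr => y /eqP yN.
(* The quotient of Deltas in a dual summand depends on w alone and is common to both sides. *)
rewrite !kn_summandE [RHS]mulrCA; congr (_ * _).
have ep0 (v : 'I_n.+1 -> C) (c : 'I_(n.+1 + 2) -> C) k : kn_generic N v (wpair w1 w2) c l ->
    ep (w1 * v k) N != 0 /\ ep (w2 * v k) N != 0.
  move=> g; split; apply/epoch_neq0P => i iN.
    exact: (kn_wz g ord0 k iN).
  exact: (kn_wz g (lift ord0 ord0) k iN).
rewrite big_ord_recl big_ord_recl big_ord0 addn0 in yN.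
have key : \prod_j \prod_k ep ((a (lshift 2 j))^-1 * wpair w1 w2 k) (y k) /
   \prod_j \prod_k ep (z j * wpair w1 w2 k) (y k) = prefactor N m w1 w2 a z *
  (\prod_j \prod_k ep ((b (lshift 2 j))^-1 * wpair w1 w2 k) (y k) /
   \prod_j \prod_k ep (x j * wpair w1 w2 k) (y k)).
  rewrite /prefactor [X in _ = X * _]big_mkcond -!prodf_div -big_split; apply: eq_bigr => j _ /=.
  rewrite !big_ord_recl !big_ord0 !mulr1 wpair0 wpair1 /b new_bl /x /new_x.
  case: ifP => jm; last by rewrite mul1r.
  have [h1 h2] := ep0 _ _ j gz; have [] := ep0 _ _ j gx; rewrite /x /new_x jm => h3 h4.
  exact: (epoch_swap yN).
rewrite /epoch_prod !(@big_split_ord _ _ _ n.+1 2) /= !invfM.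
rewrite (eq_bigr (fun j => \prod_k ep ((b (rshift n.+1 j))^-1 * wpair w1 w2 k) (y k))
  (P := xpredT) (F1 := fun j => \prod_k ep ((a (rshift n.+1 j))^-1 * wpair w1 w2 k) (y k))); last first.
  by move=> j _; apply: eq_bigr => k _; rewrite /b new_br.
set P1 := \prod_j \prod_k ep ((a _)^-1 * _) _ in key *.
set P2 := \prod_j \prod_k ep ((b (lshift 2 j))^-1 * _) _ in key *.
set P3 := \prod_j \prod_k ep (z j * _) _ in key *.
set P4 := \prod_j \prod_k ep (x j * _) _ in key *.
set R := \prod_j \prod_k ep ((b _)^-1 * _) _.
set Q := (X in _ * (_^-1 * X^-1)).
transitivity (P1 / P3 * (R / Q)); first by ring.
by rewrite key; ring.
Qed.

End Generic.

(** * Removal of the genericity assumptions *)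

Lemma near1_nonroot K (f : C -> C) c :
  (forall P : C -> Prop, (\forall s \near (1 : C)^', P s) -> \forall t \near (1 : C)^', P (f t)) ->
  c != 0 -> \forall t \near (1 : C)^', nonroot K (c * f t).
Proof.
move=> hf c0.
have h (i j : 'I_K.+1) : \forall t \near (1 : C)^', th (c * q ^+ i / q ^+ j * f t) != 0.
  by apply: (hf (fun s => th (c * q ^+ i / q ^+ j * s) != 0)); apply: theta_near1_neq0 => //; nz.
have h2 : \forall t \near (1 : C)^', forall i j : 'I_K.+1, th (c * q ^+ i / q ^+ j * f t) != 0.
  by apply: filter_forall => i; apply: filter_forall => j; apply: h.
apply: filterS h2 => t ht i j iK jK.
have := ht (inord i) (inord j); rewrite !inordK ?ltnS //.
by congr (th _ != 0); ring.
Qed.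

Lemma cont_epoch (f : C -> C) (x : C) k : f x != 0 -> {for x, continuous f} ->
  {for x, continuous (fun t => ep (f t) k)}.
Proof.
move=> fx cf; apply: continuous_prod => i _; apply: theta_continuous_comp => //.
  by nz.
by apply: cont_mul => //; exact: cont_cst.
Qed.

(** The composition that puts all of N at position k has symbols of full length N in its k-th
    denominator, which yields all positive exponents of q. Exponent 0 comes from Delta, and negative
    exponents from interchanging z_i and z_j. *)
Lemma nonzero_denominatorsP n N (w1 w2 : C) (z : 'I_n -> C) : (forall k, z k != 0) -> (0 < n)%N ->
  nonzero_denominators p q w1 w2 N z ->
  [/\ forall i j, i != j -> nonroot N (z i / z j),
      forall c, (0 < c <= N)%N -> th (q ^+ c) != 0,
      forall j c, (c < N)%N -> th (w1 * z j * q ^+ c) != 0 &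
      forall j c, (c < N)%N -> th (w2 * z j * q ^+ c) != 0].
Proof.
move=> z0 n0 [D0 den].
have den' k : factor_den p q w1 w2 z (fun j => if j == k then N else 0%N) k != 0.
  apply: den; rewrite (bigD1 k) //= eqxx big1 ?addn0 // => j /negbTE ->//.
have h k : [/\ ep (w1 * z k) N != 0, ep (w2 * z k) N != 0 & forall j, ep (q * z k / z j) N != 0].
  have := den' k; rewrite /factor_den eqxx !mulf_eq0 !negb_or => /andP[/andP[-> ->] /prodf_neq0 h].
  by split=> // j; apply: h.
have zz i j c : (0 < c <= N)%N -> th (z i / z j * q ^+ c) != 0.
  case: c => // c /= cN; have [_ _ /(_ j) /epoch_neq0P /(_ _ cN)] := h i.
  by congr (th _ != 0); rewrite exprS; ring.
have zz0 i j : i != j -> th (z i / z j) != 0.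
  have aux (k l : 'I_n) : (k < l)%N -> th (z l / z k) != 0.
    move=> kl; move/prodf_neq0: D0 => /(_ k isT) /prodf_neq0 /(_ l kl).
    by rewrite mulf_eq0 negb_or => /andP[].
  rewrite -(inj_eq val_inj) /= neq_ltn => /orP[ij|]; last exact: aux.
  have zij : z j / z i != 0 by rewrite mulf_neq0 ?invr_neq0.
  rewrite -invf_div (thetaV thP zij) mulf_neq0 ?invr_neq0 // oppr_eq0; exact: aux.
split.
- move=> i j ij c d cN dN; have [cd|cd|->] := ltngtP c d.
  + have -> : z i / z j * q ^+ c / q ^+ d = (z j / z i * q ^+ (d - c))^-1.
      rewrite -[in LHS](subnK (ltnW cd)) exprD !invfM invrK.
      have qc : q ^+ c != 0 by nz.
      have qdc : q ^+ (d - c) != 0 by nz.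
      by field; rewrite qc qdc z0.
    rewrite (thetaV thP); last by rewrite !mulf_neq0 ?invr_neq0 ?expf_neq0.
    rewrite mulf_neq0 ?invr_neq0 ?oppr_eq0 //; last by rewrite !mulf_neq0 ?invr_neq0 ?expf_neq0.
    by apply: zz; lia.
  + rewrite -(subnK (ltnW cd)) exprD mulrA mulfK ?expf_neq0 //.
    by apply: zz; lia.
  + by rewrite mulfK ?expf_neq0 // zz0.
- move=> c cN; have := zz (Ordinal n0) (Ordinal n0) c cN.
  by rewrite divff // mul1r.
- by move=> j; have [/epoch_neq0P ? _ _] := h j.
- by move=> j; have [_ /epoch_neq0P ? _] := h j.
Qed.

Lemma cont_composition_sum n N (f1 f2 : C -> C) (a : C -> 'I_(n + 2) -> C) (z : 'I_n -> C) :
  (forall k, z k != 0) -> f1 1 != 0 -> f2 1 != 0 -> (forall j, a 1 j != 0) ->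
  {for (1 : C), continuous f1} -> {for (1 : C), continuous f2} ->
  (forall j, {for (1 : C), continuous (a^~ j)}) ->
  nonzero_denominators p q (f1 1) (f2 1) N z ->
  {for (1 : C), continuous (fun t => composition_sum p q (f1 t) (f2 t) N (a t) z)}.
Proof.
move=> z0 f10 f20 a0 cf1 cf2 ca [D0 den].
apply: continuous_sum => y /eqP yN; apply: cont_mul; first exact: cont_cst.
apply: continuous_prod => k _; apply: cont_mul.
  apply: continuous_prod => j _; apply: (cont_epoch (f := fun t => a t j * z k)).
    by rewrite mulf_neq0.
  by apply: cont_mul => //; exact: cont_cst.
apply: cont_inv; first exact: (den (fun k => y k)).
apply: cont_mul; last exact: cont_cst.
by apply: cont_mul; (apply: cont_epoch; [by rewrite mulf_neq0|];
  apply: cont_mul => //; exact: cont_cst).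
Qed.

(* Together with w_1 t and w_2 / t, this preserves the balancing condition, and all of
   w_1 / w_2, a_{n+1} z_k and w_k / a_{n+1} are multiplied by nonzero powers of t. *)
Definition perturb n (t : C) (a : 'I_(n + 2) -> C) : 'I_(n + 2) -> C := fun j =>
  a j * (if j == rshift n ord0 then t ^+ 2 else
         if j == rshift n (lift ord0 ord0) then t ^- 2 else 1).

Lemma perturb_l n t (a : 'I_(n + 2) -> C) j : perturb t a (lshift 2 j) = a (lshift 2 j).
Proof. by rewrite /perturb !eq_shift mulr1. Qed.

Lemma perturb_neq0 n t (a : 'I_(n + 2) -> C) j : t != 0 -> a j != 0 -> perturb t a j != 0.
Proof.
move=> t0 aj; rewrite /perturb mulf_neq0 //; case: ifP => _; first by nz.
by case: ifP => _; [nz | exact: oner_neq0].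
Qed.

Lemma prod_perturb n t (a : 'I_(n + 2) -> C) : t != 0 -> \prod_j perturb t a j = \prod_j a j.
Proof.
move=> t0; rewrite big_split_ord [RHS]big_split_ord /=; congr (_ * _).
  by apply: eq_bigr => j _; rewrite perturb_l.
rewrite !big_ord_recl !big_ord0 /perturb !eq_shift /=.
have tt : t ^+ 2 != 0 by nz.
by field.
Qed.

Lemma cont_perturb n (a : 'I_(n + 2) -> C) j :
  {for (1 : C), continuous (fun t => perturb t a j)}.
Proof.
apply: cont_mul; first exact: cont_cst.
case: (j == rshift n ord0); first exact: continuous_exprn.
case: (j == _); last exact: cont_cst.
by apply: cont_inv; [rewrite expr1n oner_neq0 | exact: continuous_exprn].
Qed.

Lemma perturb1 n (a : 'I_(n + 2) -> C) : perturb 1 a = a.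
Proof.
by apply/funext => j; rewrite /perturb !expr1n invr1; do ?case: ifP => _; rewrite mulr1.
Qed.

(** The conditions on z and q do not involve t. Those on w_i z_j hold at t = 1, hence nearby by
    continuity. The remaining ones may fail at t = 1, but their arguments carry one of the powers
    t^2, t^-2, t^-1, t^-3, so they hold for t near 1 with t different from 1. *)
Lemma near1_kn_generic n N (w1 w2 : C) (a : 'I_(n + 2) -> C) (z : 'I_n -> C) : (0 < n)%N ->
  (forall k, z k != 0) -> w1 != 0 -> w2 != 0 -> (forall j, a j != 0) ->
  nonzero_denominators p q w1 w2 N z ->
  \forall t \near (1 : C)^',
    kn_generic N z (wpair (w1 * t) (w2 / t)) (perturb t a) (rshift n ord0).
Proof.
move=> n0 z0 w10 w20 a0 /(nonzero_denominatorsP z0 n0)[hz hq hw1 hw2].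
set l := rshift n ord0.
have al : a l != 0 by [].
have wz (f : C -> C) (w : C) : {for (1 : C), continuous f} -> f 1 = w -> w != 0 ->
    (forall j c, (c < N)%N -> th (w * z j * q ^+ c) != 0) ->
    \forall t \near (1 : C)^', forall (j : 'I_n) (c : 'I_N), th (f t * z j * q ^+ c) != 0.
  move=> cf f1 w0 hw; apply: filter_forall => j; apply: filter_forall => c.
  apply: (near1_neq0 (f := fun t => th (f t * z j * q ^+ c))); last by rewrite f1 hw.
  apply: theta_continuous_comp => //; first by rewrite f1; nz.
  by do 2 (apply: cont_mul; last exact: cont_cst).
have cw1 : {for (1 : C), continuous (fun t : C => w1 * t)}.
  by apply: cont_mul; [exact: cont_cst|exact: cont_id].
have cw2 : {for (1 : C), continuous (fun t : C => w2 / t)}.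
  apply: cont_mul; first exact: cont_cst.
  by apply: cont_inv; [exact: oner_neq0|exact: cont_id].
have h1 := wz _ _ cw1 (mulr1 w1) w10 hw1.
have h2 := wz _ _ cw2 (divr1 w2) w20 hw2.
have h3 : \forall t \near (1 : C)^', nonroot N (w1 / w2 * t ^+ 2).
  by apply: near1_nonroot => [P|]; [exact: near1_expr | nz].
have h4 : \forall t \near (1 : C)^', nonroot N (w2 / w1 * t ^- 2).
  by apply: near1_nonroot => [P|]; [exact: near1_exprV | nz].
have h5 : \forall t \near (1 : C)^', forall j : 'I_n, nonroot N (a l * z j * t ^+ 2).
  apply: filter_forall => j.
  by apply: near1_nonroot => [P|]; [exact: near1_expr | rewrite mulf_neq0].
have h6 : \forall t \near (1 : C)^', nonroot N (w1 / a l * t ^- 1).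
  by apply: near1_nonroot => [P|]; [exact: near1_exprV | nz].
have h7 : \forall t \near (1 : C)^', nonroot N (w2 / a l * t ^- 3).
  by apply: near1_nonroot => [P|]; [exact: near1_exprV | nz].
have h0 : \forall t \near (1 : C)^', t != 0.
  by apply: (near1_neq0 (f := id)); [exact: cont_id | exact: oner_neq0].
near=> t.
have t0 : t != 0 by near: t.
have pl : perturb t a l = a l * t ^+ 2 by rewrite /perturb eqxx.
have I2 (i : 'I_2) : i = ord0 \/ i = lift ord0 ord0.
  by case: i => -[|[|//]] h; [left|right]; apply: val_inj.
have t2 : t ^+ 2 != 0 by nz.
split.
- exact: hz.
- exact: hq.
- move=> i j c cN; have [->|->] := I2 i; rewrite ?wpair0 ?wpair1.
    have : forall (j : 'I_n) (c : 'I_N), th (w1 * t * z j * q ^+ c) != 0 by near: t.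
    by move=> /(_ j (Ordinal cN)).
  have : forall (j : 'I_n) (c : 'I_N), th (w2 / t * z j * q ^+ c) != 0 by near: t.
  by move=> /(_ j (Ordinal cN)).
- move=> i j; have [->|->] := I2 i; have [->|->] := I2 j; rewrite ?eqxx // => _.
    rewrite wpair0 wpair1; have -> : w1 * t / (w2 / t) = w1 / w2 * t ^+ 2 by field; rewrite w20 t0.
    by near: t.
  rewrite wpair0 wpair1; have -> : w2 / t / (w1 * t) = w2 / w1 * t ^- 2 by field; rewrite w10 t0.
  by near: t.
- move=> j; rewrite pl mulrAC.
  have : forall j : 'I_n, nonroot N (a l * z j * t ^+ 2) by near: t.
  exact.
- move=> i; rewrite pl; have [->|->] := I2 i; rewrite ?wpair0 ?wpair1.
    have -> : w1 * t / (a l * t ^+ 2) = w1 / a l * t ^- 1 by field; rewrite al t0.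
    by near: t.
  have -> : w2 / t / (a l * t ^+ 2) = w2 / a l * t ^- 3 by field; rewrite al t0.
  by near: t.
Unshelve. all: by end_near.
Qed.

Theorem transformation n N m (z : 'I_n -> C) (w1 w2 : C) (a : 'I_(n + 2) -> C) :
  (0 < n)%N -> (forall k, z k != 0) -> w1 != 0 -> w2 != 0 -> (forall j, a j != 0) ->
  w1 * w2 = (\prod_(k < n) z k) * \prod_(j < n + 2) a j ->
  nonzero_denominators p q w1 w2 N z ->
  nonzero_denominators p q w1 w2 N (new_x q w1 w2 N m a z) ->
  composition_sum p q w1 w2 N a z = prefactor N m w1 w2 a z *
    composition_sum p q w1 w2 N (new_b q w1 w2 N m a z) (new_x q w1 w2 N m a z).
Proof.
case: n z a => // n z a _ z0 w10 w20 a0 bal den_z den_x.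
set x := new_x q w1 w2 N m a z in den_x *.
set b := new_b q w1 w2 N m a z.
have x0 k : x k != 0 by apply: new_x_neq0.
have b0 k : b k != 0 by apply: new_b_neq0.
pose F t := composition_sum p q (w1 * t) (w2 / t) N (perturb t a) z -
  prefactor N m (w1 * t) (w2 / t) a z *
  composition_sum p q (w1 * t) (w2 / t) N (perturb t b) x.
suff : F 1 = 0 by rewrite /F !mulr1 !divr1 !perturb1 => /eqP; rewrite subr_eq0 => /eqP.
have cw1 : {for (1 : C), continuous (fun t : C => w1 * t)}.
  by apply: cont_mul; [exact: cont_cst|exact: cont_id].
have cw2 : {for (1 : C), continuous (fun t : C => w2 / t)}.
  apply: cont_mul; first exact: cont_cst.
  by apply: cont_inv; [exact: oner_neq0|exact: cont_id].
apply: near1_eq0.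
  have e1 : w1 * 1 = w1 by rewrite mulr1.
  have e2 : w2 / 1 = w2 by rewrite divr1.
  apply: cont_sub.
    apply: cont_composition_sum; rewrite ?e1 ?e2 ?perturb1 //.
    by move=> j; apply: cont_perturb.
  apply: cont_mul; last first.
    apply: cont_composition_sum; rewrite ?e1 ?e2 ?perturb1 //.
    by move=> j; apply: cont_perturb.
  have [_ _ hw1 hw2] := nonzero_denominatorsP z0 (ltn0Sn n) den_z.
  apply: continuous_prod => j _.
  apply: cont_mul.
    apply: cont_mul.
      apply: cont_mul; first exact: cont_cst.
      apply: cont_epoch; first by rewrite e1; have := a0 (lshift 2 j); nz.
      by apply: cont_mul => //; exact: cont_cst.
    apply: cont_epoch; first by rewrite e2; have := a0 (lshift 2 j); nz.
    by apply: cont_mul => //; exact: cont_cst.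
  apply: cont_inv.
    rewrite e1 e2 mulf_neq0 //; apply/epoch_neq0P => c cN; [exact: hw1|exact: hw2].
  apply: cont_mul; (apply: cont_epoch; [by rewrite ?e1 ?e2 mulf_neq0|]);
    by apply: cont_mul => //; exact: cont_cst.
have gz := near1_kn_generic (ltn0Sn n) z0 w10 w20 a0 den_z.
have gx := near1_kn_generic (ltn0Sn n) x0 w10 w20 b0 den_x.
have h0 : \forall t \near (1 : C)^', t != 0.
  by apply: (near1_neq0 (f := id)); [exact: cont_id | exact: oner_neq0].
near=> t.
have t0 : t != 0 by near: t.
(* The perturbation fixes w_1 w_2 and the first entries of a, hence also x, and it commutes with the
   passage from a to b. *)
have ww : w1 * t * (w2 / t) = w1 * w2 by field.
have xE : new_x q (w1 * t) (w2 / t) N m (perturb t a) z = x.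
  by apply/funext => k; rewrite /x /new_x perturb_l ww.
have bE : new_b q (w1 * t) (w2 / t) N m (perturb t a) z = perturb t b.
  apply/funext => k; case: (split_ordP k) => j ->.
    rewrite perturb_l /b !new_bl perturb_l; case: ifP => // _.
    by move: (q ^ _) => u; field.
  by rewrite new_br /perturb /b new_br.
have prefE : prefactor N m (w1 * t) (w2 / t) (perturb t a) z =
    prefactor N m (w1 * t) (w2 / t) a z.
  by apply: eq_bigr => j _; rewrite perturb_l.
apply/eqP; rewrite subr_eq0 -prefE; apply/eqP.
rewrite (@transformation_generic n N m _ _ _ _ (rshift n.+1 ord0)) ?xE ?bE //.
- by rewrite mulf_neq0.
- by rewrite mulf_neq0 ?invr_neq0.
- by move=> k; apply: perturb_neq0.
- by rewrite ww prod_perturb.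
- by near: t.
- by near: t.
Unshelve. all: by end_near.
Qed.

End KajiharaNoumi.

(** * Convergence of the theta product *)

(* R[i] carries no instance of a complete normed structure, so what is needed of it is
   stated by these two properties. *)
Definition geometric_decay (C : numFieldType) : Prop :=
  forall r e : C, 0 <= r -> r < 1 -> 0 < e -> exists J, forall M, (J <= M)%N -> r ^+ M <= e.

Definition cauchy_complete (C : numFieldType) : Prop :=
  forall u : nat -> C,
    (forall e : C, 0 < e -> exists J, forall M, (J <= M)%N -> `|u M - u J| <= e) ->
    exists l : C, u @ \oo --> l.

Section Products.
Variable C : numFieldType.

(** Induction on [s]. The constant 2 absorbs the cross term [|u i| * |P - 1|], which is at most
    [|u i|] because the bound 1/2 on the sum forces |P - 1| <= 1. *)
Lemma norm_prod_1B_sub1 (I : Type) (s : seq I) (u : I -> C) :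
  \sum_(i <- s) `|u i| <= 2^-1 ->
  `|\prod_(i <- s) (1 - u i) - 1| <= 2 * \sum_(i <- s) `|u i|.
Proof.
elim: s => [|i s IH]; first by rewrite !big_nil subrr normr0 mulr0.
rewrite !big_cons; set S := \sum_(_ <- _) _; set P := \prod_(_ <- _) _ => h.
have S0 : 0 <= S by apply: sumr_ge0.
have hS : S <= 2^-1 by apply: le_trans h; rewrite lerDr.
have -> : (1 - u i) * P - 1 = (P - 1) - u i * (P - 1) - u i by ring.
have hP := IH hS.
apply: (le_trans (ler_normB _ _)); apply: (le_trans (lerD (ler_normB _ _) (lexx _))).
rewrite normrM.
have hP1 : `|P - 1| <= 1.
  by apply: le_trans hP _; rewrite -[leRHS](@divff _ (2 : C)) ?ler_wpM2l.
rewrite mulrDr [2 * `|u i|]mulr_natl mulr2n -addrA addrC lerD // -[leRHS]addr0.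
by rewrite [leRHS]addr0 lerD // ler_piMr.
Qed.

Lemma geometric_sum_le (r : C) J M : 0 <= r -> r < 1 ->
  \sum_(J <= j < M) r ^+ j <= r ^+ J / (1 - r).
Proof.
move=> r0 r1; have r1' : 0 < 1 - r by rewrite subr_gt0.
rewrite ler_pdivlMr //.
have [MJ|JM] := leqP M J; first by rewrite big_geq // mul0r exprn_ge0.
have -> : (\sum_(J <= j < M) r ^+ j) * (1 - r) = r ^+ J - r ^+ M.
  rewrite mulr_suml -[RHS]opprB -(telescope_sumr (fun j => r ^+ j) (ltnW JM)) -sumrN.
  by apply: eq_bigr => j _; rewrite exprS; ring.
by rewrite gerBl exprn_ge0.
Qed.

Section Tail.
Variables (v : nat -> C) (K r : C).
Hypotheses (r0 : 0 <= r) (r1 : r < 1) (vK : forall j, `|v j| <= K * r ^+ j).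
Let P M := \prod_(j < M) (1 - v j).

(** The estimate is relative to [P J]. It therefore gives convergence and, in the limit, also the
    nonvanishing of an infinite product whose partial product [P J] is nonzero. *)
Lemma prod_tail J M : (J <= M)%N -> K * (r ^+ J / (1 - r)) <= 2^-1 ->
  `|P M - P J| <= `|P J| * (2 * (K * (r ^+ J / (1 - r)))).
Proof.
move=> JM hJ; have K0 : 0 <= K by have := vK 0; rewrite expr0 mulr1; apply: le_trans.
have hs : \sum_(J <= j < M) `|v j| <= K * (r ^+ J / (1 - r)).
  apply: (le_trans (ler_sum _ (fun j _ => vK j))).
  by rewrite -mulr_sumr ler_wpM2l // geometric_sum_le.
have -> : P M = P J * \prod_(J <= j < M) (1 - v j).
  by rewrite /P -!(big_mkord xpredT (fun j => 1 - v j)) -big_cat_nat.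
rewrite -[X in _ - X]mulr1 -mulrBr normrM ler_wpM2l //.
by apply: (le_trans (norm_prod_1B_sub1 (le_trans hs hJ))); rewrite ler_wpM2l.
Qed.

Hypotheses (geo : geometric_decay C) (complete : cauchy_complete C).

Lemma tail_small e : 0 < e -> exists J, forall M, (J <= M)%N -> K * (r ^+ M / (1 - r)) <= e.
Proof.
move=> e0; have K0 : 0 <= K by have := vK 0; rewrite expr0 mulr1; apply: le_trans.
have r1' : 0 < 1 - r by rewrite subr_gt0.
have [|J hJ] := geo r0 r1 (e := e * (1 - r) / (K + 1)).
  by rewrite divr_gt0 ?mulr_gt0 // ltr_wpDl.
exists J => M /hJ; rewrite ler_pdivlMr ?ltr_wpDl // => h.
rewrite mulrA ler_pdivrMr //; apply: le_trans h.
by rewrite mulrC ler_wpM2l ?exprn_ge0 // lerDl.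
Qed.

Lemma prod_cvg : exists l : C, P @ \oo --> l.
Proof.
have h2 : (0 : C) < 2^-1 by rewrite invr_gt0.
have [J0 hJ0] := tail_small h2.
have bound M : (J0 <= M)%N -> `|P M| <= `|P J0| * 2.
  move=> hM; have := prod_tail hM (hJ0 _ (leqnn _)).
  move=> h; rewrite -[P M](subrK (P J0)); apply: (le_trans (ler_normD _ _)).
  rewrite mulr_natr mulr2n lerD //; apply: le_trans h _.
  by rewrite ler_piMr // -[leRHS](@divff _ (2 : C)) ?ler_wpM2l // hJ0.
apply: complete => e e0.
(* One factor 2 bounds the later partial products by 2 |P J0|, the other comes from [prod_tail]; the
   summand 1 keeps the denominator positive. *)
have [|J1 hJ1] := tail_small (e := e / (`|P J0| * 2 * 2 + 1)).
  by rewrite divr_gt0 // ltr_wpDl // !mulr_ge0.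
exists (maxn J0 J1) => M hM.
have hJ0' := leq_maxl J0 J1; have hJ1' := leq_maxr J0 J1.
apply: (le_trans (prod_tail hM (hJ0 _ hJ0'))).
have := hJ1 _ hJ1'; rewrite ler_pdivlMr; last by rewrite ltr_wpDl // !mulr_ge0.
set d := K * _ => h; have d0 : 0 <= d.
  have := vK 0; rewrite expr0 mulr1 => hK; rewrite /d mulr_ge0 ?(le_trans _ hK) //.
  by rewrite divr_ge0 ?exprn_ge0 // subr_ge0 ltW.
apply: le_trans h; rewrite mulrDr mulr1.
apply: (@le_trans _ _ (d * (`|P J0| * 2 * 2))); last by rewrite lerDl.
have -> : d * (`|P J0| * 2 * 2) = (`|P J0| * 2) * (2 * d) by ring.
by apply: ler_wpM2r; [rewrite mulr_ge0 | exact: bound].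
Qed.

Lemma prod_lim_tail l J : P @ \oo --> l -> K * (r ^+ J / (1 - r)) <= 2^-1 ->
  `|l - P J| <= `|P J| * (2 * (K * (r ^+ J / (1 - r)))).
Proof.
move=> Pl hJ; apply/ler_addgt0Pl => e e0.
have [J1 _ hJ1] := (cvgrPdist_le _ _).1 Pl e e0.
have h1 := hJ1 (maxn J J1) (leq_maxr _ _); have h2 := prod_tail (leq_maxl J J1) hJ.
have -> : l - P J = (l - P (maxn J J1)) + (P (maxn J J1) - P J) by ring.
by apply: (le_trans (ler_normD _ _)); exact: lerD.
Qed.

End Tail.
End Products.

(** * Convergence, continuity and zeros of theta *)

Section ThetaLimit.
Variables (C : numFieldType) (p : C).
Hypotheses (geo : geometric_decay C) (complete : cauchy_complete C) (p1 : `|p| < 1).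

Definition ptheta (x : C) (M : nat) : C :=
  \prod_(j < M) ((1 - p ^+ j * x) * (1 - p ^+ j.+1 / x)).

Let v (x : C) j := p ^+ j * x + p ^+ j.+1 / x - p ^+ j * p ^+ j.+1.

Lemma pthetaE x M : x != 0 -> ptheta x M = \prod_(j < M) (1 - v x j).
Proof. by move=> x0; apply: eq_bigr => j _; rewrite /v; field. Qed.

Lemma factor_bound rho x j : x != 0 -> 1 <= rho -> `|x| <= rho -> `|x^-1| <= rho ->
  `|v x j| <= 3 * rho * `|p| ^+ j.
Proof.
move=> x0 rho1 xr xr'; have pj : 0 <= `|p| ^+ j by rewrite exprn_ge0.
have pS : `|p| ^+ j.+1 <= `|p| ^+ j by rewrite exprS ler_piMl // ltW.
have -> : 3 * rho * `|p| ^+ j = `|p| ^+ j * rho + `|p| ^+ j * rho + `|p| ^+ j * rho by ring.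
apply: (le_trans (ler_normB _ _)); apply: lerD.
  apply: (le_trans (ler_normD _ _)); rewrite !normrM !normrX; apply: lerD.
    by rewrite ler_wpM2l.
  by apply: ler_pM => //; rewrite exprn_ge0.
rewrite normrM !normrX ler_wpM2l // (le_trans pS) // (le_trans _ rho1) //.
by rewrite exprn_ile1 // ltW.
Qed.

(** A common bound for y and 1/y on a disc around x makes the tail estimate for theta uniform there.
    On the disc |y| <= 3|x|/2 and |1/y| <= 2/|x|; the witness dominates both bounds and 1. *)
Lemma annulus (x : C) : x != 0 -> exists2 rho, 1 <= rho &
  forall y : C, `|x - y| <= `|x| / 2 -> [/\ y != 0, `|y| <= rho & `|y^-1| <= rho].
Proof.
move=> x0; have nx : 0 < `|x| by rewrite normr_gt0.
have i0 : 0 <= `|x|^-1 * 2 by rewrite mulr_ge0 // invr_ge0.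
exists (1 + `|x| * 2 + `|x|^-1 * 2); first by rewrite -addrA lerDl addr_ge0 // mulr_ge0.
move=> y xy.
have h : `|x| / 2 <= `|y|.
  have : `|x| <= `|x - y| + `|y| by rewrite -{1}(subrK y x) ler_normD.
  move=> h; have := le_trans h (lerD xy (lexx _)).
  by rewrite {1}[`|x|]splitr lerD2l.
have ny : 0 < `|y| by apply: lt_le_trans h; rewrite divr_gt0.
split; first by rewrite -normr_gt0.
  have : `|y| <= `|x| + `|x - y|.
    by rewrite distrC -{1}(subrK x y) addrC ler_normD.
  move=> /le_trans; apply; rewrite addrAC.
  apply: ler_wpDl; first by rewrite addr_ge0.
  rewrite mulr_natr mulr2n lerD2l; apply: le_trans xy _.
  by rewrite ler_pdivrMr // ler_peMr // ler1n.
rewrite normfV; apply: ler_wpDl; first by rewrite addr_ge0 // mulr_ge0.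
by rewrite -[leRHS]invrK lef_pV2 ?posrE ?invr_gt0 ?mulr_gt0 ?invr_gt0 // invfM invrK.
Qed.

Lemma theta_cvg x : x != 0 -> ptheta x @ \oo --> theta p x.
Proof.
move=> x0; have [rho rho1 /(_ x)] := annulus x0.
rewrite subrr normr0 => /(_ (divr_ge0 (normr_ge0 _) (ler0n _ 2))) [_ xr xr'].
have [l hl] := prod_cvg (normr_ge0 p) p1 (fun j => factor_bound j x0 rho1 xr xr') geo complete.
have hl' : ptheta x @ \oo --> l.
  by rewrite (_ : ptheta x = fun M => \prod_(j < M) (1 - v x j)) //; apply/funext => M; rewrite pthetaE.
rewrite (_ : theta p x = l) //; apply: (cvg_lim _ hl'); exact: norm_hausdorff.
Qed.

Lemma theta_tail x rho J : x != 0 -> 1 <= rho -> `|x| <= rho -> `|x^-1| <= rho ->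
  (3 * rho) * (`|p| ^+ J / (1 - `|p|)) <= 2^-1 ->
  `|theta p x - ptheta x J| <= `|ptheta x J| * (2 * (3 * rho * (`|p| ^+ J / (1 - `|p|)))).
Proof.
move=> x0 rho1 xr xr' hJ; rewrite pthetaE //.
apply: (prod_lim_tail (normr_ge0 p) p1 (fun j => factor_bound j x0 rho1 xr xr') _ hJ).
have := theta_cvg x0.
by rewrite (_ : ptheta x = fun M => \prod_(j < M) (1 - v x j)) //; apply/funext => M; rewrite pthetaE.
Qed.

Lemma cont_ptheta (x : C) M : x != 0 -> {for x, continuous (fun y => ptheta y M)}.
Proof.
move=> x0; apply: continuous_prod => j _; apply: cont_mul; apply: cont_sub;
  try exact: cont_cst; apply: cont_mul; try exact: cont_cst; first exact: cont_id.
by apply: cont_inv => //; exact: cont_id.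
Qed.

Lemma rho_small rho e : 1 <= rho -> 0 < e ->
  exists J, 3 * rho * (`|p| ^+ J / (1 - `|p|)) <= e.
Proof.
move=> rho1 e0.
have h j : `|3 * rho * `|p| ^+ j| <= 3 * rho * `|p| ^+ j.
  by rewrite ger0_norm // !mulr_ge0 ?exprn_ge0 // (le_trans _ rho1).
have [J hJ] := tail_small (normr_ge0 p) p1 h geo e0.
by exists J; apply: hJ.
Qed.

Lemma near_annulus (x : C) : x != 0 -> \forall y \near x, `|x - y| <= `|x| / 2.
Proof.
move=> x0; have e0 : 0 < `|x| / 2 by rewrite divr_gt0 // normr_gt0.
have h : (fun t : C => t) t @[t --> x] --> x by exact: cont_id.
by move/cvgrPdist_le: h => h; exact: h _ e0.
Qed.

Lemma theta_cont (x : C) : x != 0 -> {for x, continuous (theta p)}.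
Proof.
move=> x0; have [rho rho1 hrho] := annulus x0.
apply: (cvgrPdist_le (F := nbhs x) _ _).2 => e e0.
have [xx xr xr'] : [/\ x != 0, `|x| <= rho & `|x^-1| <= rho].
  by apply: hrho; rewrite subrr normr0 divr_ge0.
(* For d <= 1/4 the tail is at most half of |ptheta x J|, so [B] bounds |ptheta x J| for the index J
   still to be chosen. *)
pose B := `|theta p x| * 2.
have B0 : 0 <= B by rewrite mulr_ge0.
have B1 : 0 < B + 1 by rewrite ltr_wpDl.
(* The two summands serve two purposes: with d <= e / (4e + 16(B + 1)) one has both d <= 1/4 and 4 d
   (B + 1) <= e/4. *)
have D0 : 0 < 4 * e + 16 * (B + 1) by rewrite addr_gt0 // mulr_gt0.
have [J] := rho_small rho1 (divr_gt0 e0 D0).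
set d := 3 * rho * _ => hd.
have d0 : 0 <= d.
  rewrite /d !mulr_ge0 ?exprn_ge0 ?(le_trans _ rho1) //.
  by rewrite invr_ge0 subr_ge0 ltW.
have d4 : d <= 4^-1.
  apply: (le_trans hd); rewrite ler_pdivrMr // mulrDr mulKf ?pnatr_eq0 // lerDl.
  by rewrite !mulr_ge0 // ?invr_ge0 // ltW.
have dB : 4 * d * (B + 1) <= e / 4.
  move: hd; rewrite ler_pdivlMr // => hd.
  rewrite ler_pdivlMr //; apply: le_trans hd.
  have -> : d * (4 * e + 16 * (B + 1)) = 4 * d * e + 4 * d * (B + 1) * 4 by ring.
  by rewrite lerDr; apply: mulr_ge0; [exact: mulr_ge0 | exact: ltW].
have dh : d <= 2^-1 by apply: (le_trans d4); rewrite lef_pV2 ?posrE // ler_nat.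
have hx := theta_tail xx rho1 xr xr' dh.
have PB : `|ptheta x J| <= B.
  rewrite /B -ler_pdivrMr //.
  have : `|ptheta x J| <= `|theta p x| + `|theta p x - ptheta x J|.
    by rewrite distrC -{1}(subrK (theta p x) (ptheta x J)) addrC ler_normD.
  move=> /le_trans /(_ (lerD (lexx _) hx)); rewrite -/d => h.
  rewrite -(lerD2r (`|ptheta x J| / 2)) -splitr; apply: (le_trans h).
  rewrite lerD2l ler_wpM2l // -[leRHS](_ : 2 * 4^-1 = _); last by field.
  by rewrite ler_wpM2l.
(* This tolerance is at most 1 and at most e/4 at once. *)
have E0 : 0 < e / (e + 4) by rewrite divr_gt0 // addr_gt0.
have E1 : e / (e + 4) <= 1 by rewrite ler_pdivrMr ?addr_gt0 // mul1r lerDl.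
have E4 : e / (e + 4) <= e / 4.
  apply: ler_wpM2l; first exact: ltW.
  by rewrite lef_pV2 ?posrE ?addr_gt0 // lerDr ltW.
have cJ : (fun t => ptheta t J) t @[t --> x] --> ptheta x J by exact: cont_ptheta.
have n2 : \forall y \near x, `|ptheta x J - ptheta y J| <= e / (e + 4).
  by move/cvgrPdist_le: cJ => cJ; exact: cJ _ E0.
move: (near_annulus x0) n2.
apply: filterS2 => y hy1 hy2; have [y0 yr yr'] := hrho _ hy1.
have hy := theta_tail y0 rho1 yr yr' dh.
have -> : theta p x - theta p y = (theta p x - ptheta x J) + (ptheta x J - ptheta y J) - (theta p y - ptheta y J) by ring.
apply: (le_trans (ler_normB _ _)).
apply: (le_trans (lerD (ler_normD _ _) hy)).
apply: (le_trans (lerD (lerD hx hy2) (lexx _))); rewrite -/d.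
have PY : `|ptheta y J| <= B + 1.
  have : `|ptheta y J| <= `|ptheta x J| + `|ptheta x J - ptheta y J|.
    by rewrite distrC -{1}(subrK (ptheta x J) (ptheta y J)) addrC ler_normD.
  move=> /le_trans; apply; apply: lerD => //; exact: le_trans hy2 E1.
have d20 : 0 <= 2 * d by rewrite mulr_ge0.
apply: (@le_trans _ _ ((B + 1) * (2 * d) + e / 4 + (B + 1) * (2 * d))).
  apply: lerD; last exact: ler_wpM2r.
  apply: lerD => //; apply: ler_wpM2r => //; apply: le_trans PB _; by rewrite lerDl.
have -> : (B + 1) * (2 * d) + e / 4 + (B + 1) * (2 * d) = 4 * d * (B + 1) + e / 4 by ring.
apply: (le_trans (lerD dB (lexx _))).
rewrite -mulrDr -[leRHS]mulr1 ler_wpM2l ?ltW //.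
have -> : 4^-1 + 4^-1 = 2^-1 :> C by field.
by rewrite invf_lt1 // ltr1n.
Qed.

(** For a J that works on a whole disc around c, the tail is at most half of the partial product, so
    theta vanishes only where one of finitely many factors does. Each factor 1 - a t or 1 - a/t has
    at most one zero, hence none near 1 except possibly 1 itself. *)
Lemma theta_near1_nonzero (c : C) : c != 0 -> \forall t \near (1 : C)^', theta p (c * t) != 0.
Proof.
move=> c0; have [rho rho1 hrho] := annulus c0.
have h4 : (0 : C) < 4^-1 by rewrite invr_gt0.
have [J] := rho_small rho1 h4; set d := 3 * rho * _ => d4.
have dh : d <= 2^-1 by apply: (le_trans d4); rewrite lef_pV2 ?posrE // ler_nat.
have cc : {for (1 : C), continuous (fun t : C => c * t)}.
  by apply: cont_mul; [exact: cont_cst|exact: cont_id].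
have h1 : \forall t \near (1 : C)^', `|c - c * t| <= `|c| / 2.
  apply: (@nbhs_dnbhs _ (1:C)).
  have := near_annulus c0; rewrite -{1}[c]mulr1 => /cc; exact.
have hneq (a : C) : a != 0 -> \forall t \near (1 : C)^', 1 - a * t != 0.
  move=> a0; have [->|a1] := eqVneq a 1.
    by apply: filterS (@nbhs_dnbhs_neq _ (1:C)) => t t1; rewrite mul1r subr_eq0 eq_sym.
  apply: (near1_neq0 (f := fun t => 1 - a * t)); last by rewrite mulr1 subr_eq0 eq_sym.
  by apply: cont_sub; [exact: cont_cst|apply: cont_mul; [exact: cont_cst|exact: cont_id]].
have h0 : \forall t \near (1 : C)^', t != 0.
  by apply: (near1_neq0 (f := id)); [exact: cont_id | exact: oner_neq0].
have fact1 (a : C) : \forall t \near (1 : C)^', 1 - a * t != 0.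
  have [->|a0] := eqVneq a 0; last exact: hneq.
  by apply: filterS h0 => t _; rewrite mul0r subr0 oner_neq0.
have fact2 (a : C) : \forall t \near (1 : C)^', 1 - a / t != 0.
  have [->|a0] := eqVneq a 0.
    by apply: filterS h0 => t _; rewrite mul0r subr0 oner_neq0.
  move: h0 (fact1 a^-1); apply: filterS2 => t t0; apply: contra; rewrite !subr_eq0 => /eqP e.
  have -> : t = a by rewrite -[RHS](divfK t0) -e mul1r.
  by rewrite mulVf.
have h2 : \forall t \near (1 : C)^', forall j : 'I_J,
    (1 - p ^+ j * (c * t)) * (1 - p ^+ j.+1 / (c * t)) != 0.
  apply: filter_forall => j.
  move: (fact1 (p ^+ j * c)) (fact2 (p ^+ j.+1 / c)); apply: filterS2 => t.
  by move=> k3 k4; apply: mulf_neq0; rewrite ?invfM mulrA.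
move: h1 h2; apply: filterS2 => t /hrho[ct0 tr tr'] ht.
have := theta_tail ct0 rho1 tr tr' dh; rewrite -/d.
have P0 : ptheta (c * t) J != 0 by apply/prodf_neq0 => j _.
move=> h; apply/negP => /eqP tz; move: h; rewrite tz sub0r normrN.
rewrite -[leLHS]mulr1 ler_pM2l ?normr_gt0 // => h.
suff : (1 : C) < 1 by rewrite ltxx.
apply: (le_lt_trans h); apply: (@le_lt_trans _ _ (2 * 4^-1)); first by rewrite ler_wpM2l.
by rewrite ltr_pdivrMr // mul1r ltr_nat.
Qed.

Lemma expr_cvg0 : (fun M => p ^+ M) @ \oo --> (0 : C).
Proof.
apply/cvgrPdist_le => e e0; have [J hJ] := geo (normr_ge0 p) p1 e0.
by exists J => // M /= JM; rewrite sub0r normrN normrX; exact: hJ.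
Qed.

Lemma theta_inv (x : C) : x != 0 -> theta p x^-1 = - theta p x / x.
Proof.
move=> x0; have xV0 : x^-1 != 0 by rewrite invr_neq0.
(* The factor 1 - p^M y tends to 1 and completes the partial product to 1 - y times an expression
   invariant under y -> 1/y. *)
have sym y M : y != 0 -> ptheta y M * (1 - p ^+ M * y) =
    (1 - y) * \prod_(j < M) ((1 - p ^+ j.+1 * y) * (1 - p ^+ j.+1 / y)).
  move=> y0; rewrite /ptheta !big_split /= mulrAC mulrA; congr (_ * _).
  have <- : \prod_(j < M.+1) (1 - p ^+ j * y) = (1 - y) * \prod_(j < M) (1 - p ^+ j.+1 * y).
    by rewrite big_ord_recl expr0 mul1r.
  by rewrite big_ord_recr.
have cp y : y != 0 -> ptheta y M * (1 - p ^+ M * y) @[M --> \oo] --> theta p y.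
  move=> y0; rewrite -[X in _ --> X]mulr1; apply: cvgM; first exact: theta_cvg.
  rewrite -[X in _ --> X]subr0 -[X in _ - X](mul0r y); apply: cvgB; first exact: cvg_cst.
  by apply: cvgM; [exact: expr_cvg0 | exact: cvg_cst].
have zE M : x * (ptheta x^-1 M * (1 - p ^+ M / x)) + ptheta x M * (1 - p ^+ M * x) = 0.
  rewrite !sym // invrK.
  rewrite [in X in _ + X](eq_bigr (fun j : 'I_M => (1 - p ^+ j.+1 / x) * (1 - p ^+ j.+1 * x))).
    by field.
  by move=> j _; rewrite mulrC.
have h0 : (fun _ : nat => 0 : C) @ \oo --> x * theta p x^-1 + theta p x.
  rewrite (_ : (fun=> 0) = fun M => x * (ptheta x^-1 M * (1 - p ^+ M / x)) +
    ptheta x M * (1 - p ^+ M * x)); last by apply/funext => M; rewrite zE.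
  apply: cvgD; last exact: cp.
  by apply: cvgM; [exact: cvg_cst | exact: cp].
have h1 : (fun _ : nat => 0 : C) @ \oo --> (0 : C) by exact: cvg_cst.
have e := cvg_unique (@norm_hausdorff _ _) h0 h1.
have -> : theta p x = - (x * theta p x^-1) by apply/eqP; rewrite -addr_eq0 addrC e.
by rewrite opprK; field.
Qed.

End ThetaLimit.

(** * Unconditional sums *)

Section UnconditionalSums.
Variable C : numFieldType.

(** Convergence along the finite subsets of the index set, represented by duplicate-free sequences.
    No enumeration is chosen, so any bijection of index sets may be applied. *)
Definition has_sum (I : eqType) (f : I -> C) (l : C) : Prop :=
  forall e : C, 0 < e -> exists s0 : seq I, forall s, uniq s -> {subset s0 <= s} ->
    `|\sum_(i <- s) f i - l| <= e.

(** The Cauchy form of absolute summability, which needs no value for the sum of the norms. *)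
Definition abs_summable (I : eqType) (f : I -> C) : Prop :=
  forall e : C, 0 < e -> exists s0 : seq I, forall s, uniq s -> {in s, forall i, i \notin s0} ->
    \sum_(i <- s) `|f i| <= e.

Lemma has_sum_unique (I : eqType) (f : I -> C) l l' : has_sum f l -> has_sum f l' -> l = l'.
Proof.
move=> hl hl'; apply/eqP; rewrite -subr_eq0 -normr_le0; apply/ler_addgt0Pl => e e0.
have e2 : 0 < e / 2 by rewrite divr_gt0.
have [s0 h0] := hl _ e2; have [s1 h1] := hl' _ e2.
pose s := undup (s0 ++ s1).
have us : uniq s := undup_uniq _.
have k0 := h0 s us; have k1 := h1 s us.
have -> : l - l' = (\sum_(i <- s) f i - l') - (\sum_(i <- s) f i - l) by ring.
rewrite addr0 [leRHS]splitr; apply: (le_trans (ler_normB _ _)); apply: lerD.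
  by apply: k1 => i si; rewrite mem_undup mem_cat si orbT.
by apply: k0 => i si; rewrite mem_undup mem_cat si.
Qed.

Lemma has_sum_scale (I : eqType) (f : I -> C) c l : has_sum f l -> has_sum (fun i => c * f i) (c * l).
Proof.
move=> hl e e0; have c1 : 0 < `|c| + 1 by rewrite ltr_wpDl.
have [s0 h] := hl _ (divr_gt0 e0 c1).
exists s0 => s us ss; rewrite -mulr_sumr -mulrBr normrM.
have := h s us ss; rewrite ler_pdivlMr // => h'; apply: le_trans h'.
by rewrite mulrC ler_wpM2l // lerDl.
Qed.

Lemma has_sum_bij (I J : eqType) (g : J -> I) (g' : I -> J) (f : I -> C) l :
  cancel g g' -> cancel g' g -> has_sum f l -> has_sum (f \o g) l.
Proof.
move=> gK g'K hl e e0; have [s0 h] := hl _ e0.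
exists (map g' s0) => s us ss.
have := h (map g s); rewrite big_map; apply.
  by rewrite map_inj_uniq //; exact: can_inj gK.
by move=> i si; rewrite -(g'K i) map_f // ss // map_f.
Qed.

Lemma abs_summable_bij (I J : eqType) (g : J -> I) (g' : I -> J) (f : I -> C) :
  cancel g g' -> cancel g' g -> abs_summable f -> abs_summable (f \o g).
Proof.
move=> gK g'K hf e e0; have [s0 h] := hf _ e0.
exists (map g' s0) => s us ss.
have := h (map g s); rewrite big_map; apply.
  by rewrite map_inj_uniq //; exact: can_inj gK.
move=> _ /mapP[j js ->]; apply/negP => gj.
by have := ss j js; rewrite -(gK j) map_f.
Qed.

Lemma sum_ofsum (I J : eqType) (f : I + J -> C) (s : seq (I + J)) : uniq s ->
  exists s1 s2, [/\ uniq s1, uniq s2,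
   (forall i, (i \in s1) = (inl i \in s)), (forall j, (j \in s2) = (inr j \in s)) &
   \sum_(x <- s) f x = \sum_(i <- s1) f (inl i) + \sum_(j <- s2) f (inr j)].
Proof.
elim: s => [|[i|j] s IH] /=; first by exists [::], [::]; rewrite !big_nil addr0.
- move=> /andP[iN /IH [s1 [s2 [u1 u2 h1 h2 e]]]]; exists (i :: s1), s2.
  split=> //=; first by rewrite h1 iN.
  + by move=> k; rewrite !inE h1.
  + by rewrite !big_cons e addrA.
- move=> /andP[jN /IH [s1 [s2 [u1 u2 h1 h2 e]]]]; exists s1, (j :: s2).
  split=> //=; first by rewrite h2 jN.
  + by move=> k; rewrite !inE h2.
  + by rewrite !big_cons e addrCA.
Qed.

Lemma has_sum_ofsum (I J : eqType) (f : I + J -> C) a b :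
  has_sum (f \o inl) a -> has_sum (f \o inr) b -> has_sum f (a + b).
Proof.
move=> ha hb e e0; have e2 : 0 < e / 2 by rewrite divr_gt0.
have [s1 h1] := ha _ e2; have [s2 h2] := hb _ e2.
exists (map inl s1 ++ map inr s2) => s us ss.
have [t1 [t2 [u1 u2 m1 m2 ->]]] := sum_ofsum f us.
have -> : \sum_(i <- t1) f (inl i) + \sum_(j <- t2) f (inr j) - (a + b) =
  (\sum_(i <- t1) f (inl i) - a) + (\sum_(j <- t2) f (inr j) - b) by ring.
rewrite [leRHS]splitr; apply: (le_trans (ler_normD _ _)); apply: lerD.
  by apply: h1 => // i is1; rewrite m1 ss // mem_cat map_f.
by apply: h2 => // i is1; rewrite m2 ss // mem_cat map_f ?orbT.
Qed.

Lemma abs_summable_ofsum (I J : eqType) (f : I + J -> C) :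
  abs_summable (f \o inl) -> abs_summable (f \o inr) -> abs_summable f.
Proof.
move=> ha hb e e0; have e2 : 0 < e / 2 by rewrite divr_gt0.
have [s1 h1] := ha _ e2; have [s2 h2] := hb _ e2.
exists (map inl s1 ++ map inr s2) => s us ss.
have [t1 [t2 [u1 u2 m1 m2 ->]]] := sum_ofsum (fun x => `|f x|) us.
rewrite [leRHS]splitr; apply: lerD.
  apply: h1 => // i; rewrite m1 => /ss; rewrite mem_cat negb_or => /andP[h _].
  by apply: contra h => h; apply: map_f.
apply: h2 => // i; rewrite m2 => /ss; rewrite mem_cat negb_or => /andP[_ h].
by apply: contra h => h; apply: map_f.
Qed.

Lemma sum_split (I : eqType) (f : I -> C) (s S : seq I) : uniq s -> uniq S -> {subset S <= s} ->
  \sum_(i <- s) f i = \sum_(i <- S) f i + \sum_(i <- [seq i <- s | i \notin S]) f i.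
Proof.
move=> us uS Ss; rewrite (bigID (mem S)) /=; congr (_ + _); last by rewrite big_filter.
rewrite -big_filter; apply: perm_big; apply: uniq_perm; rewrite ?filter_uniq // => i.
by rewrite mem_filter; case iS: (i \in S); rewrite //= Ss.
Qed.

(** Absolute summability controls whatever is added to a large finite set, so it is enough to come
    close to l on some finite sets that exhaust the index set. Below these are boxes and symmetric
    intervals. *)
Lemma has_sum_cluster (I : eqType) (f : I -> C) l : abs_summable f ->
  (forall (e : C) (S0 : seq I), 0 < e -> exists S : seq I, [/\ uniq S, {subset S0 <= S} &
     `|\sum_(i <- S) f i - l| <= e]) -> has_sum f l.
Proof.
move=> hf hc e e0; have e2 : 0 < e / 2 by rewrite divr_gt0.
have [s0 h0] := hf _ e2; have [S [uS s0S hS]] := hc _ s0 e2.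
exists S => s us ss; rewrite (sum_split f us uS ss) addrAC.
apply: (le_trans (ler_normD _ _)); rewrite [leRHS]splitr; apply: lerD => //.
apply: (le_trans (ler_norm_sum _ _ _)); apply: h0; first exact: filter_uniq.
by move=> i; rewrite mem_filter => /andP[iS _]; apply: contra iS => is0; exact: s0S.
Qed.

Lemma abs_summable_bounded (I : eqType) (f : I -> C) : abs_summable f ->
  exists2 B, 0 < B & forall s, uniq s -> \sum_(i <- s) `|f i| <= B.
Proof.
move=> hf; have [s0 h] := hf 1 ltr01.
exists (\sum_(i <- undup s0) `|f i| + 1); first by rewrite ltr_wpDl // sumr_ge0.
move=> s us; rewrite (bigID (mem s0)) /=; apply: lerD; rewrite -big_filter.
  rewrite [leRHS](@sum_split _ (fun i => `|f i|) (undup s0) [seq i <- s | i \in s0]) ?undup_uniq ?filter_uniq //.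
    by rewrite lerDl sumr_ge0.
  by move=> i; rewrite mem_filter mem_undup => /andP[].
apply: h; first exact: filter_uniq.
by move=> i; rewrite mem_filter => /andP[].
Qed.

(** Tannery's theorem, uniformly in the finite set [s]: outside a finite set [s0] the weights are
    bounded and t has small sum, while on [s0] the weights become uniformly small. *)
Lemma tannery (I : eqType) (t : I -> C) (c : nat -> I -> C) B : abs_summable t ->
  (forall M i, `|c M i| <= B) -> (forall i, c ^~ i @ \oo --> (0 : C)) ->
  forall e : C, 0 < e -> exists M0, forall M s, (M0 <= M)%N -> uniq s ->
    `|\sum_(i <- s) c M i * t i| <= e.
Proof.
move=> ht hB hc e e0; have e2 : 0 < e / 2 by rewrite divr_gt0.
have [T T0 hT] := abs_summable_bounded ht.
have B1 : 0 < `|B| + 1 by rewrite ltr_wpDl.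
have BB M i : `|c M i| <= `|B| + 1.
  apply: (le_trans (hB M i)); rewrite -[leLHS]ger0_norm ?lerDl //.
  exact: le_trans (hB M i).
have [s0 h0] := ht _ (divr_gt0 e2 B1).
have [M0 hM0] : exists M0, forall M, (M0 <= M)%N -> forall i, i \in s0 -> `|c M i| <= e / 2 / T.
  elim: s0 {h0} => [|i s0 [M0 IH]]; first by exists 0%N.
  have := (cvgrPdist_le _ _).1 (hc i) _ (divr_gt0 e2 T0) => -[M1 _ hM1].
  exists (maxn M0 M1) => M hM j; rewrite inE => /predU1P[->|js0].
    by have := hM1 M (leq_trans (leq_maxr _ _) hM); rewrite sub0r normrN.
  exact: IH (leq_trans (leq_maxl _ _) hM) _ js0.
exists M0 => M s hM us; rewrite (bigID (mem s0)) /=; apply: (le_trans (ler_normD _ _)).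
rewrite [leRHS]splitr; apply: lerD; rewrite -big_filter; apply: (le_trans (ler_norm_sum _ _ _)).
  apply: (@le_trans _ _ (\sum_(i <- [seq i <- s | i \in s0]) (e / 2 / T) * `|t i|)).
    rewrite !big_seq; apply: ler_sum => i; rewrite mem_filter => /andP[is0 _].
    by rewrite normrM ler_wpM2r // hM0.
  rewrite -mulr_sumr; apply: (@le_trans _ _ (e / 2 / T * T)); last by rewrite divfK // gt_eqF.
  by apply: ler_wpM2l; [rewrite ltW // divr_gt0 | rewrite hT // filter_uniq].
apply: (@le_trans _ _ (\sum_(i <- [seq i <- s | i \notin s0]) (`|B| + 1) * `|t i|)).
  by apply: ler_sum => i _; rewrite normrM ler_wpM2r.
rewrite -mulr_sumr; apply: (@le_trans _ _ ((`|B| + 1) * (e / 2 / (`|B| + 1)))).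
  apply: ler_wpM2l; first exact: ltW.
  apply: h0; first exact: filter_uniq.
  by move=> i; rewrite mem_filter => /andP[].
by rewrite mulrC divfK // gt_eqF.
Qed.

(** A pair outside s1 x s2 has a coordinate outside s1 or s2. Each case is enclosed in a box, where
    the sum is at most a small tail in one variable times a total bound in the other. *)
Lemma abs_summable_prod (I J : eqType) (f : I -> C) (g : J -> C) :
  abs_summable f -> abs_summable g -> abs_summable (fun x : I * J => f x.1 * g x.2).
Proof.
move=> hf hg e e0; have e2 : 0 < e / 2 by rewrite divr_gt0.
have [F F0 hF] := abs_summable_bounded hf; have [G G0 hG] := abs_summable_bounded hg.
have [s1 h1] := hf _ (divr_gt0 e2 G0); have [s2 h2] := hg _ (divr_gt0 e2 F0).
exists (allpairs pair s1 s2) => s us ss.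
pose A := [seq x <- s | x.1 \notin s1]; pose B := [seq x <- s | x.1 \in s1].
have box (s' : seq (I * J)) t1 t2 : uniq s' -> uniq t1 -> uniq t2 ->
    (forall x, x \in s' -> x.1 \in t1 /\ x.2 \in t2) ->
    \sum_(x <- s') `|f x.1 * g x.2| <= (\sum_(i <- t1) `|f i|) * \sum_(j <- t2) `|g j|.
  move=> us' u1 u2 sub.
  apply: (@le_trans _ _ (\sum_(x <- allpairs pair t1 t2) `|f x.1 * g x.2|)).
    rewrite [leRHS](@sum_split _ _ _ s') //.
    - by rewrite lerDl sumr_ge0.
    - by apply: allpairs_uniq => // -[? ?] [? ?] _ _ [-> ->].
    - move=> [i j] /sub[/= it jt]; apply/allpairsP; by exists (i, j).
  rewrite big_allpairs /= mulr_suml; apply: ler_sum => i _.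
  by rewrite mulr_sumr; apply: ler_sum => j _; rewrite normrM.
rewrite (bigID (fun x => x.1 \in s1)) /= [leRHS]splitr; apply: lerD; rewrite -big_filter.
- pose t1 := undup (map fst B); pose t2 := undup (map snd B).
  apply: (le_trans (box _ t1 t2 _ _ _ _)); rewrite ?filter_uniq ?undup_uniq //.
    by move=> x xB; rewrite !mem_undup !map_f.
  apply: (@le_trans _ _ (F * (e / 2 / F))); last by rewrite mulrC divfK // gt_eqF.
  apply: ler_pM; rewrite ?sumr_ge0 ?hF ?undup_uniq //.
  apply: h2; first exact: undup_uniq.
  move=> j; rewrite mem_undup => /mapP[[i j'] ijB -> /=]; apply/negP => js2.
  move: ijB; rewrite mem_filter /= => /andP[is1 /ss /negP]; apply.
  by apply/allpairsP; exists (i, j').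
- pose t1 := undup (map fst A); pose t2 := undup (map snd A).
  apply: (le_trans (box _ t1 t2 _ _ _ _)); rewrite ?filter_uniq ?undup_uniq //.
    by move=> x xB; rewrite !mem_undup !map_f.
  apply: (@le_trans _ _ (e / 2 / G * G)); last by rewrite divfK // gt_eqF.
  apply: ler_pM; rewrite ?sumr_ge0 ?hG ?undup_uniq //.
  apply: h1; first exact: undup_uniq.
  by move=> i; rewrite mem_undup => /mapP[[i' j] ijA -> /=]; move: ijA; rewrite mem_filter => /andP[].
Qed.

Lemma has_sum_prod (I J : eqType) (f : I -> C) (g : J -> C) a b :
  abs_summable f -> abs_summable g -> has_sum f a -> has_sum g b ->
  has_sum (fun x : I * J => f x.1 * g x.2) (a * b).
Proof.
move=> hf hg ha hb; apply: has_sum_cluster; first exact: abs_summable_prod.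
move=> e S0 e0.
have D0 : 0 < `|a| + `|b| + 1 + e by rewrite addr_gt0 // ltr_wpDl // addr_ge0.
(* This gives both d <= 1 and d (|a| + |b| + 1) <= e. *)
set d := e / (`|a| + `|b| + 1 + e).
have d0 : 0 < d by rewrite divr_gt0.
have [s1 h1] := ha _ d0; have [s2 h2] := hb _ d0.
pose t1 := undup (s1 ++ map fst S0); pose t2 := undup (s2 ++ map snd S0).
have u1 : uniq t1 := undup_uniq _.
have u2 : uniq t2 := undup_uniq _.
exists (allpairs pair t1 t2); split.
- by apply: allpairs_uniq => // -[? ?] [? ?] _ _ [-> ->].
- move=> [i j] ijS; apply/allpairsP; exists (i, j); split=> //=.
    by rewrite mem_undup mem_cat (map_f fst ijS) orbT.
  by rewrite mem_undup mem_cat (map_f snd ijS) orbT.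
rewrite big_allpairs /=.
under eq_bigr do rewrite -mulr_sumr.
rewrite -mulr_suml.
have k1 : `|\sum_(i <- t1) f i - a| <= d.
  by apply: h1 => // i si; rewrite mem_undup mem_cat si.
have k2 : `|\sum_(j <- t2) g j - b| <= d.
  by apply: h2 => // i si; rewrite mem_undup mem_cat si.
move: (\sum_(i <- t1) f i) (\sum_(j <- t2) g j) k1 k2 => F G k1 k2.
have -> : F * G - a * b = (F - a) * (G - b) + ((F - a) * b + a * (G - b)) by ring.
have d1 : d <= 1 by rewrite ler_pdivrMr // mul1r lerDr !addr_ge0.
have dE : d * (`|a| + `|b| + 1) <= e.
  have : d * (`|a| + `|b| + 1 + e) = e by rewrite divfK // gt_eqF.
  by move=> <-; rewrite ler_wpM2l ?lerDl ?ltW // mulr_gt0.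
apply: le_trans dE.
have -> : d * (`|a| + `|b| + 1) = d * 1 + (d * `|b| + `|a| * d) by ring.
apply: (le_trans (ler_normD _ _)); apply: lerD.
  by rewrite normrM; apply: ler_pM => //; apply: le_trans d1.
by apply: (le_trans (ler_normD _ _)); rewrite !normrM lerD // ?ler_wpM2r ?ler_wpM2l.
Qed.

Lemma abs_summable_nat (geo : geometric_decay C) (f : nat -> C) :
  (exists k0, forall k, (k0 <= k)%N -> `|f k| <= 2^-1 ^+ k) -> abs_summable f.
Proof.
move=> [k0 hk] e e0.
have h0 : (0 : C) <= 2^-1 by rewrite invr_ge0.
have h1 : (2^-1 : C) < 1 by rewrite invf_lt1 // ltr1n.
have [J hJ] := geo _ _ h0 h1 (divr_gt0 e0 (ltr0n C 2)).
pose K := maxn k0 J; exists (iota 0 K) => s us ss.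
have sK i : i \in s -> (K <= i)%N by move=> /ss; rewrite mem_iota /= add0n -leqNgt.
apply: (@le_trans _ _ (\sum_(i <- s) 2^-1 ^+ i)).
  rewrite !big_seq; apply: ler_sum => i /sK Ki; apply: hk.
  exact: leq_trans (leq_maxl _ _) Ki.
have [M hM] : exists M, forall i, i \in s -> (i < M)%N.
  exists (\max_(i <- s) i).+1 => i si; rewrite ltnS; exact: leq_bigmax_seq.
apply: (@le_trans _ _ (\sum_(K <= i < M) 2^-1 ^+ i)).
  rewrite [leRHS](@sum_split _ _ _ s) ?iota_uniq //.
    by rewrite lerDl sumr_ge0 // => i _; rewrite exprn_ge0.
  by move=> i si; rewrite mem_index_iota sK // hM.
apply: (le_trans (geometric_sum_le _ _ h0 h1)).
have := hJ K (leq_maxr _ _); rewrite ler_pdivlMr // => h.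
have -> : (1 - 2^-1 : C) = 2^-1 by field.
by rewrite invrK.
Qed.

End UnconditionalSums.

(** * The Jacobi triple product *)

Section JacobiTripleProduct.
Variables (C : numFieldType) (s : C).
Hypotheses (geo : geometric_decay C) (complete : cauchy_complete C).
Hypotheses (s0 : s != 0) (s1 : `|s| < 1).
Let p := s ^+ 2.

Let p1 : `|p| < 1.
Proof. by rewrite /p normrX expr_lt1. Qed.

Definition qfact k : C := \prod_(j < k) (1 - p ^+ j.+1).

Lemma qfactS k : qfact k.+1 = qfact k * (1 - p ^+ k.+1).
Proof. by rewrite /qfact big_ord_recr. Qed.

Lemma one_sub_pX_neq0 j : 1 - p ^+ j.+1 != 0.
Proof.
apply/negP => /eqP h; have : `|p ^+ j.+1| < 1 by rewrite normrX exprn_ilt1.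
by rewrite (_ : p ^+ j.+1 = 1) ?normr1 ?ltxx //; apply/eqP; rewrite eq_sym -subr_eq0 h.
Qed.

Lemma qfact_neq0 k : qfact k != 0.
Proof. by apply/prodf_neq0 => j _; exact: one_sub_pX_neq0. Qed.

(** The Gaussian binomial coefficient in base p = s^2. The value 0 for k > N lets the Pascal rule
    hold at the boundary. *)
Definition gauss N k : C := if (k <= N)%N then qfact N / (qfact k * qfact (N - k)) else 0.

Lemma gauss0 N : gauss N 0 = 1.
Proof. by rewrite /gauss subn0 {2}/qfact big_ord0 mul1r divff ?qfact_neq0. Qed.

Lemma gauss_pascal N k : (k <= N)%N ->
  gauss N.+1 k.+1 = gauss N k.+1 + p ^+ (N - k) * gauss N k.
Proof.
rewrite /gauss ltnS leq_eqVlt => /predU1P[->|kN].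
  by rewrite eqxx /= subnn subnn ltnn ?leqnn /qfact big_ord0 expr0 !mulr1 !divff ?add0r ?mulr1 //;
    apply: qfact_neq0.
rewrite kN orbT subSS.
have -> : (N - k = (N - k.+1).+1)%N by lia.
have pN : p ^+ N.+1 = p ^+ (N - k.+1).+1 * p ^+ k.+1 by rewrite -exprD; congr (_ ^+ _); lia.
rewrite !qfactS pN.
have := qfact_neq0 N; have := qfact_neq0 k; have := qfact_neq0 (N - k.+1).
have := one_sub_pX_neq0 k; have := one_sub_pX_neq0 (N - k.+1).
move: (qfact N) (qfact k) (qfact _) (p ^+ _.+1) (p ^+ _.+1) => a b c x y hx hy hc hb ha.
by field; rewrite hx hy hc hb.
Qed.

(** The finite q-binomial theorem in base p = s^2, by induction with the Pascal rule. *)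
Lemma qbinomial N z :
  \prod_(j < N) (1 + s ^+ (2 * j).+1 * z) = \sum_(k < N.+1) gauss N k * (s ^+ (k ^ 2) * z ^+ k).
Proof.
elim: N => [|N IH]; first by rewrite big_ord0 big_ord1 gauss0 !mulr1.
rewrite big_ord_recr /= IH [RHS]big_ord_recl gauss0 !expr0 !mulr1.
have -> : \sum_(k < N.+1) gauss N.+1 (lift ord0 k) * (s ^+ (lift ord0 k ^ 2) * z ^+ (lift ord0 k)) =
    \sum_(k < N.+1) gauss N k.+1 * (s ^+ (k.+1 ^ 2) * z ^+ k.+1) +
    s ^+ (2 * N).+1 * z * \sum_(k < N.+1) gauss N k * (s ^+ (k ^ 2) * z ^+ k).
  rewrite mulr_sumr -big_split; apply: eq_bigr => k _ /=.
  rewrite gauss_pascal; last by rewrite -ltnS.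
  have -> : s ^+ (k.+1 ^ 2) = s ^+ (k ^ 2) * s ^+ (2 * k).+1.
    by rewrite -exprD; congr (_ ^+ _); rewrite -!mulnn; lia.
  have -> : s ^+ (2 * N).+1 = p ^+ (N - k) * s ^+ (2 * k).+1.
    by rewrite /p -exprM -exprD; congr (_ ^+ _); have := ltn_ord k; lia.
  by rewrite [z ^+ k.+1]exprS; ring.
rewrite addrA.
have <- : \sum_(k < N.+2) gauss N k * (s ^+ (k ^ 2) * z ^+ k) =
    1 + \sum_(k < N.+1) gauss N k.+1 * (s ^+ (k.+1 ^ 2) * z ^+ k.+1).
  by rewrite big_ord_recl gauss0 !mulr1.
have gN : gauss N N.+1 = 0 by rewrite /gauss ltnn.
by rewrite [X in _ = X + _]big_ord_recr /= gN mul0r addr0; ring.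
Qed.

(** With p = s^2 and x = - s X this is the usual term p^(n(n-1)/2) (-x)^n of the theta series. *)
Definition jacobi_term (X : C) (n : int) : C := s ^ (n * n) * X ^ n.

(** The q-binomial theorem with 2M factors at z = X s^(-2M). The last M factors are those of theta
    in X. The first M, in reversed order, become those in 1/X after the monomial X^M s^(-M^2) is
    taken out. *)
Lemma jacobi_finite X M : X != 0 ->
  ptheta p (- s * X) M = \sum_(k < (2 * M).+1) gauss (2 * M) k * jacobi_term X (k%:Z - M%:Z).
Proof.
move=> X0; pose z := X * s ^- (2 * M).
have sn k : s ^+ k != 0 by rewrite expf_neq0.
have e1 : \prod_(j < 2 * M) (1 + s ^+ (2 * j).+1 * z) = X ^+ M * s ^- (M ^ 2) * ptheta p (- s * X) M.
  have -> : s ^- (M ^ 2) = \prod_(j < M) s ^- (2 * j).+1.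
    rewrite prodfV; congr (_^-1); rewrite prodrXr; congr (_ ^+ _).
    elim: (M) => [|k IH]; first by rewrite big_ord0.
    by rewrite big_ord_recr /= -IH -!mulnn; lia.
  rewrite mul2n -addnn big_split_ord /= mulrC /ptheta.
  have -> : X ^+ M = \prod_(j < M) X by rewrite prodr_const card_ord.
  rewrite [X in _ * X = _](reindex_inj rev_ord_inj) /= -!big_split; apply: eq_bigr => j _ /=.
  have hj := ltn_ord j.
  have -> : s ^+ (2 * (M + j)).+1 * z = s * p ^+ j * X.
    rewrite /z /p -exprM (_ : (2 * (M + j)).+1 = ((2 * j).+1 + 2 * M)%N); last lia.
    by rewrite exprD exprS; field; rewrite sn.
  have -> : s ^+ (2 * (M - j.+1)).+1 * z = X * s ^- (2 * j).+1.
    have -> : s ^- (2 * j).+1 = s ^+ (2 * (M - j.+1)).+1 * s ^- (2 * M).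
      rewrite (_ : (2 * M)%N = ((2 * (M - j.+1)).+1 + (2 * j).+1)%N); last lia.
      by rewrite exprD; field; rewrite !sn.
    by rewrite /z; ring.
  have -> : p ^+ j.+1 = s * s ^+ (2 * j).+1 by rewrite -exprS /p -exprM; congr (_ ^+ _); lia.
  have -> : s * p ^+ j * X = s ^+ (2 * j).+1 * X by rewrite exprS /p -exprM.
  have -> : p ^+ j * (- s * X) = - (s ^+ (2 * j).+1 * X) by rewrite exprS /p -exprM; ring.
  by field; rewrite sn s0 X0.
have c0 : X ^+ M * s ^- (M ^ 2) != 0 by rewrite mulf_neq0 ?invr_neq0 ?expf_neq0.
apply: (mulfI c0); rewrite -e1 qbinomial mulr_sumr; apply: eq_bigr => k _.
rewrite [RHS]mulrCA; congr (_ * _).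
have -> : s ^+ (k ^ 2) * z ^+ k = s ^ (k%:Z * k%:Z - (2 * M%:Z * k%:Z)) * X ^ k%:Z.
  rewrite /z exprMn exprVn -exprM mulrCA mulrC; congr (_ * _).
  by rewrite !exprnP invr_expz -expfzDr //; congr (_ ^ _).
rewrite /jacobi_term.
have -> : X ^+ M * s ^- (M ^ 2) = s ^ (- (M%:Z * M%:Z)) * X ^ M%:Z.
  by rewrite mulrC; congr (_ * _); rewrite exprnP invr_expz; congr (_ ^ _); rewrite -mulnn; lia.
rewrite mulrACA -!expfzDr //; congr (_ ^ _ * _ ^ _); lia.
Qed.

Lemma qfact_cvg : exists2 Q, Q != 0 & qfact @ \oo --> Q.
Proof.
have pB j : `|p ^+ j.+1| <= 1 * `|p| ^+ j.
  by rewrite mul1r normrX exprS ler_piMl ?exprn_ge0 // ltW.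
have [Q hQ] := prod_cvg (normr_ge0 p) p1 pB geo complete.
exists Q => //.
have h4 : (0 : C) < 4^-1 by rewrite invr_gt0.
have [J /(_ J (leqnn _)) hJ] := tail_small (normr_ge0 p) p1 pB geo h4.
have hJ2 : 1 * (`|p| ^+ J / (1 - `|p|)) <= 2^-1.
  by apply: (le_trans hJ); rewrite lef_pV2 ?posrE // ler_nat.
have := prod_lim_tail (normr_ge0 p) p1 pB hQ hJ2.
move=> h; apply/negP => /eqP Q0; move: h; rewrite Q0 sub0r normrN.
rewrite -[leLHS]mulr1 ler_pM2l ?normr_gt0 ?qfact_neq0 // => h.
suff : (1 : C) < 1 by rewrite ltxx.
apply: (le_lt_trans h); apply: (@le_lt_trans _ _ (2 * 4^-1)); first by rewrite ler_wpM2l.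
by rewrite ltr_pdivrMr // mul1r ltr_nat.
Qed.

Lemma cvg_bounded (u : nat -> C) (l : C) : u @ \oo --> l -> exists B, forall k, `|u k| <= B.
Proof.
move=> ul; have [K _ hK] := (cvgrPdist_le _ _).1 ul 1 ltr01.
exists (`|l| + 1 + \sum_(i < K) `|u i|) => k.
have [kK|Kk] := ltnP k K.
  rewrite (bigD1 (Ordinal kK)) //= addrCA lerDl addr_ge0 ?addr_ge0 //.
  by rewrite sumr_ge0.
apply: (@le_trans _ _ (`|l| + 1)); last by rewrite lerDl sumr_ge0.
have -> : u k = l - (l - u k) by ring.
apply: (le_trans (ler_normB _ _)); rewrite lerD2l; exact: hK.
Qed.

Lemma jacobi_abs_summable X : X != 0 -> abs_summable (jacobi_term X).
Proof.
move=> X0.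
pose g (x : nat + nat) : int := match x with inl k => Posz k | inr k => Negz k end.
pose g' (n : int) : nat + nat := match n with Posz k => inl k | Negz k => inr k end.
have gK : cancel g g' by case.
have g'K : cancel g' g by case.
(* Since s^(k^2) Y^k = (s^k Y)^k, it suffices that |s^k Y| <= 1/2 for large k. The negative half of
   the series is the same estimate with Y = 1/X. *)
have aux (Y : C) : exists k0, forall k, (k0 <= k)%N -> `|s ^+ (k ^ 2) * Y ^+ k| <= 2^-1 ^+ k.
  have Y1 : 0 < `|Y| + 1 by rewrite ltr_wpDl.
  have [|k0 h] := geo (normr_ge0 s) s1 (e := 2^-1 / (`|Y| + 1)).
    by rewrite divr_gt0 // invr_gt0.
  exists k0 => k /h; rewrite ler_pdivlMr // => hk.
  rewrite -mulnn exprM -exprMn normrX lerXn2r ?nnegrE ?invr_ge0 //.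
  rewrite normrM normrX; apply: le_trans hk.
  by rewrite ler_wpM2l ?exprn_ge0 // lerDl.
suff h : abs_summable (jacobi_term X \o g).
  have -> : jacobi_term X = (jacobi_term X \o g) \o g' by apply/funext => n /=; rewrite g'K.
  exact: abs_summable_bij g'K gK h.
apply: abs_summable_ofsum; apply: (abs_summable_nat geo).
  have [k0 h] := aux X; exists k0 => k /h.
  by rewrite /= /jacobi_term -mulnn.
have [k0 h] := aux X^-1; exists k0 => k hk; have := h k.+1 (leqW hk).
have -> : s ^+ (k.+1 ^ 2) * X^-1 ^+ k.+1 = (jacobi_term X \o g \o inr) k.
  by rewrite /= /jacobi_term NegzE mulrNN exprVn; congr (_ * _).
move=> /le_trans; apply; rewrite exprS ler_piMl ?exprn_ge0 ?invr_ge0 //.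
by rewrite invf_le1 // ler1n.
Qed.

Definition centered_range M : seq int := [seq (k%:Z - M%:Z)%R | k <- iota 0 (2 * M).+1].

Lemma mem_centered_range M (n : int) : (n \in centered_range M) = (absz n <= M)%N.
Proof.
apply/mapP/idP => [[k]|nM]; first by rewrite mem_iota => hk ->; lia.
by exists (absz (n + M%:Z)); [rewrite mem_iota; lia | lia].
Qed.

Lemma centered_range_uniq M : uniq (centered_range M).
Proof. by rewrite map_inj_uniq ?iota_uniq // => i j; lia. Qed.

Lemma big_centered_range M (F : nat -> int -> C) :
  \sum_(n <- centered_range M) F (absz (n + M%:Z)) n =
  \sum_(k < (2 * M).+1) F k (k%:Z - M%:Z).
Proof.
rewrite big_map (_ : iota 0 _ = index_iota 0 (2 * M).+1); last by rewrite /index_iota subn0.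
by rewrite big_mkord; apply: eq_bigr => k _; congr (F _ _); lia.
Qed.

Lemma gauss_centered M (n : int) : (absz n <= M)%N ->
  gauss (2 * M) (absz (n + M%:Z)) =
  qfact (2 * M) * ((qfact (absz (M%:Z + n)))^-1 * (qfact (absz (M%:Z - n)))^-1).
Proof.
move=> nM; rewrite /gauss ifT; last lia.
rewrite [n + _]addrC (_ : (2 * M - absz (M%:Z + n)%R)%N = absz (M%:Z - n)); last lia.
by rewrite invfM.
Qed.

(** The limit of [jacobi_finite], exchanged with the sum by Tannery's theorem. The constant is the
    Euler product, the limit of [qfact]; it does not depend on X. *)
Theorem jacobi_triple_product : exists2 Q, Q != 0 & forall X, X != 0 ->
  has_sum (jacobi_term X) (Q * theta p (- s * X)).
Proof.
have [Q Q0 hQ] := qfact_cvg; exists Q => // X X0.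
have hV : (fun k => (qfact k)^-1) @ \oo --> Q^-1 by exact: cvgV.
have [B1 hB1] := cvg_bounded hQ; have [B2 hB2] := cvg_bounded hV.
have x0 : - s * X != 0 by rewrite mulf_neq0 // oppr_eq0.
(* The weight by which the n-th term of the series exceeds Q times the n-th term of the finite
   identity. It tends to 0 because the Gaussian coefficients tend to Q/(Q Q) = 1/Q. *)
pose c M (n : int) : C := if (absz n <= M)%N then
  1 - Q * (qfact (2 * M) * ((qfact (absz (M%:Z + n)))^-1 * (qfact (absz (M%:Z - n)))^-1)) else 0.
have cB M n : `|c M n| <= 1 + `|Q| * (B1 * (B2 * B2)).
  have h : 0 <= `|Q| * (B1 * (B2 * B2)).
    have b1 := le_trans (normr_ge0 _) (hB1 0%N); have b2 := le_trans (normr_ge0 _) (hB2 0%N).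
    by rewrite !mulr_ge0.
  rewrite /c; case: ifP => _; last by rewrite normr0 addr_ge0.
  apply: (le_trans (ler_normB _ _)); rewrite normr1 lerD2l !normrM.
  by rewrite ler_wpM2l // !ler_pM // ?mulr_ge0 //; apply: hB2.
have infty_shift (f : nat -> nat) k : (forall M, (M <= f (M + k))%N) -> f @ \oo --> \oo.
  move=> hf P [N _ hN]; exists (N + k)%N => // M /= hM; apply: hN => /=.
  by have := hf (M - k)%N; rewrite subnK; lia.
have cc n : c ^~ n @ \oo --> (0 : C).
  have l1 : qfact (2 * M) @[M --> \oo] --> Q.
    by apply: (cvg_comp (fun M => 2 * M)%N qfact _ hQ); apply: (infty_shift _ 0%N) => M; lia.
  have l2 : (qfact (absz (M%:Z + n)))^-1 @[M --> \oo] --> Q^-1.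
    have sh : (fun M : nat => absz (M%:Z + n)) @ \oo --> \oo by apply: (infty_shift _ `|n|%N) => M; lia.
    exact: (cvg_comp _ _ sh hV).
  have l3 : (qfact (absz (M%:Z - n)))^-1 @[M --> \oo] --> Q^-1.
    have sh : (fun M : nat => absz (M%:Z - n)) @ \oo --> \oo by apply: (infty_shift _ `|n|%N) => M; lia.
    exact: (cvg_comp _ _ sh hV).
  have -> : (0 : C) = 1 - Q * (Q * (Q^-1 * Q^-1)) by field.
  have h := cvgB (cvg_cst (1 : C)) (cvgM (cvg_cst Q) (cvgM l1 (cvgM l2 l3))).
  apply: (@cvg_trans _ ((fun M : nat => 1 - Q * (qfact (2 * M) *
    ((qfact (absz (M%:Z + n)))^-1 * (qfact (absz (M%:Z - n)))^-1))) @ \oo)); last exact: h.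
  apply: near_eq_cvg.
  by exists `|n|%N => // M /= nM; rewrite /c nM.
have ht := jacobi_abs_summable X0.
apply: has_sum_cluster => // e S0 e0; have e2 : 0 < e / 2 by rewrite divr_gt0.
have [M0 hM0] := tannery ht cB cc e2.
have hth : Q * ptheta p (- s * X) M @[M --> \oo] --> Q * theta p (- s * X).
  by apply: cvgM; [exact: cvg_cst | exact: theta_cvg].
have [M1 _ hM1] := (cvgrPdist_le _ _).1 hth _ e2.
have [M2 hM2] : exists M2, forall n, n \in S0 -> (absz n <= M2)%N.
  by exists (\max_(n <- S0) `|n|%N) => n nS; exact: leq_bigmax_seq.
have [M [MM0 MM1 MM2]] : exists M, [/\ (M0 <= M)%N, (M1 <= M)%N & (M2 <= M)%N].
  by exists (maxn M0 (maxn M1 M2)); rewrite !leq_max !leqnn !orbT.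
exists (centered_range M); split.
- exact: centered_range_uniq.
- by move=> n /hM2 h; rewrite mem_centered_range (leq_trans h).
have -> : \sum_(n <- centered_range M) jacobi_term X n - Q * theta p (- s * X) =
   (\sum_(n <- centered_range M) c M n * jacobi_term X n) -
   (Q * theta p (- s * X) - Q * ptheta p (- s * X) M).
  suff -> : \sum_(n <- centered_range M) c M n * jacobi_term X n =
    \sum_(n <- centered_range M) jacobi_term X n - Q * ptheta p (- s * X) M by ring.
  rewrite jacobi_finite // -(big_centered_range M (fun k n => gauss (2 * M) k * jacobi_term X n)).
  rewrite mulr_sumr -sumrB !big_seq; apply: eq_bigr => /= n; rewrite mem_centered_range => nM.
  by rewrite /c nM gauss_centered //; ring.
apply: (le_trans (ler_normB _ _)); rewrite [leRHS]splitr; apply: lerD.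
  exact: hM0 (centered_range_uniq M).
exact: hM1.
Qed.

End JacobiTripleProduct.

(** * The three-term relation *)

Section LatticeSplit.

(** Splits the lattice of pairs (n, m) by the parity of n + m. For n = i + j and m = i - j one has
    n^2 + m^2 = 2(i^2 + j^2), so a product of two series in s becomes, on each class, a product of
    two series in s^2. *)
Definition parity_join (x : int * int + int * int) : int * int :=
  match x with
  | inl (i, j) => (i + j, i - j)
  | inr (i, j) => (i + j + 1, i - j)
  end.

Definition parity_split (x : int * int) : int * int + int * int :=
  let i := ((x.1 + x.2) %/ 2)%Z in
  if ((x.1 + x.2) %% 2)%Z == 0 then inl (i, i - x.2) else inr (i, i - x.2).

Lemma parity_joinK : cancel parity_join parity_split.
Proof.
case=> -[i j]; rewrite /parity_split /=.
  rewrite (_ : i + j + (i - j) = i * 2); last by ring.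
  by rewrite modzMl eqxx mulzK // (_ : i - (i - j) = j) //; ring.
rewrite (_ : i + j + 1 + (i - j) = i * 2 + 1); last by ring.
rewrite modzMDl divzMDl // (_ : (1 %/ 2)%Z = 0) // (_ : (1 %% 2)%Z == 0 = false) // addr0.
by rewrite (_ : i - (i - j) = j) //; ring.
Qed.

Lemma parity_splitK : cancel parity_split parity_join.
Proof.
move=> [n m]; rewrite /parity_split /=.
have := divz_eq (n + m) 2; have := modz_ge0 (n + m) (isT : (2 : int) != 0).
have := ltz_pmod (n + m) (isT : 0 < (2 : int)).
move: ((n + m) %/ 2)%Z ((n + m) %% 2)%Z => k r r2 r0 e.
by case: eqP => r0' /=; congr (_, _); lia.
Qed.

End LatticeSplit.

Section ThreeTerm.
Variables (C : numClosedFieldType).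
Hypotheses (geo : geometric_decay C) (complete : cauchy_complete C).

Definition is_jacobi (s : C) (f : C -> C) : Prop :=
  forall X, X != 0 -> has_sum (jacobi_term s X) (f X).

Lemma jacobi_product (s X Y : C) (f g : C -> C) : s != 0 -> `|s| < 1 -> X != 0 -> Y != 0 ->
  is_jacobi s f -> is_jacobi (s ^+ 2) g ->
  f X * f Y = g (X * Y) * g (X / Y) + s * X * (g (s ^+ 2 * (X * Y)) * g (s ^+ 2 * (X / Y))).
Proof.
move=> s0 s1 X0 Y0 hf hg.
have s20 : s ^+ 2 != 0 by rewrite expf_neq0.
have s21 : `|s ^+ 2| < 1 by rewrite normrX expr_lt1.
have XY0 : X * Y != 0 by rewrite mulf_neq0.
have XV0 : X / Y != 0 by rewrite mulf_neq0 ?invr_neq0.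
have XY2 : s ^+ 2 * (X * Y) != 0 by rewrite mulf_neq0.
have XV2 : s ^+ 2 * (X / Y) != 0 by rewrite mulf_neq0.
have sum_s Z : Z != 0 -> abs_summable (jacobi_term s Z) by exact: jacobi_abs_summable.
have sum_s2 Z : Z != 0 -> abs_summable (jacobi_term (s ^+ 2) Z) by exact: jacobi_abs_summable.
have pw n : (s ^+ 2) ^ n = s ^ (2 * n) by rewrite exprnP exprz_exp.
have h1 := has_sum_prod (sum_s _ X0) (sum_s _ Y0) (hf _ X0) (hf _ Y0).
have h2 := has_sum_bij parity_joinK parity_splitK h1.
apply: (has_sum_unique h2); apply: has_sum_ofsum.
  have h3 := has_sum_prod (sum_s2 _ XY0) (sum_s2 _ XV0) (hg _ XY0) (hg _ XV0).
  rewrite (_ : _ \o inl = fun x : int * int => jacobi_term (s ^+ 2) (X * Y) x.1 * jacobi_term (s ^+ 2) (X / Y) x.2) //.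
  apply/funext => -[i j] /=; rewrite /jacobi_term !pw !expfzMl // !exprz_inv !expfzDr //.
  have e : s ^ ((i + j) * (i + j)) * s ^ ((i - j) * (i - j)) = s ^ (2 * (i * i)) * s ^ (2 * (j * j)).
    by rewrite -!expfzDr //; congr (_ ^ _); ring.
  transitivity (s ^ ((i + j) * (i + j)) * s ^ ((i - j) * (i - j)) * (X ^ i * X ^ j * (Y ^ i * Y ^ - j))).
    by ring.
  by rewrite e; ring.
have h3 := has_sum_scale (s * X) (has_sum_prod (sum_s2 _ XY2) (sum_s2 _ XV2) (hg _ XY2) (hg _ XV2)).
rewrite (_ : _ \o inr = fun x : int * int => s * X * (jacobi_term (s ^+ 2) (s ^+ 2 * (X * Y)) x.1 * jacobi_term (s ^+ 2) (s ^+ 2 * (X / Y)) x.2)) //.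
apply/funext => -[i j] /=; rewrite /jacobi_term ![(s ^+ 2 * _) ^ _]expfzMl // !pw !expfzMl // !exprz_inv.
have -> : X ^ (i + j + 1) = X ^ i * X ^ j * X by rewrite !expfzDr.
have -> : Y ^ (i - j) = Y ^ i * Y ^ (- j) by rewrite expfzDr.
have e : s ^ ((i + j + 1) * (i + j + 1)) * s ^ ((i - j) * (i - j)) =
    s * (s ^ (2 * (i * i)) * s ^ (2 * i)) * (s ^ (2 * (j * j)) * s ^ (2 * j)).
  rewrite -[X in _ = X * _ * _]expr1z -!expfzDr //; congr (_ ^ _); ring.
transitivity (s ^ ((i + j + 1) * (i + j + 1)) * s ^ ((i - j) * (i - j)) *
   (X ^ i * X ^ j * X * (Y ^ i * Y ^ - j))); first by ring.
by rewrite e; ring.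
Qed.

(** The shift n -> n + 1 of the summation index: (n + 1)^2 - (n + 1) = n^2 + n. *)
Lemma jacobi_shift (s X : C) (f : C -> C) : s != 0 -> X != 0 -> is_jacobi s f ->
  f (X / s) = X * f (s * X).
Proof.
move=> s0 X0 hf.
have h1 := hf (X / s) (mulf_neq0 X0 (invr_neq0 s0)).
have h2 := has_sum_scale X (hf (s * X) (mulf_neq0 s0 X0)).
have gK : cancel (fun n : int => n + 1) (fun n => n - 1) by move=> n; ring.
have g'K : cancel (fun n : int => n - 1) (fun n => n + 1) by move=> n; ring.
have h3 := has_sum_bij gK g'K h1.
apply: (has_sum_unique h3).
rewrite (_ : _ \o _ = fun n => X * jacobi_term s (s * X) n) //.
apply/funext => n /=; rewrite /jacobi_term !expfzMl // exprz_inv.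
have -> : X ^ (n + 1) = X ^ n * X by rewrite expfzDr.
have e : s ^ ((n + 1) * (n + 1)) * s ^ (- (n + 1)) = s ^ (n * n) * s ^ n.
  by rewrite -!expfzDr //; congr (_ ^ _); ring.
transitivity (s ^ ((n + 1) * (n + 1)) * s ^ (- (n + 1)) * (X ^ n * X)); first by ring.
by rewrite e; ring.
Qed.

Definition theta_rank2 (p : C) : Prop := exists (k : C) (A B : C -> C), k != 0 /\
  forall x y, x != 0 -> y != 0 ->
    k * (theta p (x * y) * theta p (x / y)) = x * (A x * B y - B x * A y).

Lemma theta_rank2P (p : C) : `|p| < 1 -> theta_rank2 p.
Proof.
move=> p1; have [->|p0] := eqVneq p 0.
  exists 1, (fun x => x + x^-1), (fun=> 1); split; first exact: oner_neq0.
  have thE z : z != 0 -> theta (0 : C) z = 1 - z.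
    move=> z0; have := theta_cvg geo complete (p := 0) _ z0; rewrite normr0 => /(_ ltr01) h.
    apply: (cvg_unique (@norm_hausdorff _ _) h).
    apply: (@cvg_trans _ ((fun _ : nat => 1 - z) @ \oo)); last exact: cvg_cst.
    apply: near_eq_cvg; exists 1%N => // -[//|M] _ /=.
    rewrite /ptheta big_ord_recl big1 => [|j _]; rewrite ?expr0 !exprS !mul0r !subr0 ?mul1r ?mulr1 //.
  move=> x y x0 y0; rewrite !thE ?mulf_neq0 ?invr_neq0 //.
  by field; rewrite x0 y0.
pose s := sqrtC p.
have sp : s ^+ 2 = p by rewrite sqrtCK.
have s0 : s != 0 by rewrite sqrtC_eq0.
have s1 : `|s| < 1 by rewrite -(@expr_lt1 _ 2) // -normrX sp.
have [Q Q0 hQ] := jacobi_triple_product geo complete s0 s1.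
have p0' : s ^+ 2 != 0 by rewrite sp.
have p1' : `|s ^+ 2| < 1 by rewrite sp.
have [Q' Q'0 hQ'] := jacobi_triple_product geo complete p0' p1'.
pose f X := Q * theta (s ^+ 2) (- s * X).
pose g X := Q' * theta ((s ^+ 2) ^+ 2) (- (s ^+ 2) * X).
exists (Q * Q), (fun x => x * g (s ^+ 2 * x ^+ 2)), (fun x => g (x ^+ 2)).
split; first by rewrite mulf_neq0.
move=> x y x0 y0.
(* With X = - xy/s and Y = - (x/y)/s the arguments - s X and - s Y of theta are xy and x/y, while XY
   = x^2/s^2 and X/Y = y^2 separate the variables x and y on the right of [jacobi_product]. *)
have X0 : - (x * y) / s != 0 by rewrite mulf_neq0 ?invr_neq0 ?oppr_eq0 ?mulf_neq0.
have Y0 : - (x / y) / s != 0 by rewrite !mulf_neq0 ?invr_neq0 ?oppr_eq0 ?mulf_neq0 ?invr_neq0.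
have hf : is_jacobi s f := hQ; have hg : is_jacobi (s ^+ 2) g := hQ'.
have := jacobi_product s0 s1 X0 Y0 hf hg.
have -> : - (x * y) / s * (- (x / y) / s) = x ^+ 2 / s ^+ 2 by field; rewrite s0 y0.
have -> : - (x * y) / s / (- (x / y) / s) = y ^+ 2 by field; rewrite s0 y0 x0.
have -> : s ^+ 2 * (x ^+ 2 / s ^+ 2) = x ^+ 2 by field.
rewrite (jacobi_shift p0' _ hg) ?expf_neq0 // /f.
have -> : - s * (- (x * y) / s) = x * y by field.
have -> : - s * (- (x / y) / s) = x / y by field; rewrite s0 y0.
have -> : s * (- (x * y) / s) = - (x * y) by field.
rewrite sp => e.
transitivity (Q * theta p (x * y) * (Q * theta p (x / y))); first by ring.
by rewrite e /g; ring.
Qed.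

Theorem theta_lawsP (p : C) : `|p| < 1 -> theta_laws (theta p).
Proof.
move=> p1; split.
- exact: theta_inv.
- move=> A U V c A0 U0 V0 c0.
  have [k [F [G [k0 h]]]] := theta_rank2P p1.
  pose x := sqrtC c; have xx : x ^+ 2 = c by rewrite sqrtCK.
  have x0 : x != 0 by rewrite sqrtC_eq0.
  pose y := A / x; pose u := U / x; pose v := V / x.
  have y0 : y != 0 by rewrite mulf_neq0 ?invr_neq0.
  have u0 : u != 0 by rewrite mulf_neq0 ?invr_neq0.
  have v0 : v != 0 by rewrite mulf_neq0 ?invr_neq0.
  have -> : c / A = x / y by rewrite -xx /y; field; rewrite x0 A0.
  have -> : c / U = x / u by rewrite -xx /u; field; rewrite x0 U0.
  have -> : c / V = x / v by rewrite -xx /v; field; rewrite x0 V0.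
  have AE : A = x * y by rewrite /y; field.
  have UE : U = x * u by rewrite /u; field.
  have VE : V = x * v by rewrite /v; field.
  rewrite AE UE VE -xx.
  have -> : x * u * (x * v) / x ^+ 2 = u * v by field.
  have -> : x * u / (x * v) = u / v by field; rewrite x0 v0.
  have -> : x * y * (x * v) / x ^+ 2 = y * v by field.
  have -> : x * y / (x * v) = y / v by field; rewrite x0 v0.
  have -> : x * y * (x * u) / x ^+ 2 = y * u by field.
  have -> : x * y / (x * u) = y / u by field; rewrite x0 u0.
  apply: (mulfI (mulf_neq0 k0 k0)); rewrite mulr0.
  transitivity (k * (theta p (x * y) * theta p (x / y)) * (k * (theta p (u * v) * theta p (u / v))) / (x * u)
    - k * (theta p (x * u) * theta p (x / u)) * (k * (theta p (y * v) * theta p (y / v))) / (x * y)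
    + k * (theta p (x * v) * theta p (x / v)) * (k * (theta p (y * u) * theta p (y / u))) / (x * y)).
    by ring.
  by rewrite !h //; field; rewrite x0 y0 u0.
- exact: theta_cont.
- exact: theta_near1_nonzero.
Qed.

End ThreeTerm.

(** * Geometric decay and completeness for the complex numbers *)

Section ComplexNumbers.
Variable R : realType.

Lemma complex_geometric_decay : geometric_decay (R[i] : numFieldType).
Proof.
(* The order on complex numbers compares only numbers with equal imaginary parts, so [r] and [e] are
   real and the claim reduces to the real one. *)
move=> [r i] [e j]; rewrite !ltcE !lecE /= => /andP[/eqP -> r0] /andP[_ r1] /andP[/eqP -> e0].
have r1' : `|r| < 1 by rewrite ger0_norm.
have [J _ hJ] := (cvgrPdist_le _ _).1 (cvg_expr r1') _ e0.
exists J => M /hJ; rewrite sub0r normrN normrX ger0_norm // => h.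
have -> : (r +i* 0)%C ^+ M = (r ^+ M)%:C%C by rewrite rmorphXn.
by rewrite lecE /= eqxx.
Qed.

Lemma complex_complete : cauchy_complete (R[i] : numFieldType).
Proof.
move=> u hu.
(* Applied to the real and the imaginary part, both additive and bounded by the norm. *)
have real_part (f : R[i] -> R) : (forall x y, f (x - y) = f x - f y) ->
    (forall x, (`|f x|%:C <= `|x|)%C) -> cvgn (f \o u).
  move=> fB fn; apply/cauchy_cvgP; apply: cauchy_exP => e e0.
  have e20 : (0 : R[i]) < (e / 2)%:C%C by rewrite ltcR divr_gt0.
  have [J hJ] := hu _ e20.
  exists (f (u J)); exists J => // M /= /hJ h.
  rewrite /ball /= distrC -fB.
  have : `|f (u M - u J)| <= e / 2 by rewrite -lecR; apply: le_trans h.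
  by move=> /le_lt_trans; apply; rewrite ltr_pdivrMr // ltr_pMr // ltr1n.
have Re_le (x : R[i]) : (`|complex.Re x|%:C <= `|x|)%C by exact: normc_ge_Re.
have Im_le (x : R[i]) : (`|complex.Im x|%:C <= `|x|)%C.
  by rewrite normc_def lecR -sqrtr_sqr ler_wsqrtr // lerDr sqr_ge0.
have ReB (x y : R[i]) : complex.Re (x - y) = complex.Re x - complex.Re y by case: x => ? ?; case: y.
have ImB (x y : R[i]) : complex.Im (x - y) = complex.Im x - complex.Im y by case: x => ? ?; case: y.
have h1 := real_part _ ReB Re_le; have h2 := real_part _ ImB Im_le.
set l1 := lim _ in h1; set l2 := lim _ in h2.
exists (l1 +i* l2)%C.
apply: (cvgrPdist_le (F := \oo) _ _).2 => -[e j].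
rewrite ltcE /= => /andP[/eqP -> e0].
have e2 : 0 < e / 2 by rewrite divr_gt0.
have [J1 _ hJ1] := (cvgrPdist_le _ _).1 h1 _ e2.
have [J2 _ hJ2] := (cvgrPdist_le _ _).1 h2 _ e2.
exists (maxn J1 J2) => // M /=; rewrite geq_max => /andP[/hJ1 k1 /hJ2 k2].
rewrite normc_def lecR -[leRHS](ger0_norm (ltW e0)) -sqrtr_sqr ler_wsqrtr //.
rewrite ReB ImB /=.
have sq x : `|x| <= e / 2 -> x ^+ 2 <= (e / 2) ^+ 2.
  by move=> hx; rewrite -real_normK ?num_real // lerXn2r ?nnegrE // ltW.
apply: (le_trans (lerD (sq _ k1) (sq _ k2))).
have -> : (e / 2) ^+ 2 + (e / 2) ^+ 2 = e ^+ 2 / 2 by field.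
by rewrite ler_pdivrMr // ler_peMr ?ler1n // sqr_ge0.
Qed.

End ComplexNumbers.

Theorem corollary4p1 (R : realType) (p q : R[i]) (n N m : nat)
    (z : 'I_n -> R[i]) (w1 w2 : R[i]) (a : 'I_(n + 2) -> R[i])
    (hp : `|p| < 1) (hq : q != 0) (hn : (1 <= n)%N) (hm : (m <= n)%N)
    (hz : forall k, z k != 0) (hw1 : w1 != 0) (hw2 : w2 != 0)
    (ha : forall j, a j != 0)
    (balancing : w1 * w2 = (\prod_(k < n) z k) * \prod_(j < n + 2) a j)
    (hden_lhs : nonzero_denominators p q w1 w2 N z)
    (hden_rhs : nonzero_denominators p q w1 w2 N (new_x q w1 w2 N m a z))
    (hden_pre : forall j : 'I_n, (j < n - m)%N ->
       epoch p q (w1 * z j) N * epoch p q (w2 * z j) N != 0) :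
  composition_sum p q w1 w2 N a z =
  (\prod_(j < n | (j < n - m)%N)
     ((a (lshift 2 j) * z j) ^+ N
      * epoch p q (w1 / a (lshift 2 j)) N * epoch p q (w2 / a (lshift 2 j)) N
      / (epoch p q (w1 * z j) N * epoch p q (w2 * z j) N)))
  * composition_sum p q w1 w2 N (new_b q w1 w2 N m a z)
      (new_x q w1 w2 N m a z).
Proof.
have thP := theta_lawsP (@complex_geometric_decay R) (@complex_complete R) hp.
exact: (transformation thP hq hn hz hw1 hw2 ha balancing hden_lhs hden_rhs).
Qed.
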